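(* Let $n\ge1$ and $m\ge0$ be integers. If $m<n$, then $\mathrm{Ext}^*(\mathrm{Pa}_m,\mathrm T^n\circ\mathrm{ab})$ is concentrated in degree $*=n-m$; furthermore, $\mathrm{Ext}^{n-m}(\mathrm{Pa}_m,\mathrm T^n\circ\mathrm{ab})$ is a free abelian group, which is non-trivial for $m>0$. If $m\ge n$, then $\mathrm{Ext}^0(\mathrm{Pa}_m,\mathrm T^n\circ\mathrm{ab})\cong\mathbb Z$ and $\mathrm{Ext}^*(\mathrm{Pa}_m,\mathrm T^n\circ\mathrm{ab})\cong0$ for $*>0$.
   Context: $\mathrm{Ext}$ is taken in the abelian category of functors from finitely generated free groups to abelian groups. $\mathrm{Pa}_m(G)=I(G)/I(G)^{m+1}$ is the $m$-th Passi functor, where $I(G)=\ker(\mathbb Z[G]\to\mathbb Z)$ is the augmentation ideal; $\mathrm{ab}$ is abelianization and $\mathrm T^n$ the $n$-fold tensor power. *)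

(* Defs.v *)
From HB Require Import structures.
From mathcomp Require Import all_boot all_algebra ring_quotient generic_quotient.
From mathcomp Require Import boolp freeg.

Set Implicit Arguments.
Unset Strict Implicit.
Unset Printing Implicit Defensive.

Import GRing.Theory.
Local Open Scope ring_scope.
Local Open Scope quotient_scope.

Lemma additive_ext (A B : zmodType) (f g : {additive A -> B}) :
  f =1 g -> f = g.
Proof.
case: f g => f [[[f0 fD]]] [g [[[g0 gD]]]] /= /funext fg.
case: g / fg g0 gD => g0 gD.
by rewrite (Prop_irrelevance f0 g0) (Prop_irrelevance fD gD).
Qed.

Definition fgU (K : choiceType) (x : K) : {freeg K / int} := << x >>.

Section FreeAbelian.
Variables (K : choiceType) (A : zmodType).

Definition fgext (f : K -> A) : {freeg K / int} -> A :=
  @fglift int (zmodule A) K f.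

Lemma fgext_is_additive (f : K -> A) : zmod_morphism (fgext f).
Proof. exact: (@lift_is_additive int K (zmodule A) f). Qed.

HB.instance Definition _ (f : K -> A) :=
  GRing.isZmodMorphism.Build {freeg K / int} A (fgext f) (fgext_is_additive f).

Lemma fgextU (f : K -> A) (x : K) : fgext f (fgU x) = f x.
Proof. by rewrite /fgext /fgU liftU scale1r. Qed.

Lemma freeg_additive_ext (f g : {additive {freeg K / int} -> A}) :
  (forall x, f (fgU x) = g (fgU x)) -> f =1 g.
Proof.
move=> fg D; rewrite -(freeg_sumE D) !raddf_sum.
apply: eq_bigr => z _.
rewrite -[coeff z D]intz -[_%:~R]/(1 *~ coeff z D) -freegU_mulz.
by rewrite !raddfMz -/(fgU z) fg.
Qed.

End FreeAbelian.

Definition zspan (A : zmodType) (P : A -> Prop) : {pred A} :=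
  fun x => `[< forall S : zmodClosed A, (forall y, P y -> y \in S) -> x \in S >].

Section Span.
Variables (A : zmodType) (P : A -> Prop).

Lemma zspanP x :
  (x \in zspan P) <->
  (forall S : zmodClosed A, (forall y, P y -> y \in S) -> x \in S).
Proof. by split=> [/asboolP|?]; last exact/asboolP. Qed.

Lemma zspan_closed : zmod_closed (zspan P).
Proof.
split=> [|x y /zspanP xP /zspanP yP]; apply/zspanP => S PS; first exact: rpred0.
by rewrite rpredB ?xP ?yP.
Qed.

HB.instance Definition _ := GRing.isZmodClosed.Build A (zspan P) zspan_closed.

Lemma mem_zspan x : P x -> x \in zspan P.
Proof. by move=> Px; apply/zspanP => S; apply. Qed.

End Span.

Section Preimage.
Variables (A B : zmodType) (f : {additive A -> B}) (S : zmodClosed B).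

Definition zpreim : {pred A} := fun x => f x \in S.

Lemma zpreim_closed : zmod_closed zpreim.
Proof.
split=> [|x y xS yS]; first by rewrite -[_ \in _]/(f 0 \in S) raddf0 rpred0.
by rewrite -[_ \in _]/(f (x - y) \in S) raddfB rpredB.
Qed.

HB.instance Definition _ := GRing.isZmodClosed.Build A zpreim zpreim_closed.

End Preimage.

Section Kernel.
Variables (A B : zmodType) (f : {additive A -> B}).

Definition zker : {pred A} := fun x => f x == 0.

Lemma zker_closed : zmod_closed zker.
Proof.
split=> [|x y]; rewrite !unfold_in /zker ?raddf0 // => /eqP fx /eqP fy.
by rewrite raddfB fx fy subr0.
Qed.

HB.instance Definition _ := GRing.isZmodClosed.Build A zker zker_closed.

End Kernel.

Section SubZmod.
Variables (A : zmodType) (S : zmodClosed A).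

Record subz := Subz { subz_val : A; subz_valP : subz_val \in S }.

HB.instance Definition _ := [isSub for subz_val].
HB.instance Definition _ := [Choice of subz by <:].
HB.instance Definition _ := [SubChoice_isSubZmodule of subz by <:].

End SubZmod.

Lemma zspan_image (A B : zmodType) (f : {additive A -> B}) (P : A -> Prop)
    (S : zmodClosed B) :
  (forall x, P x -> f x \in S) -> forall x, x \in zspan P -> f x \in S.
Proof. by move=> fP x /zspanP/(_ (zpreim f S)); apply. Qed.

Section InducedMaps.
Variables (A B : zmodType) (S : zmodClosed A) (T : zmodClosed B).
Variables (f : {additive A -> B}).
Hypothesis fST : forall x, x \in S -> f x \in T.

Definition subz_map (x : subz S) : subz T := Subz (fST (subz_valP x)).

Lemma subz_map_is_additive : zmod_morphism subz_map.
Proof. by move=> x y; apply: val_inj; rewrite /= !raddfB. Qed.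

HB.instance Definition _ :=
  GRing.isZmodMorphism.Build (subz S) (subz T) subz_map subz_map_is_additive.

Definition quot_fun (x : Quotient.quot S) : Quotient.quot T :=
  \pi_(Quotient.quot T) (f (repr x)).

Lemma quot_fun_pi x :
  quot_fun (\pi_(Quotient.quot S) x) = \pi_(Quotient.quot T) (f x).
Proof.
apply/eqP; rewrite -Quotient.idealrBE -raddfB fST //.
by rewrite Quotient.idealrBE reprK.
Qed.

Lemma quot_fun_is_additive : zmod_morphism quot_fun.
Proof.
elim/quotW=> x; elim/quotW=> y.
by rewrite -raddfB !quot_fun_pi !raddfB.
Qed.

Definition quot_map : {additive Quotient.quot S -> Quotient.quot T} :=
  HB.pack quot_fun (GRing.isZmodMorphism.Build (Quotient.quot S)
    (Quotient.quot T) quot_fun quot_fun_is_additive).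

Lemma quot_map_pi x :
  quot_map (\pi_(Quotient.quot S) x) = \pi_(Quotient.quot T) (f x).
Proof. exact: quot_fun_pi. Qed.

End InducedMaps.


Definition grhom (G H : groupType) := UMagmaMorphism.type G H.
Identity Coercion grhom_morphism : grhom >-> UMagmaMorphism.type.

Section GroupHom.
Variables G H : groupType.

Lemma grhom_ext (f g : grhom G H) : f =1 g -> f = g.
Proof.
case: f g => f [[f1] [fM]] [g [[g1] [gM]]] /= /funext fg.
case: g / fg g1 gM => g1 gM.
by rewrite (Prop_irrelevance f1 g1) (Prop_irrelevance fM gM).
Qed.

HB.instance Definition _ := gen_eqMixin (grhom G H).
HB.instance Definition _ := gen_choiceMixin (grhom G H).

End GroupHom.

Definition grid (G : groupType) : grhom G G :=
  UMagmaMorphism.clone G G idfun _.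
Definition grcomp (G H K : groupType) (g : grhom H K) (f : grhom G H) :
  grhom G K := UMagmaMorphism.clone G K (g \o f) _.

(* The free group on [n] generators: words in the letters [(false, i)] (the
   i-th generator) and [(true, i)] (its inverse), modulo the congruence
   generated by cancellation. *)

Section FreeGroup.
Variable n : nat.

Definition word := seq (bool * 'I_n).

Inductive word_cong : word -> word -> Prop :=
| WCancel b i : word_cong [:: (b, i); (~~ b, i)] [::]
| WRefl u : word_cong u u
| WSym u v : word_cong u v -> word_cong v u
| WTrans u v w : word_cong u v -> word_cong v w -> word_cong u w
| WCat u u' v v' :
    word_cong u u' -> word_cong v v' -> word_cong (u ++ v) (u' ++ v').

Definition word_eqv : rel word := fun u v => `[< word_cong u v >].

Lemma word_eqv_class : equiv_class_of word_eqv.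
Proof.
split=> [u|u v|v u w]; first exact/asboolP/WRefl.
  by apply/asboolP/asboolP; apply: WSym.
by move=> /asboolP uv /asboolP vw; apply/asboolP/(WTrans uv vw).
Qed.

Canonical word_equiv := EquivRelPack word_eqv_class.
Canonical word_encModRel := defaultEncModRel word_eqv.

Definition freegrp := {eq_quot word_eqv}.

HB.instance Definition _ : EqQuotient word word_eqv freegrp := EqQuotient.on freegrp.
HB.instance Definition _ := Choice.on freegrp.

Lemma FG_eqP u v : \pi_freegrp u = \pi_freegrp v <-> word_cong u v.
Proof. by split=> [/eqmodP/asboolP|uv]; last exact/eqmodP/asboolP. Qed.

Lemma FG_reprP u : word_cong (repr (\pi_freegrp u)) u.
Proof. by apply/FG_eqP; rewrite reprK. Qed.

Definition winv (u : word) : word := rev [seq (~~ l.1, l.2) | l <- u].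

Lemma winvK : involutive winv.
Proof.
move=> u; rewrite /winv map_rev revK -map_comp -[RHS]map_id.
by apply: eq_map => -[b i] /=; rewrite negbK.
Qed.

Lemma winv_cat u v : winv (u ++ v) = winv v ++ winv u.
Proof. by rewrite /winv map_cat rev_cat. Qed.

Lemma winv_cong u v : word_cong u v -> word_cong (winv u) (winv v).
Proof.
elim=> {u v} [b i|u|u v _ /WSym//|u v w _ uv _ /(WTrans uv)//|u u' v v' _ uu _ vv].
- by rewrite /winv /= /rev /= negbK; exact: WCancel.
- exact: WRefl.
- by rewrite !winv_cat; exact: WCat.
Qed.

Lemma winvr u : word_cong (u ++ winv u) [::].
Proof.
elim: u => [|[b i] u IHu]; first exact: WRefl.
rewrite -cat1s winv_cat -catA (catA u).
apply: WTrans (WCancel b i).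
apply: (@WCat [:: (b, i)] [:: (b, i)] _ [:: (~~ b, i)] (WRefl _)).
exact: (WCat IHu (WRefl [:: (~~ b, i)])).
Qed.

Definition FG_one : freegrp := \pi_freegrp [::].
Definition FG_inv (x : freegrp) : freegrp := \pi_freegrp (winv (repr x)).
Definition FG_mul (x y : freegrp) : freegrp := \pi_freegrp (repr x ++ repr y).

Lemma FG_mul_pi u v : FG_mul (\pi_freegrp u) (\pi_freegrp v) = \pi_freegrp (u ++ v).
Proof. by apply/FG_eqP; apply: WCat; apply: FG_reprP. Qed.

Lemma FG_inv_pi u : FG_inv (\pi_freegrp u) = \pi_freegrp (winv u).
Proof. by apply/FG_eqP; apply: winv_cong; exact: FG_reprP. Qed.

Lemma FG_mulA : associative FG_mul.
Proof.
elim/quotW=> u; elim/quotW=> v; elim/quotW=> w.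
by rewrite (FG_mul_pi v w) (FG_mul_pi u v) !FG_mul_pi catA.
Qed.

Lemma FG_mul1 : left_id FG_one FG_mul.
Proof. by elim/quotW=> u; rewrite FG_mul_pi. Qed.

Lemma FG_mulr1 : right_id FG_one FG_mul.
Proof. by elim/quotW=> u; rewrite FG_mul_pi cats0. Qed.

Lemma FG_mulVg : left_inverse FG_one FG_inv FG_mul.
Proof.
elim/quotW=> u; rewrite FG_inv_pi FG_mul_pi.
by apply/FG_eqP; rewrite -{2}[u]winvK; exact: winvr.
Qed.

Lemma FG_mulgV : right_inverse FG_one FG_inv FG_mul.
Proof. by elim/quotW=> u; rewrite FG_inv_pi FG_mul_pi; apply/FG_eqP/winvr. Qed.

HB.instance Definition _ :=
  isGroup.Build freegrp FG_mulA FG_mul1 FG_mulr1 FG_mulVg FG_mulgV.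

Definition FG : groupType := Group.clone freegrp _.

Definition FG_gen (i : 'I_n) : FG := \pi_freegrp [:: (false, i)].

End FreeGroup.

Section Abelianization.
Variable G : groupType.
Local Open Scope group_scope.

Definition derived : {pred G} :=
  fun x => `[< forall S : groupClosed G, (forall y z, [~ y, z] \in S) -> x \in S >].

Lemma derivedP x :
  (x \in derived) <->
  (forall S : groupClosed G, (forall y z, [~ y, z] \in S) -> x \in S).
Proof. by split=> [/asboolP|?]; last exact/asboolP. Qed.

Lemma derivedR y z : [~ y, z] \in derived.
Proof. exact/derivedP. Qed.

Lemma derived1 : 1 \in derived.
Proof. by apply/derivedP => S _; exact: gpred1. Qed.

Lemma derivedM : mulg_closed derived.
Proof.
move=> x y /derivedP xS /derivedP yS; apply/derivedP => S RS.
by rewrite gpredM ?xS ?yS.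
Qed.

Lemma derivedV : invg_closed derived.
Proof. by move=> x /derivedP xS; apply/derivedP => S RS; rewrite gpredVr ?xS. Qed.

HB.instance Definition _ := isMulClosed.Build G derived derivedM.
HB.instance Definition _ := isMul1Closed.Build G derived derived1.
HB.instance Definition _ := isInvClosed.Build G derived derivedV.

Lemma derivedJ x y : x \in derived -> x ^ y \in derived.
Proof. by move=> xD; rewrite -[x ^ y](mulVKg x) gpredM ?derivedR. Qed.

Definition ab_eqv : rel G := fun x y => x^-1 * y \in derived.

Lemma ab_eqv_class : equiv_class_of ab_eqv.
Proof.
rewrite /ab_eqv; split=> [x|x y|y x z]; first by rewrite mulVg derived1.
  by rewrite -gpredV invgM invgK.
by move=> xy yz; rewrite -[z](mulVKg y) mulgA gpredM.
Qed.

Canonical ab_equiv := EquivRelPack ab_eqv_class.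
Canonical ab_encModRel := defaultEncModRel ab_eqv.

Definition ab := {eq_quot ab_eqv}.

HB.instance Definition _ : EqQuotient G ab_eqv ab := EqQuotient.on ab.
HB.instance Definition _ := Choice.on ab.

Lemma ab_eqP x y : \pi_ab x = \pi_ab y <-> x^-1 * y \in derived.
Proof. by split=> [/eqmodP|xy]; last exact/eqmodP. Qed.

Lemma ab_reprP x : (repr (\pi_ab x))^-1 * x \in derived.
Proof. by apply/ab_eqP; rewrite reprK. Qed.

Definition ab_zero : ab := \pi_ab 1.
Definition ab_opp (x : ab) : ab := \pi_ab (repr x)^-1.
Definition ab_add (x y : ab) : ab := \pi_ab (repr x * repr y).

Lemma ab_add_pi x y : ab_add (\pi_ab x) (\pi_ab y) = \pi_ab (x * y).
Proof.
apply/ab_eqP; set x' := repr _; set y' := repr _.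
have -> : (x' * y')^-1 * (x * y) = (x'^-1 * x) ^ y' * (y'^-1 * y).
  by rewrite invgM conjgE !mulgA mulgK.
by rewrite gpredM ?derivedJ ?ab_reprP.
Qed.

Lemma ab_opp_pi x : ab_opp (\pi_ab x) = \pi_ab x^-1.
Proof.
apply/ab_eqP; set x' := repr _.
have -> : (x'^-1)^-1 * x^-1 = ((x'^-1 * x) ^ x'^-1)^-1.
  by rewrite conjgE invgK -mulgA mulVKg invgM invgK.
by rewrite gpredV derivedJ ?ab_reprP.
Qed.

Lemma ab_addA : associative ab_add.
Proof.
elim/quotW=> x; elim/quotW=> y; elim/quotW=> z.
by rewrite (ab_add_pi y z) (ab_add_pi x y) !ab_add_pi mulgA.
Qed.

Lemma ab_addC : commutative ab_add.
Proof.
elim/quotW=> x; elim/quotW=> y; rewrite !ab_add_pi; apply/ab_eqP.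
have -> : (x * y)^-1 * (y * x) = [~ y, x].
  by rewrite invgM commgEl conjgE !mulgA.
exact: derivedR.
Qed.

Lemma ab_add0 : left_id ab_zero ab_add.
Proof. by elim/quotW=> x; rewrite ab_add_pi mul1g. Qed.

Lemma ab_addN : left_inverse ab_zero ab_opp ab_add.
Proof. by elim/quotW=> x; rewrite ab_opp_pi ab_add_pi mulVg. Qed.

HB.instance Definition _ :=
  GRing.isZmodule.Build ab ab_addA ab_addC ab_add0 ab_addN.

Lemma ab_piD x y : \pi_ab (x * y) = (\pi_ab x + \pi_ab y)%R.
Proof. exact/esym/ab_add_pi. Qed.

Lemma ab_piV x : \pi_ab x^-1 = (- \pi_ab x)%R.
Proof. exact/esym/ab_opp_pi. Qed.

End Abelianization.

Arguments derived : clear implicits.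

Section AbelianizationMap.
Variables (G H : groupType) (f : grhom G H).

Definition gpreim (S : groupClosed H) : {pred G} := fun x => f x \in S.

Lemma gpreim_mulg_closed S : mulg_closed (gpreim S).
Proof. 
move=> x y xS yS; rewrite -[_ \in _]/(f (x * y)%g \in S) gmulfM.
exact: gpredM.
 Qed.

Lemma gpreim1 S : 1%g \in gpreim S.
Proof. by rewrite -[_ \in _]/(f 1%g \in S) gmulf1 gpred1. Qed.

Lemma gpreimV S : invg_closed (gpreim S).
Proof. by move=> x xS; rewrite -[_ \in _]/(f x^-1%g \in S) gmulfV gpredV. Qed.

HB.instance Definition _ S := isMulClosed.Build G (gpreim S) (@gpreim_mulg_closed S).
HB.instance Definition _ S := isMul1Closed.Build G (gpreim S) (@gpreim1 S).
HB.instance Definition _ S := isInvClosed.Build G (gpreim S) (@gpreimV S).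

Lemma derived_map x : x \in derived G -> f x \in derived H.
Proof.
move=> /derivedP/(_ (gpreim (derived H))); apply=> y z.
by rewrite -[_ \in _]/(f [~ y, z]%g \in derived H) gmulfR derivedR.
Qed.

Definition ab_map (x : ab G) : ab H := \pi_(ab H) (f (repr x)).

Lemma ab_map_pi x : ab_map (\pi_(ab G) x) = \pi_(ab H) (f x).
Proof. by apply/ab_eqP; rewrite -gmulfV -gmulfM derived_map ?ab_reprP. Qed.

Lemma ab_map_is_additive : zmod_morphism ab_map.
Proof.
elim/quotW=> x; elim/quotW=> y; rewrite -ab_piV -ab_piD !ab_map_pi.
by rewrite gmulfM gmulfV ab_piD ab_piV.
Qed.

HB.instance Definition _ :=
  GRing.isZmodMorphism.Build (ab G) (ab H) ab_map ab_map_is_additive.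

End AbelianizationMap.

Section GroupRing.
Variable G : groupType.

Definition ZG := {freeg G / int}.

HB.instance Definition _ := GRing.Lmodule.on ZG.

Definition ZG_mul (x y : ZG) : ZG :=
  fgext (fun g => fgext (fun h => fgU (g * h)%g : ZG) y) x.

Lemma ZG_mulUU (g h : G) : ZG_mul (fgU g) (fgU h) = fgU (g * h)%g.
Proof. by rewrite /ZG_mul !fgextU. Qed.

Definition ZG_mulr (y x : ZG) : ZG := ZG_mul x y.

Lemma ZG_mulBl y : zmod_morphism (ZG_mulr y).
Proof. exact: fgext_is_additive. Qed.

HB.instance Definition _ y :=
  GRing.isZmodMorphism.Build ZG ZG (ZG_mulr y) (ZG_mulBl y).

Lemma ZG_mulBr x : zmod_morphism (ZG_mul x).
Proof.
move=> y z.
pose f w := fun g => fgext (fun h => fgU (g * h)%g : ZG) w.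
apply: (@freeg_additive_ext G ZG (fgext (f (y - z))) (fgext (f y) \- fgext (f z))).
by move=> g; rewrite /= !fgextU /f raddfB.
Qed.

HB.instance Definition _ x :=
  GRing.isZmodMorphism.Build ZG ZG (ZG_mul x) (ZG_mulBr x).

Lemma ZG_mulA : associative ZG_mul.
Proof.
move=> x y z.
apply: (@freeg_additive_ext G ZG (ZG_mulr (ZG_mul y z))
          (ZG_mulr z \o ZG_mulr y)) => g.
apply: (@freeg_additive_ext G ZG (ZG_mul (fgU g) \o ZG_mulr z)
          (ZG_mulr z \o ZG_mul (fgU g))) => /= h.
apply: (@freeg_additive_ext G ZG (ZG_mul (fgU g) \o ZG_mul (fgU h))
          (ZG_mul (ZG_mul (fgU g) (fgU h)))) => /= k.
by rewrite !ZG_mulUU mulgA.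
Qed.

Lemma ZG_mul1l : left_id (fgU 1%g : ZG) ZG_mul.
Proof.
apply: (@freeg_additive_ext G ZG (ZG_mul (fgU 1%g)) idfun) => g /=.
by rewrite ZG_mulUU mul1g.
Qed.

Lemma ZG_mul1r : right_id (fgU 1%g : ZG) ZG_mul.
Proof.
apply: (@freeg_additive_ext G ZG (ZG_mulr (fgU 1%g)) idfun) => g.
rewrite /= /ZG_mulr.
by rewrite ZG_mulUU mulg1.
Qed.

Lemma ZG_mulDl : left_distributive ZG_mul +%R.
Proof. by move=> x y z; exact: (raddfD (ZG_mulr z)). Qed.

Lemma ZG_mulDr : right_distributive ZG_mul +%R.
Proof. by move=> x y z; exact: raddfD. Qed.

Lemma ZG_1neq0 : (fgU 1%g : ZG) != 0.
Proof. by rewrite /fgU freegU_eq0. Qed.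

HB.instance Definition _ :=
  GRing.Zmodule_isNzRing.Build ZG
    ZG_mulA ZG_mul1l ZG_mul1r ZG_mulDl ZG_mulDr ZG_1neq0.

(* The augmentation, i.e. the sum of the coefficients. *)
Definition augm : {additive ZG -> int} := @deg G.

Definition aug_ideal : zmodClosed ZG := zker augm.

(* [I(G)^k] for [k > 0]: the subgroup generated by the [k]-fold products of
   elements of [I(G)]. *)
Definition aug_power (k : nat) : zmodClosed ZG :=
  zspan (fun x : ZG => exists y : 'I_k -> ZG,
    (forall i, y i \in aug_ideal) /\ x = \prod_i y i).

Definition aug_power_in (m : nat) : zmodClosed (subz aug_ideal) :=
  zpreim (val : subz aug_ideal -> ZG) (aug_power m.+1).

Definition Passi (m : nat) : zmodType :=
  GRing.Zmodule.clone (Quotient.quot (aug_power_in m)) _.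

End GroupRing.

Section GroupRingMap.
Variables (G H : groupType) (f : grhom G H).

Definition ZG_map : ZG G -> ZG H := fgext (fun g => fgU (f g) : ZG H).

HB.instance Definition _ := GRing.Additive.on ZG_map.

Lemma ZG_mapU g : ZG_map (fgU g) = fgU (f g).
Proof. exact: fgextU. Qed.

Lemma ZG_map_monoid : monoid_morphism ZG_map.
Proof.
split; first by rewrite -[1]/(fgU 1%g : ZG G) ZG_mapU gmulf1.
move=> x y.
apply: (@freeg_additive_ext G (ZG H) (ZG_map \o ZG_mulr y)
          (ZG_mulr (ZG_map y) \o ZG_map)) => g.
apply: (@freeg_additive_ext G (ZG H) (ZG_map \o ZG_mul (fgU g))
          (ZG_mul (ZG_map (fgU g)) \o ZG_map)) => h.
by rewrite /= ZG_mulUU !ZG_mapU ZG_mulUU gmulfM.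
Qed.

HB.instance Definition _ :=
  GRing.isMonoidMorphism.Build (ZG G) (ZG H) ZG_map ZG_map_monoid.

Lemma augm_map x : augm H (ZG_map x) = augm G x.
Proof.
apply: (@freeg_additive_ext G int (augm H \o ZG_map) (augm G)) => g /=.
by rewrite ZG_mapU /fgU !degU.
Qed.

Lemma aug_ideal_map x : x \in aug_ideal G -> ZG_map x \in aug_ideal H.
Proof.
move=> /eqP xI; rewrite -[_ \in _]/(augm H (ZG_map x) == 0).
by rewrite augm_map xI.
Qed.

Lemma aug_power_map k x : x \in aug_power G k -> ZG_map x \in aug_power H k.
Proof.
apply: zspan_image => {x} _ [y [yI ->]]; apply: mem_zspan.
exists (fun i => ZG_map (y i)); split=> [i|]; first exact: aug_ideal_map.
exact: rmorph_prod.
Qed.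

Definition aug_ideal_hom : subz (aug_ideal G) -> subz (aug_ideal H) :=
  subz_map aug_ideal_map.

HB.instance Definition _ := GRing.Additive.on aug_ideal_hom.

Lemma aug_power_in_map m x :
  x \in aug_power_in G m -> aug_ideal_hom x \in aug_power_in H m.
Proof. exact: aug_power_map. Qed.

Definition Passi_map (m : nat) : {additive Passi G m -> Passi H m} :=
  quot_map (@aug_power_in_map m).

End GroupRingMap.

(* The tensor power [T^n(A)] is presented as the free abelian group on [A^n]
   modulo multilinearity; for [n = 0] there is no relation and it is [Z]. *)

Section Tensor.
Variables (n : nat) (A : zmodType).

Definition multilin_rel (x : {freeg {ffun 'I_n -> A} / int}) : Prop :=
  exists (i : 'I_n) (u v w : {ffun 'I_n -> A}),
    [/\ w i = u i + v i,
        forall j, j != i -> u j = w j /\ v j = w j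
      & x = fgU w - fgU u - fgU v].

Definition tensor : zmodType :=
  GRing.Zmodule.clone (Quotient.quot (zspan multilin_rel)) _.

End Tensor.

Section TensorMap.
Variables (n : nat) (A B : zmodType) (f : {additive A -> B}).

Definition tuples_map :
    {freeg {ffun 'I_n -> A} / int} -> {freeg {ffun 'I_n -> B} / int} :=
  fgext (fun u : {ffun 'I_n -> A} => fgU ([ffun i => f (u i)] : {ffun 'I_n -> B})).

HB.instance Definition _ := GRing.Additive.on tuples_map.

Lemma tuples_mapU u : tuples_map (fgU u) = fgU [ffun i => f (u i)].
Proof. exact: fgextU. Qed.

Lemma multilin_rel_map x :
  x \in zspan (@multilin_rel n A) -> tuples_map x \in zspan (@multilin_rel n B).
Proof.
apply: zspan_image => {x} _ [i [u [v [w [wi wj ->]]]]]; apply: mem_zspan.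
exists i, [ffun j => f (u j)], [ffun j => f (v j)], [ffun j => f (w j)].
split=> [|j ji|]; first by rewrite !ffunE wi raddfD.
  by rewrite !ffunE; have [-> ->] := wj _ ji.
by rewrite !raddfB /= !tuples_mapU.
Qed.

Definition tensor_map : {additive tensor n A -> tensor n B} :=
  quot_map multilin_rel_map.

End TensorMap.

(* Functors from finitely generated free groups to abelian groups. The source
   category, which is not small, is represented by its standard skeleton: the
   object [a : nat] stands for the free group [FG a], and the morphisms from
   [a] to [b] are all the group homomorphisms [FG a -> FG b]. *)

Record functor := Functor {
  fobj :> nat -> zmodType;
  fmap : forall a b, grhom (FG a) (FG b) -> {additive fobj a -> fobj b};
  fmap_id : forall a x, fmap (grid (FG a)) x = x;
  fmap_comp : forall a b c (f : grhom (FG a) (FG b)) (g : grhom (FG b) (FG c)) x,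
    fmap (grcomp g f) x = fmap g (fmap f x)
}.

Arguments fmap F [a b] f : rename.
Arguments fmap_id F [a] x : rename.
Arguments fmap_comp F [a b c] f g x : rename.

Section PassiFunctor.
Variable m : nat.

Lemma Passi_mapU (G H : groupType) (f : grhom G H) (x : subz (aug_ideal G)) :
  Passi_map f m (\pi_(Quotient.quot (aug_power_in G m)) x) = \pi_(Quotient.quot (aug_power_in H m)) (aug_ideal_hom f x).
Proof. exact: quot_map_pi. Qed.

Lemma ZG_map_id (G : groupType) : ZG_map (grid G) =1 id.
Proof.
apply: (@freeg_additive_ext G (ZG G) (ZG_map (grid G)) idfun) => g.
exact: ZG_mapU.
Qed.

Lemma ZG_map_comp (G H K : groupType) (f : grhom G H) (g : grhom H K) :
  ZG_map (grcomp g f) =1 ZG_map g \o ZG_map f.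
Proof.
apply: (@freeg_additive_ext G (ZG K) (ZG_map (grcomp g f)) (ZG_map g \o ZG_map f)).
by move=> x /=; rewrite !ZG_mapU.
Qed.

Lemma Passi_map_id a (x : Passi (FG a) m) : Passi_map (grid (FG a)) m x = x.
Proof.
elim/quotW: x => x; rewrite Passi_mapU; congr (\pi_ _ _).
by apply: val_inj; exact: ZG_map_id.
Qed.

Lemma Passi_map_comp a b c (f : grhom (FG a) (FG b)) (g : grhom (FG b) (FG c))
    (x : Passi (FG a) m) :
  Passi_map (grcomp g f) m x = Passi_map g m (Passi_map f m x).
Proof.
elim/quotW: x => x; rewrite (Passi_mapU f) (Passi_mapU g) Passi_mapU.
by congr (\pi_ _ _); apply: val_inj; exact: (ZG_map_comp f g (subz_val x)).
Qed.

Definition Pa : functor := Functor Passi_map_id Passi_map_comp.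

End PassiFunctor.

Section TensorFunctor.
Variable n : nat.

Definition Tab_map a b (f : grhom (FG a) (FG b)) :
    {additive tensor n (ab (FG a)) -> tensor n (ab (FG b))} :=
  tensor_map n (ab_map f).

Lemma Tab_mapU a b (f : grhom (FG a) (FG b)) x :
  Tab_map f (\pi_(Quotient.quot (zspan (@multilin_rel n (ab (FG a))))) x)
  = \pi_(Quotient.quot (zspan (@multilin_rel n (ab (FG b))))) (tuples_map (ab_map f) x).
Proof. exact: quot_map_pi. Qed.

Lemma Tab_map_id a (x : tensor n (ab (FG a))) : Tab_map (grid (FG a)) x = x.
Proof.
elim/quotW: x => x; rewrite Tab_mapU; congr (\pi_ _ _).
move: x; apply: (@freeg_additive_ext _ _ (tuples_map (ab_map (grid _))) idfun).
move=> u; rewrite /= tuples_mapU; congr (fgU _); apply/ffunP => i; rewrite ffunE.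
by elim/quotW: (u i) => g; exact: (ab_map_pi (grid _)).
Qed.

Lemma Tab_map_comp a b c (f : grhom (FG a) (FG b)) (g : grhom (FG b) (FG c))
    (x : tensor n (ab (FG a))) :
  Tab_map (grcomp g f) x = Tab_map g (Tab_map f x).
Proof.
elim/quotW: x => x; rewrite (Tab_mapU f) (Tab_mapU g) Tab_mapU; congr (\pi_ _ _).
move: x; apply: (@freeg_additive_ext _ _ (tuples_map (ab_map (grcomp g f)))
                   (tuples_map (ab_map g) \o tuples_map (ab_map f))).
move=> u /=; rewrite !tuples_mapU; congr (fgU _); apply/ffunP => i.
rewrite !ffunE; elim/quotW: (u i) => h /=.
by rewrite (ab_map_pi f) (ab_map_pi g) ab_map_pi.
Qed.

(* [T^n o ab] *)
Definition Tab : functor := Functor Tab_map_id Tab_map_comp.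

End TensorFunctor.

Record nat_trans (F G : functor) := NatTrans {
  nt_fun :> forall a, {additive F a -> G a};
  nt_natural : forall a b (f : grhom (FG a) (FG b)) x,
    nt_fun b (fmap F f x) = fmap G f (nt_fun a x)
}.

Section NatTrans.
Variables F G : functor.
Implicit Types phi psi : nat_trans F G.

Lemma nat_trans_ext phi psi : (forall a, phi a =1 psi a) -> phi = psi.
Proof.
case: phi psi => [p pn] [q qn] /= pq.
have e : p = q by apply: functional_extensionality_dep => a; apply/additive_ext/pq.
by case: q / e qn pq => qn _; congr NatTrans; exact: Prop_irrelevance.
Qed.

HB.instance Definition _ := gen_eqMixin (nat_trans F G).
HB.instance Definition _ := gen_choiceMixin (nat_trans F G).

Lemma nt_zero_natural a b (f : grhom (FG a) (FG b)) (x : F a) :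
  (\0 : F b -> G b) (fmap F f x) = fmap G f ((\0 : F a -> G a) x).
Proof. by rewrite /= raddf0. Qed.

Definition nt_zero : nat_trans F G :=
  @NatTrans F G (fun a => \0) nt_zero_natural.

Lemma nt_add_natural phi psi a b (f : grhom (FG a) (FG b)) (x : F a) :
  (phi b \+ psi b) (fmap F f x) = fmap G f ((phi a \+ psi a) x).
Proof. by rewrite /= !nt_natural raddfD. Qed.

Definition nt_add phi psi : nat_trans F G :=
  @NatTrans F G (fun a => phi a \+ psi a) (@nt_add_natural phi psi).

Lemma nt_opp_natural phi a b (f : grhom (FG a) (FG b)) (x : F a) :
  (\- phi b) (fmap F f x) = fmap G f ((\- phi a) x).
Proof. by rewrite /= nt_natural raddfN. Qed.

Definition nt_opp phi : nat_trans F G :=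
  @NatTrans F G (fun a => \- phi a) (@nt_opp_natural phi).

Lemma nt_addA : associative nt_add.
Proof. by move=> p q r; apply: nat_trans_ext => a x /=; rewrite addrA. Qed.

Lemma nt_addC : commutative nt_add.
Proof. by move=> p q; apply: nat_trans_ext => a x /=; rewrite addrC. Qed.

Lemma nt_add0 : left_id nt_zero nt_add.
Proof. by move=> p; apply: nat_trans_ext => a x /=; rewrite add0r. Qed.

Lemma nt_addN : left_inverse nt_zero nt_opp nt_add.
Proof. by move=> p; apply: nat_trans_ext => a x /=; rewrite addNr. Qed.

HB.instance Definition _ :=
  GRing.isZmodule.Build (nat_trans F G) nt_addA nt_addC nt_add0 nt_addN.

End NatTrans.

Section Composition.
Variables F G H : functor.

Lemma nt_comp_natural (psi : nat_trans G H) (phi : nat_trans F G)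
    a b (f : grhom (FG a) (FG b)) (x : F a) :
  (psi b \o phi b) (fmap F f x) = fmap H f ((psi a \o phi a) x).
Proof. by rewrite /= !nt_natural. Qed.

Definition nt_comp (psi : nat_trans G H) (phi : nat_trans F G) : nat_trans F H :=
  @NatTrans F H (fun a => psi a \o phi a) (@nt_comp_natural psi phi).

Definition nt_precomp (phi : nat_trans F G) (psi : nat_trans G H) :
  nat_trans F H := nt_comp psi phi.

Lemma nt_precomp_is_additive phi : zmod_morphism (nt_precomp phi).
Proof. by move=> p q; exact: nat_trans_ext. Qed.

HB.instance Definition _ phi :=
  GRing.isZmodMorphism.Build (nat_trans G H) (nat_trans F H)
    (nt_precomp phi) (nt_precomp_is_additive phi).

End Composition.

(* Epimorphisms of functors are the pointwise surjections. *)
Definition nt_epi (F G : functor) (p : nat_trans F G) : Prop :=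
  forall a (y : G a), exists x, p a x = y.

Definition nt_exact (F G H : functor) (f : nat_trans F G) (g : nat_trans G H) :
    Prop :=
  forall a (y : G a), g a y = 0 <-> exists x, f a x = y.

Definition projective (P : functor) : Prop :=
  forall (F G : functor) (p : nat_trans F G) (f : nat_trans P G),
    nt_epi p -> exists g : nat_trans P F, nt_comp p g = f.

Record proj_resolution (F : functor) := ProjResolution {
  res :> nat -> functor;
  res_diff : forall i, nat_trans (res i.+1) (res i);
  res_aug : nat_trans (res 0) F;
  res_projective : forall i, projective (res i);
  res_aug_epi : nt_epi res_aug;
  res_exact0 : nt_exact (res_diff 0) res_aug;
  res_exact : forall i, nt_exact (res_diff i.+1) (res_diff i)
}.

(* The standard projective resolution: the covering [freeF F -> F] is the direct
   sum, over all objects [b] and all [x : F b], of the maps [Z[Hom(b, -)] -> F]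
   corresponding to [x] under the Yoneda lemma, and the resolution is obtained
   by iterating on kernels. *)

Section FreeCover.
Variable F : functor.

Definition freeF_basis (a : nat) := {b : nat & (F b * grhom (FG b) (FG a))%type}.

HB.instance Definition _ a := Choice.on (freeF_basis a).

Definition freeF_gen b a (x : F b) (g : grhom (FG b) (FG a)) :
  {freeg (freeF_basis a) / int} := fgU (existT _ b (x, g) : freeF_basis a).

Definition freeF_map a a' (f : grhom (FG a) (FG a')) :
    {additive {freeg (freeF_basis a) / int} -> {freeg (freeF_basis a') / int}} :=
  fgext (fun z : freeF_basis a =>
    freeF_gen (projT2 z).1 (grcomp f (projT2 z).2)).

Lemma freeF_mapU b a a' (x : F b) (g : grhom (FG b) (FG a))
    (f : grhom (FG a) (FG a')) :
  freeF_map f (freeF_gen x g) = freeF_gen x (grcomp f g).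
Proof. exact: fgextU. Qed.

Lemma freeF_map_id a x : freeF_map (grid (FG a)) x = x.
Proof.
apply: (freeg_additive_ext (g := idfun)) => -[b [y g]].
rewrite [LHS]freeF_mapU; congr (freeF_gen _ _); exact: grhom_ext.
Qed.

Lemma freeF_map_comp a b c (f : grhom (FG a) (FG b)) (g : grhom (FG b) (FG c)) x :
  freeF_map (grcomp g f) x = freeF_map g (freeF_map f x).
Proof.
apply: (freeg_additive_ext (g := freeF_map g \o freeF_map f)) => -[d [y h]].
rewrite [LHS]freeF_mapU /= [in RHS]freeF_mapU freeF_mapU.
by congr (freeF_gen _ _); exact: grhom_ext.
Qed.

Definition freeF : functor := Functor freeF_map_id freeF_map_comp.

Section Extension.
Variables (G : functor) (t : forall b, F b -> G b).

Definition freeF_ext_fun a : {additive freeF a -> G a} :=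
  fgext (fun z : freeF_basis a => fmap G (projT2 z).2 (t (projT2 z).1)).

Lemma freeF_ext_funU b a (x : F b) (g : grhom (FG b) (FG a)) :
  freeF_ext_fun a (freeF_gen x g) = fmap G g (t x).
Proof. exact: fgextU. Qed.

Lemma freeF_ext_natural a b (f : grhom (FG a) (FG b)) (x : freeF a) :
  freeF_ext_fun b (fmap freeF f x) = fmap G f (freeF_ext_fun a x).
Proof.
apply: (freeg_additive_ext (f := freeF_ext_fun b \o freeF_map f)
          (g := fmap G f \o freeF_ext_fun a)) => -[d [y h]].
rewrite /= -[fgU _]/(freeF_gen y h) freeF_mapU !freeF_ext_funU.
exact: fmap_comp.
Qed.

Definition freeF_ext : nat_trans freeF G := NatTrans freeF_ext_natural.

End Extension.

Lemma freeF_nt_eq (G : functor) (p q : nat_trans freeF G) :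
  (forall b (x : F b), p b (freeF_gen x (grid (FG b)))
                       = q b (freeF_gen x (grid (FG b)))) ->
  p = q.
Proof.
move=> pq; apply: nat_trans_ext => a.
apply: freeg_additive_ext => -[b [x g]].
have -> : fgU (existT _ b (x, g) : freeF_basis a)
          = fmap freeF g (freeF_gen x (grid (FG b))).
  by rewrite [RHS]freeF_mapU; congr (freeF_gen _ _); exact: grhom_ext.
by rewrite !nt_natural pq.
Qed.

Lemma freeF_projective : projective freeF.
Proof.
move=> G H p f p_epi.
have [t tE] : exists t : forall b, F b -> G b,
    forall b x, p b (t b x) = f b (freeF_gen x (grid (FG b))).
  have c b (x : F b) : {y : G b | p b y = f b (freeF_gen x (grid (FG b)))}.
    exact/constructive_indefinite_description/p_epi.
  by exists (fun b x => sval (c b x)) => b x; exact: svalP (c b x).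
exists (freeF_ext t); apply: freeF_nt_eq => b x /=.
by rewrite [freeF_ext_fun _ _ _]freeF_ext_funU fmap_id tE.
Qed.

Definition freeF_counit : nat_trans freeF F := freeF_ext (fun b x => x).

Lemma freeF_counit_epi : nt_epi freeF_counit.
Proof.
move=> a y; exists (freeF_gen y (grid (FG a))).
by rewrite [LHS]freeF_ext_funU fmap_id.
Qed.

End FreeCover.

Section KernelFunctor.
Variables (F G : functor) (p : nat_trans F G).

Lemma kerF_stable a b (f : grhom (FG a) (FG b)) x :
  x \in zker (p a) -> fmap F f x \in zker (p b).
Proof.
move=> /eqP px; rewrite -[_ \in _]/(p b (fmap F f x) == 0).
by rewrite nt_natural px raddf0.
Qed.

Definition kerF_map a b (f : grhom (FG a) (FG b)) :
    {additive subz (zker (p a)) -> subz (zker (p b))} :=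
  subz_map (@kerF_stable a b f).

Lemma kerF_map_id a x : kerF_map (grid (FG a)) x = x.
Proof. by apply: val_inj; exact: fmap_id. Qed.

Lemma kerF_map_comp a b c (f : grhom (FG a) (FG b)) (g : grhom (FG b) (FG c)) x :
  kerF_map (grcomp g f) x = kerF_map g (kerF_map f x).
Proof. by apply: val_inj; exact: fmap_comp. Qed.

Definition kerF : functor := Functor kerF_map_id kerF_map_comp.

Definition kerF_incl : nat_trans kerF F :=
  @NatTrans kerF F (fun a => val : subz (zker (p a)) -> F a)
    (fun a b f x => erefl).

Lemma kerF_exact : nt_exact kerF_incl p.
Proof.
move=> a y; split=> [py|[x <-]]; last by apply/eqP; exact: (valP x).
by have yK : y \in zker (p a) by [apply/eqP]; exists (Subz yK).
Qed.

End KernelFunctor.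

Section StandardResolution.
Variable F : functor.

Fixpoint syzygy (i : nat) : functor :=
  if i is j.+1 then kerF (freeF_counit (syzygy j)) else F.

Definition std_diff i : nat_trans (freeF (syzygy i.+1)) (freeF (syzygy i)) :=
  nt_comp (kerF_incl (freeF_counit (syzygy i))) (freeF_counit (syzygy i.+1)).

Lemma std_exact (G : functor) i (p : nat_trans (freeF (syzygy i)) G) :
  nt_exact (kerF_incl (freeF_counit (syzygy i))) p -> nt_exact (std_diff i) p.
Proof.
move=> ex a y; rewrite ex; split=> [[x <-]|[x <-]]; last by eexists.
by have [z <-] := freeF_counit_epi x; exists z.
Qed.

Lemma std_exact0 : nt_exact (std_diff 0) (freeF_counit F).
Proof. exact/std_exact/kerF_exact. Qed.

Lemma std_exactS i : nt_exact (std_diff i.+1) (std_diff i).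
Proof.
apply: std_exact => a y; rewrite -kerF_exact; split=> [/= y0|/= ->].
  exact: val_inj.
exact: (raddf0 (kerF_incl (freeF_counit (syzygy i)) a)).
Qed.

Definition std_resolution : proj_resolution F :=
  ProjResolution (fun i => @freeF_projective (syzygy i))
    (@freeF_counit_epi F) std_exact0 std_exactS.

End StandardResolution.

(* The cohomology of the cochain complex [Hom(P, G)]; there are no nonzero
   coboundaries in degree 0. *)

Section Cohomology.
Variables (F G : functor) (P : proj_resolution F).

Definition cocycles (i : nat) : zmodClosed (nat_trans (P i) G) :=
  zker (nt_precomp (H := G) (res_diff P i)).

Definition is_coboundary (i : nat) : nat_trans (P i) G -> Prop :=
  if i is j.+1 then
    fun phi => exists psi, phi = nt_precomp (res_diff P j) psi
  else fun phi => phi = 0.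

Definition coboundaries (i : nat) : {pred subz (cocycles i)} :=
  fun phi => `[< is_coboundary (val phi) >].

Lemma coboundaries_closed i : zmod_closed (@coboundaries i).
Proof.
split=> [|x y /asboolP xB /asboolP yB]; apply/asboolP.
  by case: i => [|i] //=; exists 0; rewrite raddf0.
case: i x y xB yB => [|i] x y /=; first by move=> -> ->; rewrite subr0.
by move=> [u ->] [v ->]; exists (u - v); rewrite raddfB.
Qed.

HB.instance Definition _ i :=
  GRing.isZmodClosed.Build (subz (cocycles i)) (@coboundaries i)
    (@coboundaries_closed i).

Definition cohomology (i : nat) : zmodType :=
  GRing.Zmodule.clone (Quotient.quot (@coboundaries i)) _.

End Cohomology.

Definition Ext (F G : functor) (i : nat) : zmodType :=
  cohomology G (std_resolution F) i.

Definition zmod_iso (A B : zmodType) : Prop :=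
  exists f : {additive A -> B}, bijective f.

Definition zmod_trivial (A : zmodType) : Prop := forall x : A, x = 0.

Definition free_abelian (A : zmodType) : Prop :=
  exists K : choiceType, zmod_iso {freeg K / int} A.

(* Main.v *)
Require Import Defs.
From HB Require Import structures.
From mathcomp Require Import all_boot all_algebra ring_quotient generic_quotient.
From mathcomp Require Import boolp freeg.
From mathcomp Require Import zify.

(** The Ext groups are computed from an explicit small projective resolution of
the Passi functor.  Write [<g>] for the basis of Z[G] and give it the product
[<g><h> = <gh> - <g> - <h>], so that [<g> |-> g - 1] is multiplicative: this is
the rule [(g-1)(h-1) = (gh-1) - (g-1) - (h-1)].  A word is a nonempty sequence of
letters separated by gaps, each of them inner or outer; an inner gap is a bar
of the bar construction, an outer gap a tensor sign.  The differential [bdiff]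
replaces an inner gap in all possible ways, by a multiplication and by an outer
gap.  Let [PW m j] be the functor spanned by the words with j inner and fewer
than m outer gaps (a word with m outer gaps represents an element of
I(G)^(m+1), and is killed).  The words with a prescribed sequence of l - 1 gaps
span Z[G^l] = Z[Hom(F_l, G)], so [PW m j] is projective and a natural
transformation from it is determined by its values on universal words
([PW_ext], [PW_nt_eq]).  For a free group G the augmentation ideal is free on
the x_i - 1; Fox derivatives therefore split the first letter of a word into a
product, and this contracts the complex up to an error that raises the number
of outer gaps, which is nilpotent ([PW_contractible]).  This and a direct
argument in degree zero give [Passi_resolution].

A natural transformation into T^n ab is determined by the coefficients of
y_1 (x) ... (x) y_n in its values on words over the free group on y_1, ..., y_n,
and as this coefficient is multilinear, only those words matter in which every
letter is a product of distinct generators and every generator occurs in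
exactly one letter.  Thus Hom([PW m j], T^n ab) is dual
to the group [piece (qcell m j)] of words whose letters are pairwise disjoint,
possibly empty, blocks covering {1,...,n} ([chi_inj], [chi_surj]).  The
differential becomes the same [bdiff] for the product of blocks [smu]: the union
of two nonempty blocks, zero for one empty block, and minus the empty block for
two empty ones ([chi_diff]).

What remains is combinatorics of blocks.  A word in the complex has j inner and
fewer than m outer gaps, hence at most j + m letters.
- If j < n - m, no word consists of singletons.  Splitting the minimum off the
  first block that is not a singleton, or duplicating it if it is empty, is a
  contraction for the product restricted to ascending pairs of blocks; the
  remaining products lower the number of inversions
  ([Qd_contractible_low]).
- If j > n - m or m >= n, duplicating the first empty block contracts the words
  that contain one, and turning an outer first gap into an inner one
  contracts the others up to shorter words ([Qd_contractible_high]).  For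
  m >= n the latter fails only for the word with a single block, which accounts
  for the copy of Z in degree zero ([Qd_contractible_zero]).
- In degree n - m > 0 the coboundaries form a direct summand of the cochains,
  because the complex of blocks is contractible one degree below; so the
  cohomology embeds into a finite power of Z and is free ([cohomology_free]).  A cycle on which a
  cocycle takes the value 1 is the antisymmetrized (shuffle) product of single
  points, preceded by m - 1 single points separated by outer gaps
  ([shuffle_cycle]). *)

Set Implicit Arguments.
Unset Strict Implicit.
Unset Printing Implicit Defensive.

Import GRing.Theory.
Local Open Scope ring_scope.
Local Open Scope quotient_scope.

(** * Additive maps out of free abelian groups *)

Section FgextTheory.
Variables (K : choiceType) (A B : zmodType).
Implicit Types (f g : K -> A) (x : {freeg K / int}).

Lemma eq_fgext f g : f =1 g -> fgext f =1 fgext g.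
Proof. by move=> /funext ->. Qed.

Lemma fgext_comp (h : {additive A -> B}) f x :
  h (fgext f x) = fgext (h \o f) x.
Proof.
apply: (freeg_additive_ext (f := h \o fgext f) (g := fgext (h \o f))) => k /=.
by rewrite !fgextU.
Qed.

Lemma fgextD f g x : fgext (f \+ g) x = fgext f x + fgext g x.
Proof.
apply: (freeg_additive_ext (f := fgext (f \+ g)) (g := fgext f \+ fgext g)) => k /=.
by rewrite !fgextU.
Qed.

Lemma fgextN f x : fgext (\- f) x = - fgext f x.
Proof.
apply: (freeg_additive_ext (f := fgext (\- f)) (g := \- fgext f)) => k /=.
by rewrite !fgextU.
Qed.

Lemma fgextB f g x : fgext (f \- g) x = fgext f x - fgext g x.
Proof. by rewrite -fgextN -fgextD. Qed.

Lemma fgext0 x : fgext (fun=> 0 : A) x = 0.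
Proof.
by apply: (freeg_additive_ext (f := fgext (fun=> 0 : A)) (g := \0)) => k; rewrite /= fgextU.
Qed.

Lemma fgext_id x : fgext (@fgU K) x = x.
Proof.
by apply: (freeg_additive_ext (f := fgext (@fgU K)) (g := idfun)) => k; exact: fgextU.
Qed.

End FgextTheory.

(** Filtrations of complexes of words and estimates of error terms are all
stated as membership in the subgroup spanned by part of the basis. *)
Definition fspan (K : choiceType) (p : K -> Prop) : zmodClosed {freeg K / int} :=
  zspan (fun x => exists2 k, p k & x = fgU k).

Lemma zspan_ind (A : zmodType) (P : A -> Prop) (Q : A -> Prop) :
  Q 0 -> (forall x y, Q x -> Q y -> Q (x - y)) -> (forall x, P x -> Q x) ->
  forall x, x \in zspan P -> Q x.
Proof.
move=> Q0 QB PQ x.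
pose S : {pred A} := fun x => `[< Q x >].
have Sc : zmod_closed S.
  by split=> [|u v /asboolP Qu /asboolP Qv]; apply/asboolP => //; exact: QB.
pose SS : zmodClosed A := HB.pack S (GRing.isZmodClosed.Build A S Sc).
by move=> /zspanP/(_ SS) xS; apply/asboolP/xS => y /PQ Qy; apply/asboolP.
Qed.

Section FspanTheory.
Variables (K L : choiceType).

Lemma fspanU (p : K -> Prop) k : p k -> fgU k \in fspan p.
Proof. by move=> pk; apply: mem_zspan; exists k. Qed.

Lemma fspan_fgext (A : zmodType) (S : zmodClosed A) (p : K -> Prop) (f : K -> A) x :
  (forall k, p k -> f k \in S) -> x \in fspan p -> fgext f x \in S.
Proof.
move=> fS; apply: (zspan_image (f := fgext f)) => _ [k pk ->].
by rewrite /= fgextU fS.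
Qed.

Lemma fspan_sub (p q : K -> Prop) x :
  (forall k, p k -> q k) -> x \in fspan p -> x \in fspan q.
Proof.
move=> pq xp; rewrite -(fgext_id x); apply: fspan_fgext xp => k /pq; exact: fspanU.
Qed.

Lemma fspan_eq (A : zmodType) (p : K -> Prop)
    (f g : {additive {freeg K / int} -> A}) x :
  (forall k, p k -> f (fgU k) = g (fgU k)) -> x \in fspan p -> f x = g x.
Proof.
move=> fg xp.
have : x \in zker (f \- g).
  rewrite -(fgext_id x); apply: fspan_fgext xp => k pk.
  by apply/eqP; rewrite /= fg // subrr.
by move=> /eqP /= /subr0_eq.
Qed.

Lemma fspan_ind (p : K -> Prop) (Q : {freeg K / int} -> Prop) :
  Q 0 -> (forall x y, Q x -> Q y -> Q (x - y)) -> (forall k, p k -> Q (fgU k)) ->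
  forall x, x \in fspan p -> Q x.
Proof. by move=> Q0 QB pQ; apply: zspan_ind => // _ [k /pQ Qk ->]. Qed.

Lemma fspan_all x : x \in fspan (fun k : K => True).
Proof.
rewrite -(freeg_sumE x); apply: rpred_sum => k _.
rewrite -[coeff k x]intz -[_%:~R]/(1 *~ coeff k x) -freegU_mulz.
by apply: rpredMz; apply: fspanU.
Qed.

Lemma fspan_false (p : K -> Prop) x : (forall k, ~ p k) -> x \in fspan p -> x = 0.
Proof. by move=> np; apply: (fspan_eq (f := idfun) (g := \0)) => k /np. Qed.

End FspanTheory.

Section QuotientLift.
Variables (A B : zmodType) (S : zmodClosed A) (f : {additive A -> B}).
Hypothesis fS : forall x, x \in S -> f x = 0.

Definition quot_lift_fun (x : Quotient.quot S) : B := f (repr x).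

Lemma quot_lift_fun_pi x : quot_lift_fun (\pi_(Quotient.quot S) x) = f x.
Proof.
apply/subr0_eq; rewrite -raddfB fS //.
by rewrite Quotient.idealrBE reprK.
Qed.

Lemma quot_lift_is_additive : zmod_morphism quot_lift_fun.
Proof.
elim/quotW=> x; elim/quotW=> y.
by rewrite -raddfB !quot_lift_fun_pi raddfB.
Qed.

Definition quot_lift : {additive Quotient.quot S -> B} :=
  HB.pack quot_lift_fun (GRing.isZmodMorphism.Build (Quotient.quot S) B
    quot_lift_fun quot_lift_is_additive).

Lemma quot_lift_pi x : quot_lift (\pi_(Quotient.quot S) x) = f x.
Proof. exact: quot_lift_fun_pi. Qed.

End QuotientLift.

Lemma quot_pi_eq0 (A : zmodType) (S : zmodClosed A) x :
  (\pi_(Quotient.quot S) x == 0) = (x \in S).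
Proof.
by rewrite -(raddf0 (\pi_(Quotient.quot S))) -Quotient.idealrBE subr0.
Qed.

Lemma zmod_iso_of (A B : zmodType) (f : {additive A -> B}) :
  (forall x, f x = 0 -> x = 0) -> (forall y, exists x, f x = y) -> zmod_iso A B.
Proof.
move=> f_inj f_surj; exists f.
have fI : injective f.
  by move=> x y fxy; apply/subr0_eq/f_inj; rewrite raddfB fxy subrr.
exists (fun y => sval (cid (f_surj y))) => x; last exact: (svalP (cid (f_surj x))).
by apply: fI; exact: (svalP (cid (f_surj _))).
Qed.

Lemma bij_additive_inv (A B : zmodType) (f : {additive A -> B}) (g : B -> A) :
  cancel f g -> cancel g f -> zmod_morphism g.
Proof. by move=> fK gK x y; apply: (can_inj fK); rewrite raddfB !gK. Qed.

Lemma zmod_iso_sym (A B : zmodType) : zmod_iso A B -> zmod_iso B A.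
Proof.
move=> [f [g fK gK]].
pose h : {additive B -> A} := HB.pack g (GRing.isZmodMorphism.Build B A g (bij_additive_inv fK gK)).
by exists h; exists f.
Qed.

Lemma zmod_iso_trans (A B C : zmodType) : zmod_iso A B -> zmod_iso B C -> zmod_iso A C.
Proof. by move=> [f fb] [g gb]; exists (g \o f); exact: bij_comp. Qed.

Lemma zmod_trivial_iso (A B : zmodType) : zmod_iso A B -> zmod_trivial B -> zmod_trivial A.
Proof.
by move=> [f [g fK gK]] B0 x; rewrite -(fK x) (B0 (f x)) -(B0 (f 0)) fK.
Qed.

Lemma free_abelian_iso (A B : zmodType) : zmod_iso A B -> free_abelian B -> free_abelian A.
Proof.
by move=> AB [K KB]; exists K; apply: zmod_iso_trans KB (zmod_iso_sym AB).
Qed.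

(** The image of f is an ideal of Z, generated by an element of least nonzero
absolute value. *)
Lemma int_subgroup_gen (A : zmodType) (f : {additive A -> int}) :
  exists a, forall x, exists k : int, f x = k * f a.
Proof.
have [[x0 fx0]|f0] := pselect (exists x, f x != 0); last first.
  exists 0 => x; exists 0; rewrite mul0r; apply/eqP/negP => /negP fx.
  by apply: f0; exists x.
have exP : exists n, `[< exists x, (n != 0)%N /\ `|f x|%N = n >].
  by exists `|f x0|%N; apply/asboolP; exists x0; rewrite absz_eq0.
have [n /asboolP[a [n0 fa]] nmin] := ex_minnP exP.
exists a => x; exists (f x %/ f a)%Z.
have fa0 : f a != 0 by rewrite -absz_eq0 fa.
suff r0 : (f x %% f a)%Z = 0 by rewrite {1}(divz_eq (f x) (f a)) r0 addr0.
apply/eqP; apply/negP => /negP r0.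
have e : f (x - a *~ (f x %/ f a)%Z) = (f x %% f a)%Z.
  by rewrite raddfB raddfMz /= mulrzz {1}(divz_eq (f x) (f a)) mulrC addrC addKr.
have := nmin `|(f x %% f a)%Z|%N.
have -> : `[< exists y, (`|(f x %% f a)%Z| != 0)%N /\ `|f y|%N = `|(f x %% f a)%Z|%N >] = true.
  by apply/asboolP; exists (x - a *~ (f x %/ f a)%Z); rewrite e absz_eq0.
move=> /(_ isT); rewrite leqNgt => /negP; apply.
by rewrite -fa -ltz_nat gez0_abs ?modz_ge0 // ltz_mod.
Qed.

(** A subgroup of Z^N is free, by induction on N: the last coordinate maps it
onto a cyclic group, which splits off, and the kernel embeds into Z^(N-1).  The
embedding is given by its N coordinates. *)
Lemma free_abelian_embed (N : nat) (A : zmodType) (f : 'I_N -> {additive A -> int}) :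
  (forall x, (forall i, f i x = 0) -> x = 0) -> free_abelian A.
Proof.
elim: N A f => [|N IHN] A f f_inj.
  exists void; apply: (zmod_iso_of (f := \0)) => x; last by exists 0; symmetry; apply: f_inj => -[].
  by move=> _; apply: (freeg_additive_ext (f := idfun) (g := \0)) => -[].
have [a aP] := int_subgroup_gen (f ord_max).
pose A0 := subz (zker (f ord_max)).
pose f0 (i : 'I_N) : {additive A0 -> int} := f (widen_ord (leqnSn N) i) \o val.
have [|K [g [g' gK g'K]]] := IHN A0 f0.
  move=> x fx; apply: val_inj; apply: f_inj => i.
  have [iN|iN] := ltnP i N.
    have -> : i = widen_ord (leqnSn N) (Ordinal iN) by apply: val_inj.
    exact: fx.
  have -> : i = ord_max by apply: val_inj => /=; have := ltn_ord i; lia.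
  exact/eqP/(valP x).
have kerP (x : A) : f ord_max x = 0 -> exists y, val (g y) = x.
  move=> /eqP fx; exists (g' (Subz (S := zker (f ord_max)) fx)).
  by rewrite g'K.
have [fa0|fa0] := eqVneq (f ord_max a) 0.
  exists K; apply: (zmod_iso_of (f := val \o g)) => [x /= gx|y].
    by rewrite -(gK x) -(gK 0); congr g'; apply: val_inj; rewrite /= gx raddf0.
  by apply: kerP; have [k ->] := aP y; rewrite fa0 mulr0.
exists (option K).
pose h : {additive {freeg (option K) / int} -> A} :=
  fgext (fun o : option K => if o is Some k then val (g (fgU k)) else a).
pose up : {additive {freeg K / int} -> {freeg (option K) / int}} :=
  fgext (fun k => fgU (Some k)).
have hup y : h (up y) = val (g y).
  apply: (freeg_additive_ext (f := h \o up) (g := val \o g)) => k.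
  by rewrite /h /up /= !fgextU.
have dec x : exists y (k : int), x = up y + fgU None *~ k.
  move: x (fspan_all x); apply: fspan_ind => [|u v [y [k ->]] [y' [k' ->]]|[k|] _].
  - by exists 0, 0; rewrite raddf0 mulr0z addr0.
  - exists (y - y'), (k - k'); rewrite mulrzBr raddfB /= opprD !addrA.
    by congr (_ + _); rewrite addrAC.
  - by exists (fgU k), 0; rewrite mulr0z addr0 /up /= fgextU.
  by exists 0, 1; rewrite raddf0 add0r.
apply: (zmod_iso_of (f := h)) => [x|y].
  have [y [k ->]] := dec x.
  rewrite raddfD raddfMz /= hup /h fgextU => e.
  have := congr1 (f ord_max) e; rewrite raddfD raddfMz raddf0 /=.
  rewrite (eqP (valP (g y))) add0r mulrzz => /eqP; rewrite mulf_eq0 (negPf fa0) /=.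
  move=> /eqP k0; move: e; rewrite k0 !mulr0z !addr0 => e.
  suff -> : y = 0 by rewrite raddf0.
  by rewrite -(gK y) -(gK 0); congr g'; apply: val_inj; rewrite /= e raddf0.
have [k yk] := aP y.
have [z zE] : exists z, val (g z) = y - a *~ k.
  by apply: kerP; rewrite raddfB raddfMz /= yk mulrzz mulrC subrr.
by exists (up z + fgU None *~ k); rewrite raddfD raddfMz /= hup /h fgextU zE subrK.
Qed.

(** * Independence of the projective resolution *)

Section KernelLift.
Variables (P F G : functor) (g : nat_trans F G) (h : nat_trans P F).
Hypothesis gh0 : forall a (x : P a), g a (h a x) = 0.

Definition kerF_lift_fun a (x : P a) : kerF g a :=
  Subz (S := zker (g a)) (introT eqP (gh0 x)).

Lemma kerF_lift_is_additive a : zmod_morphism (@kerF_lift_fun a).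
Proof. by move=> x y; apply: val_inj; rewrite /= !raddfB. Qed.

HB.instance Definition _ a := GRing.isZmodMorphism.Build (P a) (kerF g a)
  (@kerF_lift_fun a) (@kerF_lift_is_additive a).

Lemma kerF_lift_natural a b (f : grhom (FG a) (FG b)) x :
  kerF_lift_fun (fmap P f x) = fmap (kerF g) f (kerF_lift_fun x).
Proof. by apply: val_inj; exact: nt_natural. Qed.

Definition kerF_lift : nat_trans P (kerF g) :=
  @NatTrans P (kerF g) (fun a => @kerF_lift_fun a) kerF_lift_natural.

End KernelLift.

Lemma nt_eqE (F G : functor) (p q : nat_trans F G) a x : p = q -> p a x = q a x.
Proof. by move=> ->. Qed.

(** Lift through the surjection of F onto the kernel of g. *)
Lemma projective_lift_exact (P F G H : functor) (f : nat_trans F G)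
    (g : nat_trans G H) (h : nat_trans P G) :
  projective P -> nt_exact f g -> (forall a (x : P a), g a (h a x) = 0) ->
  exists k : nat_trans P F, forall a x, f a (k a x) = h a x.
Proof.
move=> Pproj fg gh0.
have gf0 a (x : F a) : g a (f a x) = 0 by apply/fg; exists x.
have [|k kE] := Pproj _ _ (kerF_lift gf0) (kerF_lift gh0).
  move=> a [y yK]; have /fg[x xy] := eqP yK.
  by exists x; apply: val_inj.
by exists k => a x; have /(congr1 val) := nt_eqE x kE.
Qed.

Section Comparison.
Variables (F : functor) (P Q : proj_resolution F).

(** The cycles of the resolution, augmented by F in degree -1: this uniform
description avoids treating degree 0 apart in the inductions below. *)
Definition res_cycle (R : proj_resolution F) i a : R i a -> Prop :=
  match i return R i a -> Prop with
  | 0 => fun y => res_aug R a y = 0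
  | j.+1 => fun y => res_diff R j a y = 0
  end.

Lemma res_cycleP (R : proj_resolution F) i a (y : R i a) :
  res_cycle y <-> exists z, res_diff R i a z = y.
Proof. by case: i y => [|i] y; [exact: res_exact0|exact: res_exact]. Qed.

Lemma projective_lift_cycle (E : functor) (R : proj_resolution F) i (h : nat_trans E (R i)) :
  projective E -> (forall a x, res_cycle (h a x)) ->
  exists k : nat_trans E (R i.+1), forall a x, res_diff R i a (k a x) = h a x.
Proof.
case: i h => [|i] h Eproj hc; apply: projective_lift_exact Eproj _ hc.
  exact: res_exact0.
exact: res_exact.
Qed.

Record chain_map := ChainMap {
  cm_fun :> forall i, nat_trans (P i) (Q i);
  cm_comm : forall i a x, res_diff Q i a (cm_fun i.+1 a x) = cm_fun i a (res_diff P i a x)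
}.

(** The lifts are chosen recursively; each step carries along the fact that the
lift preserves cycles, which is what the next step needs. *)
Lemma comparison_map_exists :
  exists f : chain_map, forall a x, res_aug Q a (f 0%N a x) = res_aug P a x.
Proof.
have [f0 f0E] := @res_projective F P 0 _ _ (res_aug Q) (res_aug P) (@res_aug_epi _ Q).
pose T i := {f : nat_trans (P i) (Q i) |
  forall a (y : P i a), res_cycle y -> res_cycle (f a y)}.
have step i (f : T i) : {f' : T i.+1 |
    forall a x, res_diff Q i a (sval f' a x) = sval f a (res_diff P i a x)}.
  case: f => f fc; apply: cid.
  have [|f' f'E] := projective_lift_cycle (h := nt_comp f (res_diff P i)) (@res_projective F P i.+1).
    by move=> a x; apply: fc; apply/res_cycleP; exists x.
  have f'c a (y : P i.+1 a) : res_cycle y -> res_cycle (f' a y).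
    by rewrite /= f'E /= => ->; rewrite raddf0.
  by exists (exist _ f' f'c).
have f0c a (y : P 0 a) : res_cycle y -> res_cycle (f0 a y).
  by move=> /= y0; have /= -> := nt_eqE y f0E.
pose fix fs i : T i := if i is j.+1 then sval (step j (fs j)) else exist _ f0 f0c.
exists (@ChainMap (fun i => sval (fs i)) (fun i => svalP (step i (fs i)))) => a x.
exact: nt_eqE f0E.
Qed.

(** s_{i+1} lifts f_{i+1} - s_i d, which is a cycle by the equation for s_i on cycles. *)
Lemma null_homotopy (f : chain_map) :
  (forall a x, res_aug Q a (f 0%N a x) = 0) ->
  exists s : forall i, nat_trans (P i) (Q i.+1),
    (forall a x, f 0%N a x = res_diff Q 0 a (s 0%N a x)) /\
    (forall i a x, f i.+1 a x =
       res_diff Q i.+1 a (s i.+1 a x) + s i a (res_diff P i a x)).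
Proof.
move=> f00.
have [s0 s0E] := projective_lift_cycle (h := f 0%N) (@res_projective F P 0) f00.
pose T i := {s : nat_trans (P i) (Q i.+1) |
  forall a (y : P i a), res_cycle y -> res_diff Q i a (s a y) = f i a y}.
have step i (s : T i) : {s' : T i.+1 | forall a x,
    f i.+1 a x = res_diff Q i.+1 a (sval s' a x) + sval s a (res_diff P i a x)}.
  case: s => s sc; apply: cid.
  have [|s' s'E] := projective_lift_cycle (h := f i.+1 - nt_comp s (res_diff P i))
                      (@res_projective F P i.+1).
    move=> a x /=; rewrite raddfB /= cm_comm sc ?subrr //.
    by apply/res_cycleP; exists x.
  have s'c a (y : P i.+1 a) : res_cycle y -> res_diff Q i.+1 a (s' a y) = f i.+1 a y.
    by rewrite s'E /= => ->; rewrite raddf0 subr0.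
  by exists (exist _ s' s'c) => a x; rewrite /= s'E /= subrK.
pose fix ss i : T i := if i is j.+1 then sval (step j (ss j))
  else exist _ s0 (fun a y _ => s0E a y).
exists (fun i => sval (ss i)); split=> [a x|i a x]; first by rewrite /= s0E.
exact: (svalP (step i (ss i))).
Qed.

End Comparison.

Section CohomologyMap.
Variables (F G : functor) (P Q : proj_resolution F) (f : chain_map P Q).

Lemma cocycles_map i u : u \in cocycles G Q i -> nt_precomp (f i) u \in cocycles G P i.
Proof.
move=> /eqP uc; apply/eqP; apply: nat_trans_ext => a x /=.
by rewrite -cm_comm; exact: (nt_eqE _ uc).
Qed.

Lemma coboundaries_map i (u : subz (cocycles G Q i)) :
  u \in @coboundaries F G Q i ->
  subz_map (@cocycles_map i) u \in @coboundaries F G P i.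
Proof.
move=> /asboolP uB; apply/asboolP; case: i u uB => [|i] u /=.
  by move=> ->; rewrite raddf0.
move=> [psi ->]; exists (nt_precomp (f i) psi); apply: nat_trans_ext => a x /=.
by rewrite cm_comm.
Qed.

Definition cohomology_map i : {additive cohomology G Q i -> cohomology G P i} :=
  quot_map (@coboundaries_map i).

End CohomologyMap.

Section ComparisonIso.
Variables (F G : functor).

(** f - id covers zero, so it is null-homotopic. *)
Lemma chain_self_map_homotopic (P : proj_resolution F) (f : chain_map P P) i
    (u : nat_trans (P i) G) :
  (forall a x, res_aug P a (f 0%N a x) = res_aug P a x) ->
  u \in cocycles G P i -> is_coboundary (P := P) (nt_precomp (f i) u - u).
Proof.
move=> f0 /eqP uc.
pose g i : nat_trans (P i) (P i) := f i - @NatTrans (P i) (P i) (fun=> idfun) (fun _ _ _ _ => erefl).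
have gc j a x : res_diff P j a (g j.+1 a x) = g j a (res_diff P j a x).
  by rewrite /= raddfB /= cm_comm.
have [|s [s0 sS]] := @null_homotopy F P P (ChainMap gc).
  by move=> a x; rewrite /= raddfB /= f0 subrr.
have uE a x : (nt_precomp (f i) u - u) a x = u a (g i a x) by rewrite /= raddfB.
case: i u uc uE => [|i] u uc uE /=.
  apply: nat_trans_ext => a x; rewrite uE (s0 a x); exact: (nt_eqE _ uc).
exists (nt_precomp (s i) u); apply: nat_trans_ext => a x.
rewrite uE (sS i a x) raddfD /=.
have -> : u a (res_diff P i.+1 a (s i.+1 a x)) = 0 by exact: (nt_eqE _ uc).
by rewrite add0r.
Qed.

Lemma chain_map_comp_comm (P Q : proj_resolution F) (f : chain_map P Q) (g : chain_map Q P) i a x :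
  res_diff P i a (nt_comp (g i.+1) (f i.+1) a x) = nt_comp (g i) (f i) a (res_diff P i a x).
Proof. by rewrite /= !cm_comm. Qed.

(** Two resolutions are homotopy equivalent, since both composites of the
comparison maps are homotopic to the identity. *)
Lemma cohomology_unique (P Q : proj_resolution F) i :
  zmod_iso (cohomology G Q i) (cohomology G P i).
Proof.
have [f f0] := comparison_map_exists P Q; have [g g0] := comparison_map_exists Q P.
pose gf := ChainMap (chain_map_comp_comm f g); pose fg := ChainMap (chain_map_comp_comm g f).
have gf0 a x : res_aug P a (gf 0%N a x) = res_aug P a x by rewrite /= g0 f0.
have fg0 a x : res_aug Q a (fg 0%N a x) = res_aug Q a x by rewrite /= f0 g0.
apply: (zmod_iso_of (f := cohomology_map G f i)) => [|]; elim/quotW=> u.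
  rewrite [cohomology_map _ _ _ _]quot_map_pi => /eqP; rewrite quot_pi_eq0 => uB.
  apply/eqP; rewrite quot_pi_eq0; have := coboundaries_map g uB.
  set v := subz_map _ _; move=> vB.
  have wB : u - v \in @coboundaries F G Q i.
    rewrite -opprB rpredN; apply/asboolP.
    have := chain_self_map_homotopic fg0 (valP u).
    congr is_coboundary; congr (_ - _); exact: nat_trans_ext.
  by rewrite -(subrK v u) rpredD.
exists (\pi_(Quotient.quot _) (subz_map (@cocycles_map F G Q P g i) u)).
rewrite [LHS]quot_map_pi; apply/eqP; rewrite -subr_eq0 -raddfB quot_pi_eq0.
apply/asboolP; have := chain_self_map_homotopic gf0 (valP u).
congr is_coboundary; congr (_ - _); exact: nat_trans_ext.
Qed.

End ComparisonIso.

(** * Contractions up to a nilpotent error *)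

(** The complex C2 -> C1 -> C0 is contracted at C1 up to a nilpotent error nu.
This is weaker than a contracting homotopy but, as the next two lemmas show,
just as useful; it allows contractions that are only correct to leading order
for a filtration. *)
Definition contractible (C2 C1 C0 : zmodType) (d2 : {additive C2 -> C1})
    (d1 : {additive C1 -> C0}) : Prop :=
  exists (h1 : {additive C1 -> C2}) (h0 : {additive C0 -> C1})
         (nu : {additive C1 -> C1}) (B : nat),
    (forall x, d2 (h1 x) + h0 (d1 x) = x + nu x) /\ (forall x, iter B nu x = 0).

Section Contractible.
Variables (C2 C1 C0 : zmodType) (d2 : {additive C2 -> C1}) (d1 : {additive C1 -> C0}).
Hypothesis d1d2 : forall x, d1 (d2 x) = 0.
Hypothesis contr : contractible d2 d1.

(** With nu = 0 take K = h1.  On cycles d2 h1 = 1 + nu, and nu preserves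
cycles, so K can be taken as the finite geometric series sum_k h1 (-nu)^k. *)
Lemma contractible_section :
  exists K : {additive C1 -> C2}, forall x, d1 x = 0 -> d2 (K x) = x.
Proof.
have [h1 [h0 [nu [B [hE nuB]]]]] := contr.
have d2h1 x : d1 x = 0 -> d2 (h1 x) = x + nu x.
  by move=> x0; have := hE x; rewrite x0 raddf0 addr0.
have d1nu x : d1 x = 0 -> d1 (nu x) = 0.
  move=> x0; have := d1d2 (h1 x); rewrite d2h1 // raddfD x0 add0r; exact.
suff [K KE] : exists K : {additive C1 -> C2},
    forall x, d1 x = 0 -> iter B nu x = 0 -> d2 (K x) = x.
  by exists K => x x0; exact: KE.
elim: B {nuB} => [|B [K KE]].
  by exists \0 => x _ /= ->; rewrite raddf0.
exists (h1 \- (K \o nu)) => x x0; rewrite iterSr => xB.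
by rewrite /= raddfB /= d2h1 // KE ?d1nu // addrK.
Qed.

(** The dual statement: the equation of the homotopy gives
c = c h0 d1 - c nu, and c nu again vanishes on boundaries. *)
Lemma contractible_cosection (A : zmodType) (c : {additive C1 -> A}) :
  (forall x, c (d2 x) = 0) -> exists b : {additive C0 -> A}, forall x, c x = b (d1 x).
Proof.
have [h1 [h0 [nu [B [hE nuB]]]]] := contr => cd2.
have : forall x, c (iter B nu x) = 0 by move=> x; rewrite nuB raddf0.
elim: B c cd2 {nuB} => [|B IHB] c cd2 cB; first by exists \0.
have cE x : c x = c (h0 (d1 x)) - c (nu x).
  by have /(congr1 c) := hE x; rewrite !raddfD /= cd2 add0r => ->; rewrite addrK.
have [x|x|b bE] := IHB (c \o nu).
- have := cE (d2 x); rewrite cd2 d1d2 !raddf0 sub0r => /esym/eqP.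
  by rewrite oppr_eq0 => /eqP.
- by have := cB x.
by exists ((c \o h0) \- b) => x; rewrite cE /= -bE.
Qed.

End Contractible.

Section Pieces.
Variable W : choiceType.
Implicit Types (p q : pred W) (x : {freeg W / int}).

(** Words subject to a condition p span a group of their own.  The operators on
all words need not preserve p, so an operator T is compressed to pieces:
include, apply T, and discard the words outside. *)
Definition piece p := {freeg {w : W | p w} / int}.
HB.instance Definition _ p := GRing.Zmodule.on (piece p).

Definition incl p : piece p -> {freeg W / int} :=
  fgext (fun u : {w | p w} => fgU (val u)).
HB.instance Definition _ p := GRing.Additive.on (@incl p).
Arguments incl : clear implicits.

Definition restr_word p (w : W) : piece p :=
  if insub w is Some u then fgU (u : {w | p w}) else 0.

Definition restr p : {freeg W / int} -> piece p := fgext (restr_word p).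
HB.instance Definition _ p := GRing.Additive.on (restr p).

Arguments incl p : simpl never.
Arguments restr p : simpl never.

Lemma inclU p (u : {w | p w}) : incl p (fgU u) = fgU (val u).
Proof. exact: fgextU. Qed.

Lemma restrU p (u : {w | p w}) : restr p (fgU (val u)) = fgU u.
Proof. by rewrite [LHS]fgextU /restr_word valK. Qed.

Lemma restr_out p w : ~~ p w -> restr p (fgU w) = 0.
Proof. by move=> pw; rewrite [LHS]fgextU /restr_word insubN. Qed.

Lemma inclK p (x : piece p) : restr p (incl p x) = x.
Proof.
apply: (freeg_additive_ext (f := restr p \o incl p) (g := idfun)) => u /=.
by rewrite inclU restrU.
Qed.

Lemma incl_restr p x : x \in fspan p -> incl p (restr p x) = x.
Proof.
apply: (fspan_eq (f := incl p \o restr p) (g := idfun)) => w pw /=.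
by rewrite -[w]/(val (Sub w pw : {w | p w})) restrU inclU.
Qed.

Lemma restr_span (r : W -> Prop) p x :
  x \in fspan r -> restr p x \in fspan (fun u : {w | p w} => r (val u)).
Proof.
apply: fspan_fgext => w rw; rewrite /restr_word.
by case: insubP => [u _ uw|_]; [apply: fspanU; rewrite uw|exact: rpred0].
Qed.

Lemma restr_span0 (r : W -> Prop) p x :
  (forall w, r w -> ~~ p w) -> x \in fspan r -> restr p x = 0.
Proof.
move=> rp xr; apply: fspan_false (restr_span p xr).
by move=> [w pw] /= /rp; rewrite pw.
Qed.

End Pieces.
Arguments incl {W} p.
Arguments restr {W} p.
Arguments incl {W} p x : simpl never.
Arguments restr {W} p x : simpl never.

Section Operators.
Variables W W' : choiceType.

Definition compress (T : {additive {freeg W / int} -> {freeg W' / int}})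
    (p : pred W) (q : pred W') : piece p -> piece q := restr q \o T \o incl p.
Arguments compress : clear implicits.
HB.instance Definition _ T p q := GRing.Additive.on (compress T p q).

Arguments compress T p q : simpl never.

(** The condition under which the compression of T does commute with discarding
words, so that compressions compose as they should. *)
Definition adm (T : {additive {freeg W / int} -> {freeg W' / int}})
    (p : pred W) (q : pred W') : Prop :=
  forall w, ~~ p w -> restr q (T (fgU w)) = 0.

Lemma compressE T p q (x : piece p) : compress T p q x = restr q (T (incl p x)). Proof. by []. Qed.

Lemma adm_compress T p q x : adm T p q -> compress T p q (restr p x) = restr q (T x).
Proof.
move=> Tpq; apply: (freeg_additive_ext (f := compress T p q \o restr p) (g := restr q \o T)) => w.
rewrite /= compressE; have [pw|pw] := boolP (p w).
  by rewrite -[w]/(val (Sub w pw : {w | p w})) restrU inclU.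
by rewrite restr_out // !raddf0 Tpq.
Qed.

End Operators.
Arguments compress {W W'} T p q.
Arguments compress {W W'} T p q x : simpl never.

Section PieceContraction.
Variable W : choiceType.
Implicit Types (p : pred W) (x : {freeg W / int}).

Lemma iter_lower_nilpotent p (nu : {additive piece p -> piece p}) (t : W -> nat) B :
  (forall u : {w | p w}, (t (val u) < B)%N) ->
  (forall u : {w | p w}, nu (fgU u) \in fspan (fun v : {w | p w} => (t (val v) < t (val u))%N)) ->
  forall x : piece p, iter B nu x = 0.
Proof.
move=> tB nut x.
have : x \in fspan (fun v : {w | p w} => (t (val v) < B)%N).
  apply: fspan_sub (fspan_all x) => v _; exact: tB.
elim: B {tB} x => [|B IHB] x xB; first exact: fspan_false xB.
rewrite iterSr; apply: IHB.
rewrite -(fgext_id x) fgext_comp; apply: fspan_fgext xB => v vB.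
apply: fspan_sub (nut v) => u uv; exact: leq_trans uv vB.
Qed.

(** The practical criterion for contractibility: S is a contraction up to terms
of lower weight t.  The target C0 and the map h0 are left arbitrary so as to
cover the augmented end of a complex. *)
Lemma piece_contractible (D S : {additive {freeg W / int} -> {freeg W / int}})
    p2 p1 (C0 : zmodType) (d1 : {additive piece p1 -> C0})
    (h0 : {additive C0 -> piece p1}) (t : W -> nat) B :
  adm D p2 p1 ->
  (forall u : {w | p1 w}, (t (val u) < B)%N) ->
  (forall u : {w | p1 w},
     restr p1 (D (S (fgU (val u)))) + h0 (d1 (fgU u)) - fgU u
       \in fspan (fun v : {w | p1 w} => (t (val v) < t (val u))%N)) ->
  contractible (compress D p2 p1) d1.
Proof.
move=> Dadm tB hE.
pose nu : {additive piece p1 -> piece p1} :=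
  ((restr p1 \o D \o S \o incl p1) \+ (h0 \o d1)) \- idfun.
exists (compress S p1 p2), h0, nu, B; split=> x.
  by rewrite /= [compress S _ _ _]compressE adm_compress // /nu /= [RHS]addrC subrK.
apply: (iter_lower_nilpotent tB) => u.
by rewrite /nu /= inclU hE.
Qed.

Lemma piece_contractible_mid (D S : {additive {freeg W / int} -> {freeg W / int}})
    p2 p1 p0 (t : W -> nat) B :
  adm D p2 p1 -> adm S p0 p1 ->
  (forall w, p1 w -> (t w < B)%N) ->
  (forall w, p1 w -> D (S (fgU w)) + S (D (fgU w)) - fgU w
       \in fspan (fun v => (t v < t w)%N)) ->
  contractible (compress D p2 p1) (compress D p1 p0).
Proof.
move=> Dadm Sadm tB hE.
apply: (piece_contractible (S := S) (h0 := compress S p0 p1) (t := t) (B := B)) => // [[w pw]|u].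
  exact: tB.
rewrite /= [compress D _ _ _]compressE adm_compress // inclU -[X in _ - X]restrU -raddfD -raddfB.
apply: (restr_span (r := fun v => (t v < t (val u))%N)).
by apply: hE; exact: (valP u).
Qed.

End PieceContraction.

(** * Words with inner and outer gaps *)

Section Bilinear.
Variables (K : choiceType) (A B : zmodType) (f : K -> {additive A -> B}).

(** The value at y of the linear extension of a family of operators: a pairing,
additive in each argument, with f on the basis of the first one. *)
Definition bil (y : {freeg K / int}) (x : A) : B := fgext (fun k => f k x) y.

Lemma bil_is_additive y : zmod_morphism (bil y).
Proof.
move=> u v; rewrite /bil -fgextB; apply: eq_fgext => k /=; exact: raddfB.
Qed.
HB.instance Definition _ y := GRing.isZmodMorphism.Build A B (bil y) (bil_is_additive y).

Lemma bilU k x : bil (fgU k) x = f k x.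
Proof. exact: fgextU. Qed.

Lemma bilBl y z x : bil (y - z) x = bil y x - bil z x.
Proof. exact: raddfB. Qed.
Lemma bil0l x : bil 0 x = 0.
Proof. exact: raddf0. Qed.
End Bilinear.
Arguments bil {K A B} f y x : simpl never.

Lemma bil_comp (K : choiceType) (A B C : zmodType) (f : K -> {additive A -> B})
    (g : {additive B -> C}) y x : g (bil f y x) = bil (fun k => g \o f k) y x.
Proof. exact: fgext_comp. Qed.

Lemma eq_bil (K : choiceType) (A B C : zmodType) (f : K -> {additive A -> B})
    (g : K -> {additive C -> B}) x x' y :
  (forall k, f k x = g k x') -> bil f y x = bil g y x'.
Proof. by move=> fg; apply: eq_fgext. Qed.

(** [BOne k] is a single letter; in [BCons k b w] the gap after the letter k is
inner if b is true and outer if b is false.  [din] and [dout] count the gaps of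
the two kinds. *)
Inductive bword (K : Type) := BOne of K | BCons of K & bool & bword K.

HB.instance Definition _ K := gen_eqMixin (bword K).
HB.instance Definition _ K := gen_choiceMixin (bword K).

Section BWord.
Variable K : Type.
Implicit Types (k : K) (w : bword K).

Definition whead w := match w with BOne k => k | BCons k _ _ => k end.

Definition set_head w k :=
  match w with BOne _ => BOne k | BCons _ b w' => BCons k b w' end.

Fixpoint din w := if w is BCons _ b w' then (b + din w')%N else 0%N.
Fixpoint dout w := if w is BCons _ b w' then (~~ b + dout w')%N else 0%N.
Fixpoint wlen w := if w is BCons _ _ w' then (wlen w').+1 else 1%N.

Lemma din_set_head w k : din (set_head w k) = din w. Proof. by case: w. Qed.
Lemma dout_set_head w k : dout (set_head w k) = dout w. Proof. by case: w. Qed.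
Lemma wlen_set_head w k : wlen (set_head w k) = wlen w. Proof. by case: w. Qed.

Lemma wlenE w : wlen w = (din w + dout w).+1.
Proof. by elim: w => //= k b w ->; case: b; lia. Qed.

End BWord.

Section MergeComplex.
Variable K : choiceType.
Notation ZW := {freeg (bword K) / int}.

Definition bcons k b : ZW -> ZW := fgext (fun w => fgU (BCons k b w)).
HB.instance Definition _ k b := GRing.Additive.on (bcons k b).
Arguments bcons k b x : simpl never.

Lemma bconsU k b w : bcons k b (fgU w) = fgU (BCons k b w).
Proof. exact: fgextU. Qed.

Definition heads (w : bword K) : {freeg K / int} -> ZW := fgext (fun k => fgU (set_head w k)).
HB.instance Definition _ w := GRing.Additive.on (heads w).
Arguments heads w y : simpl never.

Definition blin b (y : {freeg K / int}) : ZW -> ZW := bil (fun k => bcons k b) y.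
HB.instance Definition _ b y := GRing.Additive.on (blin b y).

Lemma heads_cons k b w y : heads (BCons k b w) y = blin b y (fgU w).
Proof. by apply: eq_fgext => k'; rewrite /= bconsU. Qed.

(** Induction on words inside an equality of additive maps: the step may apply
its induction hypothesis to a linear combination of tails, which is needed
because the operators do not send words to words. *)
Lemma ZW_ind_ext (A : zmodType) (f g : {additive ZW -> A}) :
  (forall k, f (fgU (BOne k)) = g (fgU (BOne k))) ->
  (forall k b x, f x = g x -> f (bcons k b x) = g (bcons k b x)) ->
  f =1 g.
Proof.
move=> fg1 fgC; apply: freeg_additive_ext; elim=> [k|k b w IHw]; first exact: fg1.
by rewrite -bconsU; apply: fgC.
Qed.

(** Replaces each inner gap in turn by an outer one, with the sign (-1)^i where i
counts the inner gaps to the left.  Outer gaps contribute no sign. *)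
Fixpoint conv_word (w : bword K) : ZW :=
  match w with
  | BOne _ => 0
  | BCons k true w' => bcons k false (fgU w') - bcons k true (conv_word w')
  | BCons k false w' => bcons k false (conv_word w')
  end.

Definition conv : ZW -> ZW := fgext conv_word.
HB.instance Definition _ := GRing.Additive.on conv.
Arguments conv : simpl never.

Lemma conv_one k : conv (fgU (BOne k)) = 0. Proof. exact: fgextU. Qed.

Lemma conv_inner k x : conv (bcons k true x) = bcons k false x - bcons k true (conv x).
Proof.
apply: (freeg_additive_ext (f := conv \o bcons k true)
  (g := bcons k false \- (bcons k true \o conv))) => w /=.
by rewrite bconsU /conv !fgextU.
Qed.

Lemma conv_outer k x : conv (bcons k false x) = bcons k false (conv x).
Proof.
apply: (freeg_additive_ext (f := conv \o bcons k false)
  (g := bcons k false \o conv)) => w /=.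
by rewrite bconsU /conv !fgextU.
Qed.

Section Product.
Variable mu : K -> K -> {freeg K / int}.

Definition hmul k : ZW -> ZW := fgext (fun w => heads w (mu k (whead w))).
HB.instance Definition _ k := GRing.Additive.on (hmul k).
Arguments hmul k x : simpl never.

Lemma hmulU k w : hmul k (fgU w) = heads w (mu k (whead w)).
Proof. exact: fgextU. Qed.

Lemma hmul_bcons k h b x : hmul k (bcons h b x) = blin b (mu k h) x.
Proof.
apply: (freeg_additive_ext (f := hmul k \o bcons h b) (g := blin b (mu k h))) => w.
by rewrite /= bconsU hmulU heads_cons.
Qed.

(** Replaces each inner gap in turn by the product of the adjacent letters, with
the sign of the bar construction as in [conv_word]. *)
Fixpoint mdiff_word (w : bword K) : ZW :=
  match w with
  | BOne _ => 0
  | BCons k true w' => hmul k (fgU w') - bcons k true (mdiff_word w')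
  | BCons k false w' => bcons k false (mdiff_word w')
  end.

Definition mdiff : ZW -> ZW := fgext mdiff_word.
HB.instance Definition _ := GRing.Additive.on mdiff.
Arguments mdiff : simpl never.

Lemma mdiff_one k : mdiff (fgU (BOne k)) = 0. Proof. exact: fgextU. Qed.

Lemma mdiff_inner k x : mdiff (bcons k true x) = hmul k x - bcons k true (mdiff x).
Proof.
apply: (freeg_additive_ext (f := mdiff \o bcons k true)
  (g := hmul k \- (bcons k true \o mdiff))) => w /=.
by rewrite bconsU /mdiff !fgextU.
Qed.

Lemma mdiff_outer k x : mdiff (bcons k false x) = bcons k false (mdiff x).
Proof.
apply: (freeg_additive_ext (f := mdiff \o bcons k false)
  (g := bcons k false \o mdiff)) => w /=.
by rewrite bconsU /mdiff !fgextU.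
Qed.

(** The differential of the resolution and of its dual; for an associative mu its
two parts anticommute and each squares to zero. *)
Definition bdiff (x : ZW) : ZW := mdiff x + conv x.

Lemma bdiff_is_additive : zmod_morphism bdiff.
Proof. by move=> x y; rewrite /bdiff !raddfB opprD !addrA; congr (_ + _); rewrite addrAC. Qed.
HB.instance Definition _ := GRing.isZmodMorphism.Build ZW ZW bdiff bdiff_is_additive.

Lemma bdiff_one k : bdiff (fgU (BOne k)) = 0.
Proof. by rewrite /bdiff mdiff_one conv_one addr0. Qed.

Lemma bdiff_inner k x :
  bdiff (bcons k true x) = hmul k x + bcons k false x - bcons k true (bdiff x).
Proof.
rewrite /bdiff mdiff_inner conv_inner raddfD /= opprD !addrA; congr (_ + _).
by rewrite addrAC.
Qed.

Lemma bdiff_outer k x : bdiff (bcons k false x) = bcons k false (bdiff x).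
Proof. by rewrite /bdiff mdiff_outer conv_outer raddfD. Qed.

Hypothesis muA : forall k1 k2 k3,
  fgext (fun k => mu k k3) (mu k1 k2) = fgext (mu k1) (mu k2 k3).

Lemma hmul_heads k w y : hmul k (heads w y) = heads w (fgext (mu k) y).
Proof.
apply: (freeg_additive_ext (f := hmul k \o heads w) (g := heads w \o fgext (mu k))) => h.
rewrite /= fgextU [heads w (fgU h)]fgextU hmulU.
by case: w.
Qed.

Lemma hmul_hmul k h x : hmul k (hmul h x) = bil (fun j => hmul j) (mu k h) x.
Proof.
apply: (freeg_additive_ext (f := hmul k \o hmul h) (g := bil (fun j => hmul j) (mu k h))) => w /=.
rewrite hmulU hmul_heads -muA fgext_comp; apply: eq_fgext => j /=.
by rewrite hmulU.
Qed.

(** The differential is linear for multiplication from the left, by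
associativity of mu. *)
Lemma bdiff_hmul k x : bdiff (hmul k x) = hmul k (bdiff x).
Proof.
move: x; apply: (ZW_ind_ext (f := bdiff \o hmul k) (g := hmul k \o bdiff)) => [h|h b x IHx] /=.
  rewrite bdiff_one raddf0 hmulU fgext_comp -(fgext0 _ (mu k h)).
  by apply: eq_fgext => j; exact: bdiff_one.
rewrite hmul_bcons; case: b.
  rewrite bdiff_inner raddfB raddfD /= hmul_hmul !hmul_bcons /blin bil_comp.
  rewrite /bil -fgextD -fgextB; apply: eq_fgext => j /=.
  by rewrite bdiff_inner.
rewrite bdiff_outer hmul_bcons /blin bil_comp; apply: eq_bil => j /=.
by rewrite bdiff_outer.
Qed.

(** By induction on the word: for an inner first gap the two occurrences of the
product cancel by [bdiff_hmul], and so do those of the outer gap. *)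
Lemma bdiff_bdiff x : bdiff (bdiff x) = 0.
Proof.
move: x; apply: (ZW_ind_ext (f := bdiff \o bdiff) (g := \0)) => [k|k b x /= IHx] /=.
  by rewrite bdiff_one raddf0.
case: b; last by rewrite !bdiff_outer IHx raddf0.
rewrite bdiff_inner raddfB raddfD /= bdiff_outer bdiff_inner IHx raddf0 subr0.
by rewrite bdiff_hmul subrr.
Qed.

End Product.
End MergeComplex.

(** * Free groups, crossed homomorphisms and abelianization *)

Section FreeGroupTheory.
Variable a : nat.
Local Open Scope group_scope.

Definition letter_gen (G : groupType) (h : 'I_a -> G) (l : bool * 'I_a) : G :=
  if l.1 then (h l.2)^-1 else h l.2.

Lemma FG_mulE (u v : word a) : \pi_(freegrp a) (u ++ v) = (\pi_(freegrp a) u : FG a) * \pi_(freegrp a) v.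
Proof. by rewrite [RHS]FG_mul_pi. Qed.

Lemma FG_letterE l : \pi_(freegrp a) [:: l] = letter_gen (@FG_gen a) l.
Proof.
case: l => [[] i] //=; rewrite /letter_gen /=.
by rewrite [RHS]FG_inv_pi.
Qed.

Lemma FG_consE l (u : word a) :
  \pi_(freegrp a) (l :: u) = letter_gen (@FG_gen a) l * \pi_(freegrp a) u.
Proof. by rewrite -cat1s FG_mulE FG_letterE. Qed.

Lemma FG_ind (P : FG a -> Prop) :
  P 1 -> (forall l x, P x -> P (letter_gen (@FG_gen a) l * x)) -> forall x, P x.
Proof.
move=> P1 PM; elim/quotW; elim=> [|l u IHu]; first exact: P1.
by rewrite FG_consE; apply: PM.
Qed.

Section Lift.
Variables (G : groupType) (h : 'I_a -> G).

Definition word_eval (u : word a) : G := foldr (fun l x => letter_gen h l * x) 1 u.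

Lemma word_eval_cat u v : word_eval (u ++ v) = word_eval u * word_eval v.
Proof. by elim: u => [|l u IHu] /=; rewrite ?mul1g // IHu mulgA. Qed.

Lemma word_eval_cong u v : word_cong u v -> word_eval u = word_eval v.
Proof.
elim=> {u v} [b i|//|//|u v w _ -> _ -> //|u u' v v' _ uu _ vv].
  by rewrite /= /letter_gen /= mulg1; case: b; rewrite /= ?mulVg ?mulgV.
by rewrite !word_eval_cat uu vv.
Qed.

Definition FG_lift_fun (x : FG a) : G := word_eval (repr x).

Lemma FG_lift_pi u : FG_lift_fun (\pi_(freegrp a) u) = word_eval u.
Proof. by apply: word_eval_cong; exact: FG_reprP. Qed.

Lemma FG_lift_monoid :
  (FG_lift_fun 1 = 1) * {morph FG_lift_fun : x y / x * y}.
Proof.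
split=> [|]; first exact: FG_lift_pi [::].
elim/quotW=> u; elim/quotW=> v.
by rewrite -FG_mulE !FG_lift_pi word_eval_cat.
Qed.

Definition FG_lift : grhom (FG a) G :=
  HB.pack FG_lift_fun (isUMagmaMorphism.Build (FG a) G FG_lift_fun FG_lift_monoid).

Lemma FG_lift_gen i : FG_lift (FG_gen i) = h i.
Proof. by rewrite [LHS]FG_lift_pi /= mulg1. Qed.

End Lift.

Lemma grhom_letter (G : groupType) (f : grhom (FG a) G) l :
  f (letter_gen (@FG_gen a) l) = letter_gen (fun i => f (FG_gen i)) l.
Proof. by case: l => [[] i]; rewrite /letter_gen //= gmulfV. Qed.

Lemma FG_hom_ext (G : groupType) (f g : grhom (FG a) G) :
  (forall i, f (FG_gen i) = g (FG_gen i)) -> f = g.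
Proof.
move=> fg; apply: grhom_ext; apply: FG_ind => [|l x IHx]; first by rewrite !gmulf1.
by rewrite !gmulfM IHx !grhom_letter; case: l => [[] i]; rewrite /letter_gen /= fg.
Qed.

End FreeGroupTheory.

Section CrossedHom.
Variables (a : nat) (M : zmodType) (act : FG a -> {additive M -> M}) (d : 'I_a -> M).
Hypothesis act1 : forall m, act 1%g m = m.
Hypothesis actM : forall x y m, act (x * y)%g m = act y (act x m).

Definition crossed_letter (l : bool * 'I_a) : M :=
  if l.1 then - act (FG_gen l.2)^-1%g (d l.2) else d l.2.

(** The value on a word of the map that satisfies
c(xy) = act y (c x) + c y and takes the value d i on the i-th generator. *)
Fixpoint crossed_word (u : word a) : M :=
  if u is l :: u' then act (\pi_(freegrp a) u') (crossed_letter l) + crossed_word u' else 0.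

Lemma crossed_word_cat u v :
  crossed_word (u ++ v) = act (\pi_(freegrp a) v) (crossed_word u) + crossed_word v.
Proof.
elim: u => [|l u IHu] /=; first by rewrite raddf0 add0r.
by rewrite IHu FG_mulE actM raddfD addrA.
Qed.

Lemma crossed_word_cong u v : word_cong u v -> crossed_word u = crossed_word v.
Proof.
elim=> {u v} [b i|//|//|u v w _ -> _ -> //|u u' v v' _ uu cvv vv]; last first.
  by rewrite !crossed_word_cat uu vv; have /FG_eqP -> := cvv.
rewrite /= FG_letterE /crossed_letter /letter_gen /= addr0.
rewrite -[\pi_(freegrp a) [::]]/(1%g : FG a) act1.
by case: b => /=; rewrite ?subrr // raddfN -actM mulVg act1 addNr.
Qed.

(** A free group has a unique crossed homomorphism with given values on the
generators.  Both the exponent sums and the Fox derivatives are of this kind. *)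
Definition crossed (x : FG a) : M := crossed_word (repr x).

Lemma crossed_pi u : crossed (\pi_(freegrp a) u) = crossed_word u.
Proof. by apply: crossed_word_cong; exact: FG_reprP. Qed.

Lemma crossedM x y : crossed (x * y)%g = act y (crossed x) + crossed y.
Proof.
elim/quotW: x => u; elim/quotW: y => v.
by rewrite -FG_mulE !crossed_pi crossed_word_cat.
Qed.

Lemma crossed1 : crossed 1%g = 0. Proof. exact: crossed_pi [::]. Qed.

Lemma crossed_gen i : crossed (FG_gen i) = d i.
Proof.
rewrite [LHS]crossed_pi /= addr0.
by rewrite -[\pi_(freegrp a) [::]]/(1%g : FG a) act1.
Qed.

End CrossedHom.

Section FreeAb.
Variable a : nat.

Definition ab_gen i : ab (FG a) := \pi_(ab (FG a)) (FG_gen i).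

Lemma ab_additive_ext (A : zmodType) (f g : {additive ab (FG a) -> A}) :
  (forall i, f (ab_gen i) = g (ab_gen i)) -> f =1 g.
Proof.
move=> fg; elim/quotW; apply: FG_ind => [|l x IHx].
  by rewrite -[\pi_(ab (FG a)) 1%g]/(0 : ab (FG a)) !raddf0.
rewrite ab_piD !raddfD IHx /=; congr (_ + _).
by case: l => [[] i]; rewrite /letter_gen /= ?ab_piV ?raddfN /= fg.
Qed.

Variable i : 'I_a.

Definition int_act (x : FG a) : {additive int -> int} := idfun.

(** The exponent sum of the i-th generator: the crossed homomorphism for the
trivial action on Z. *)
Definition FG_expo : FG a -> int := crossed int_act (fun j => (i == j)%:Z).

Lemma FG_expoM x y : FG_expo (x * y)%g = FG_expo x + FG_expo y.
Proof. exact: crossedM. Qed.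

Lemma FG_expo1 : FG_expo 1%g = 0. Proof. exact: crossed1. Qed.

Lemma FG_expoV x : FG_expo x^-1%g = - FG_expo x.
Proof. by apply/eqP; rewrite -addr_eq0 -FG_expoM mulVg FG_expo1. Qed.

Definition expo_ker : {pred FG a} := fun x => FG_expo x == 0.

Lemma expo_ker_mulg_closed : mulg_closed expo_ker.
Proof.
by move=> x y /eqP x0 /eqP y0; rewrite -[_ \in _]/(_ == _) FG_expoM x0 y0.
Qed.
Lemma expo_ker1 : 1%g \in expo_ker.
Proof. by rewrite -[_ \in _]/(_ == _) FG_expo1. Qed.
Lemma expo_kerV : invg_closed expo_ker.
Proof. by move=> x /eqP x0; rewrite -[_ \in _]/(_ == _) FG_expoV x0. Qed.
HB.instance Definition _ := isMulClosed.Build (FG a) expo_ker expo_ker_mulg_closed.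
HB.instance Definition _ := isMul1Closed.Build (FG a) expo_ker expo_ker1.
HB.instance Definition _ := isInvClosed.Build (FG a) expo_ker expo_kerV.

Lemma expo_derived x : x \in derived (FG a) -> FG_expo x = 0.
Proof.
move=> /derivedP/(_ expo_ker) xS; apply/eqP/xS => y z.
rewrite -[_ \in _]/(_ == _) commgEl conjgE !FG_expoM !FG_expoV.
by apply/eqP; lia.
Qed.

(** The i-th coordinate on the free abelian group ab(F_a). *)
Definition expo (x : ab (FG a)) : int := FG_expo (repr x).

Lemma expo_pi x : expo (\pi_(ab (FG a)) x) = FG_expo x.
Proof.
apply/eqP; rewrite -subr_eq0 -oppr_eq0 opprB; apply/eqP.
have /expo_derived := ab_reprP x.
by rewrite FG_expoM FG_expoV addrC.
Qed.

Lemma expo_is_additive : zmod_morphism expo.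
Proof.
by elim/quotW=> x; elim/quotW=> y; rewrite -ab_piV -ab_piD !expo_pi FG_expoM FG_expoV.
Qed.
HB.instance Definition _ := GRing.isZmodMorphism.Build (ab (FG a)) int expo expo_is_additive.

Lemma expo_gen j : expo (ab_gen j) = (i == j)%:Z.
Proof. by rewrite expo_pi [LHS]crossed_gen. Qed.

End FreeAb.

(** * Letters, relabelling and functoriality of words *)

Section Letters.
Variable K : Type.
Implicit Types (w : bword K).

Fixpoint letters w : seq K :=
  match w with BOne k => [:: k] | BCons k _ w' => k :: letters w' end.

Lemma size_letters w : size (letters w) = wlen w.
Proof. by elim: w => //= k b w ->. Qed.

Lemma letters_head w : letters w = whead w :: behead (letters w).
Proof. by case: w. Qed.

Lemma letters_set_head w k : letters (set_head w k) = k :: behead (letters w).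
Proof. by case: w. Qed.

End Letters.

Section Relabel.
Variable K : Type.

Fixpoint bmap (L : Type) (f : K -> L) (w : bword K) : bword L :=
  match w with BOne k => BOne (f k) | BCons k b w' => BCons (f k) b (bmap f w') end.

Fixpoint relab (L : Type) (h : nat -> L) (w : bword K) : bword L :=
  match w with
  | BOne _ => BOne (h 0%N)
  | BCons _ b w' => BCons (h 0%N) b (relab (fun i => h i.+1) w')
  end.

Lemma din_bmap (L : Type) (f : K -> L) w : din (bmap f w) = din w.
Proof. by elim: w => //= k b w ->. Qed.
Lemma dout_bmap (L : Type) (f : K -> L) w : dout (bmap f w) = dout w.
Proof. by elim: w => //= k b w ->. Qed.
Lemma wlen_bmap (L : Type) (f : K -> L) w : wlen (bmap f w) = wlen w.
Proof. by elim: w => //= k b w ->. Qed.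
Lemma letters_bmap (L : Type) (f : K -> L) w : letters (bmap f w) = map f (letters w).
Proof. by elim: w => //= k b w ->. Qed.
Lemma din_relab (L : Type) (h : nat -> L) w : din (relab h w) = din w.
Proof. by elim: w h => //= k b w IHw h; rewrite IHw. Qed.
Lemma dout_relab (L : Type) (h : nat -> L) w : dout (relab h w) = dout w.
Proof. by elim: w h => //= k b w IHw h; rewrite IHw. Qed.
Lemma wlen_relab (L : Type) (h : nat -> L) w : wlen (relab h w) = wlen w.
Proof. by elim: w h => //= k b w IHw h; rewrite IHw. Qed.

Lemma eq_relab (L : Type) (h h' : nat -> L) w :
  (forall i, (i < wlen w)%N -> h i = h' i) -> relab h w = relab h' w.
Proof.
elim: w h h' => [k|k b w IHw] h h' /= hh'; first by rewrite hh'.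
by rewrite hh' //; congr BCons; apply: IHw => i iw; rewrite hh'.
Qed.

Lemma relab_nth d (w : bword K) : relab (nth d (letters w)) w = w.
Proof. by elim: w => //= k b w IHw; rewrite IHw. Qed.

Lemma bmap_id (w : bword K) : bmap id w = w.
Proof. by elim: w => //= k b w ->. Qed.

End Relabel.

Lemma bmap_comp (K L M : Type) (f : K -> L) (g : L -> M) w :
  bmap (g \o f) w = bmap g (bmap f w).
Proof. by elim: w => //= k b w ->. Qed.

Lemma bmap_relab (K L M : Type) (f : L -> M) (h : nat -> L) (w : bword K) :
  bmap f (relab h w) = relab (f \o h) w.
Proof. by elim: w h => //= k b w IHw h; rewrite IHw. Qed.

Lemma relab_bmap (K L M : Type) (f : K -> M) (h : nat -> L) (w : bword K) :
  relab h (bmap f w) = relab h w.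
Proof. by elim: w h => //= k b w IHw h; rewrite IHw. Qed.

Lemma letters_relab (K L : Type) (h : nat -> L) (w : bword K) d i :
  (i < wlen w)%N -> nth d (letters (relab h w)) i = h i.
Proof. by elim: w h i => [k|k b w IHw] h [|i] //=; exact: IHw. Qed.

Section Spans.
Variable K : choiceType.
Notation ZW := {freeg (bword K) / int}.

Lemma span_bcons (p q : bword K -> Prop) k b x :
  (forall w, p w -> q (BCons k b w)) -> x \in fspan p -> bcons k b x \in fspan q.
Proof. by move=> pq; apply: fspan_fgext => w /pq; exact: fspanU. Qed.

Lemma conv_span w :
  conv (fgU w) \in fspan (fun w' : bword K =>
    [/\ (din w').+1 = din w, dout w' = (dout w).+1 & letters w' = letters w]).
Proof.
elim: w => [k|k b w IHw]; first by rewrite conv_one rpred0.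
rewrite -bconsU; case: b; rewrite ?conv_inner ?conv_outer.
  apply: rpredB; first by rewrite bconsU; apply: fspanU.
  by apply: span_bcons IHw => w' /= [<- -> ->].
by apply: span_bcons IHw => w' /= [<- -> ->].
Qed.

Definition merged (r : K -> K -> K -> Prop) (s s' : seq K) : Prop :=
  exists s1 k h k' s2, [/\ s = s1 ++ [:: k, h & s2], s' = s1 ++ k' :: s2 & r k h k'].

Lemma heads_span (r : K -> Prop) w y :
  y \in fspan r -> heads w y \in fspan (fun w' => exists2 k, r k & w' = set_head w k).
Proof. by apply: fspan_fgext => k rk; apply: fspanU; exists k. Qed.

(** The relation r bounds the letters that can occur in a product; every
estimate of [mdiff] below is an instance of this one. *)
Lemma mdiff_span mu (r : K -> K -> K -> Prop) w :
  (forall k h, mu k h \in fspan (r k h)) ->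
  mdiff mu (fgU w) \in fspan (fun w' : bword K =>
    [/\ (din w').+1 = din w, dout w' = dout w & merged r (letters w) (letters w')]).
Proof.
move=> mur; elim: w => [k|k b w IHw]; first by rewrite mdiff_one rpred0.
have IHk : bcons k b (mdiff mu (fgU w)) \in fspan (fun w' : bword K =>
    [/\ (din w').+1 = din (BCons k b w), dout w' = dout (BCons k b w)
      & merged r (letters (BCons k b w)) (letters w')]).
  apply: span_bcons IHw => w' /= [<- -> [s1 [k1 [h [k' [s2 [-> -> rk]]]]]]].
  by split=> //; [rewrite addnS|exists (k :: s1), k1, h, k', s2].
rewrite -bconsU; case: b IHk => IHk; rewrite ?mdiff_inner ?mdiff_outer //.
apply: rpredB => //.
rewrite hmulU; have := heads_span w (mur k (whead w)).
apply: fspan_sub => _ [k' rk' ->].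
rewrite din_set_head dout_set_head letters_set_head /= [letters w]letters_head /=.
by split=> //; exists [::], k, (whead w), k', (behead (letters w)).
Qed.

Lemma merged_size r (s s' : seq K) : merged r s s' -> size s = (size s').+1.
Proof.
by move=> [s1 [k [h [k' [s2 [-> -> _]]]]]]; rewrite !size_cat /= !addnS.
Qed.

End Spans.

Section BmapZ.
Variables (K L : choiceType) (f : K -> L).
Notation ZK := {freeg (bword K) / int}.
Notation ZL := {freeg (bword L) / int}.

Definition bmapZ : ZK -> ZL := fgext (fun w => fgU (bmap f w)).
HB.instance Definition _ := GRing.Additive.on bmapZ.
Arguments bmapZ : simpl never.

Lemma bmapZU w : bmapZ (fgU w) = fgU (bmap f w). Proof. exact: fgextU. Qed.

Lemma bmapZ_bcons k b x : bmapZ (bcons k b x) = bcons (f k) b (bmapZ x).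
Proof.
apply: (freeg_additive_ext (f := bmapZ \o bcons k b) (g := bcons (f k) b \o bmapZ)) => w /=.
by rewrite bconsU !bmapZU bconsU.
Qed.

Lemma bmapZ_conv x : bmapZ (conv x) = conv (bmapZ x).
Proof.
move: x; apply: (ZW_ind_ext (f := bmapZ \o @conv K) (g := @conv L \o bmapZ)) => [k|k b x /= IHx] /=.
  by rewrite bmapZU !conv_one raddf0.
by case: b; rewrite bmapZ_bcons ?conv_inner ?conv_outer ?raddfB /= !bmapZ_bcons IHx.
Qed.

Variables (muK : K -> K -> {freeg K / int}) (muL : L -> L -> {freeg L / int}).
Hypothesis fmu : forall k h, fgext (fun j => fgU (f j)) (muK k h) = muL (f k) (f h).

Lemma bmapZ_heads w y : bmapZ (heads w y) = heads (bmap f w) (fgext (fun j => fgU (f j)) y).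
Proof.
apply: (freeg_additive_ext (f := bmapZ \o heads w) (g := heads (bmap f w) \o fgext (fun j => fgU (f j)))) => k /=.
rewrite /heads !fgextU bmapZU.
by case: w.
Qed.

Lemma bmapZ_hmul k x : bmapZ (hmul muK k x) = hmul muL (f k) (bmapZ x).
Proof.
apply: (freeg_additive_ext (f := bmapZ \o hmul muK k) (g := hmul muL (f k) \o bmapZ)) => w /=.
rewrite bmapZU !hmulU bmapZ_heads fmu; congr (heads _ (muL _ _)).
by case: w.
Qed.

Lemma bmapZ_mdiff x : bmapZ (mdiff muK x) = mdiff muL (bmapZ x).
Proof.
move: x; apply: (ZW_ind_ext (f := bmapZ \o mdiff muK) (g := mdiff muL \o bmapZ)) => [k|k b x /= IHx] /=.
  by rewrite bmapZU !mdiff_one raddf0.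
by case: b; rewrite bmapZ_bcons ?mdiff_inner ?mdiff_outer ?raddfB /= !bmapZ_bcons IHx ?bmapZ_hmul.
Qed.

(** Functoriality: the differential commutes with maps of letters that are
compatible with the products. *)
Lemma bmapZ_bdiff x : bmapZ (bdiff muK x) = bdiff muL (bmapZ x).
Proof. by rewrite /bdiff raddfD /= bmapZ_mdiff bmapZ_conv. Qed.

End BmapZ.

(** * Splitting the first letter by Fox calculus *)

Section HeadContraction.
Variables (K : choiceType) (mu : K -> K -> {freeg K / int}).
Variables (sig : K -> {freeg (K * K) / int}) (rho : K -> {freeg K / int}).
Notation ZW := {freeg (bword K) / int}.
Notation ZKK := {freeg (K * K) / int}.

Hypothesis mu_sig : forall g, fgext (fun kk => mu kk.1 kk.2) (sig g) = fgU g - rho g.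
Hypothesis sig_mu : forall g h, fgext sig (mu g h) =
  fgext (fun kk => fgext (fun j => fgU (kk.1, j)) (mu kk.2 h)) (sig g)
  + fgext (fun k => fgU (k, h)) (rho g).
Hypothesis rho_mu : forall g h, fgext rho (mu g h) = 0.

Definition split2 b (z : ZKK) : ZW -> ZW :=
  bil (fun kk : K * K => bcons kk.1 true \o bcons kk.2 b) z.
HB.instance Definition _ b z := GRing.Additive.on (split2 b z).

Definition split_head (w : bword K) : ZKK -> ZW :=
  fgext (fun kk : K * K => fgU (BCons kk.1 true (set_head w kk.2))).
HB.instance Definition _ w := GRing.Additive.on (split_head w).

(** Suppose that every letter g is, up to a remainder [rho g], the product of the
pairs in [sig g].  The first letter is split accordingly, with a new inner gap;
if the first gap is outer, the remainder is left in place and the splitting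
passes over the gap to the next letter. *)
Fixpoint hsplit_word (w : bword K) : ZW :=
  split_head w (sig (whead w)) +
  match w with BCons g false w' => blin false (rho g) (hsplit_word w') | _ => 0 end.

Definition hsplit : ZW -> ZW := fgext hsplit_word.
HB.instance Definition _ := GRing.Additive.on hsplit.
Arguments hsplit : simpl never.

Lemma split_head_cons g b w z : split_head (BCons g b w) z = split2 b z (fgU w).
Proof. by apply: eq_fgext => kk; rewrite /= !bconsU. Qed.

Lemma hsplit_one g : hsplit (fgU (BOne g)) = split_head (BOne g) (sig g).
Proof. by rewrite [LHS]fgextU /= addr0. Qed.

Lemma hsplit_inner g x : hsplit (bcons g true x) = split2 true (sig g) x.
Proof.
apply: (freeg_additive_ext (f := hsplit \o bcons g true) (g := split2 true (sig g))) => w /=.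
by rewrite bconsU [LHS]fgextU /= addr0 split_head_cons.
Qed.

Lemma hsplit_outer g x :
  hsplit (bcons g false x) = split2 false (sig g) x + blin false (rho g) (hsplit x).
Proof.
apply: (freeg_additive_ext (f := hsplit \o bcons g false)
  (g := split2 false (sig g) \+ (blin false (rho g) \o hsplit))) => w /=.
by rewrite bconsU [LHS]fgextU /= split_head_cons /hsplit fgextU.
Qed.

(** This is where [sig_mu] and [rho_mu] enter: a product splits its left factor,
and the remainder of the left factor is split off from the right one. *)
Lemma hsplit_hmul g x : hsplit (hmul mu g x) =
  bil (fun kk : K * K => bcons kk.1 true \o hmul mu kk.2) (sig g) x + blin true (rho g) x.
Proof.
apply: (freeg_additive_ext (f := hsplit \o hmul mu g) (g :=
  bil (fun kk : K * K => bcons kk.1 true \o hmul mu kk.2) (sig g) \+ blin true (rho g))) => w /=.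
rewrite hmulU.
have headsE y : hsplit (heads w y) = split_head w (fgext sig y) +
    match w with BCons _ false w' => blin false (fgext rho y) (hsplit_word w') | _ => 0 end.
  case: w => [k|k [] w']; rewrite ?addr0.
  - apply: (freeg_additive_ext (f := hsplit \o heads (BOne k))
      (g := split_head (BOne k) \o fgext sig)) => j /=.
    by rewrite [heads _ _]fgextU hsplit_one fgextU.
  - apply: (freeg_additive_ext (f := hsplit \o heads (BCons k true w'))
      (g := split_head (BCons k true w') \o fgext sig)) => j /=.
    by rewrite [heads _ _]fgextU fgextU [LHS]fgextU /= addr0.
  apply: (freeg_additive_ext (f := hsplit \o heads (BCons k false w'))
    (g := (split_head (BCons k false w') \o fgext sig) \+
          (fgext (fun k => bcons k false (hsplit_word w')) \o fgext rho))) => j /=.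
  by rewrite [heads _ _]fgextU !fgextU [LHS]fgextU.
rewrite headsE rho_mu.
have -> : match w with BCons _ false w' => blin false 0 (hsplit_word w') | _ => 0 end = 0.
  by case: w {headsE} => [|k [] w'] //; exact: bil0l.
rewrite addr0 sig_mu raddfD /=; congr (_ + _).
  rewrite fgext_comp; apply: eq_fgext => -[k k'] /=.
  rewrite hmulU !fgext_comp; apply: eq_fgext => j /=.
  by rewrite [LHS]fgextU /= -bconsU.
rewrite fgext_comp; apply: eq_fgext => k /=.
rewrite [LHS]fgextU /= bconsU; congr (fgU (BCons _ _ _)).
by case: w {headsE}.
Qed.

Lemma blin_fgext b (L : choiceType) (f : L -> {freeg K / int}) z x :
  blin b (fgext f z) x = fgext (fun l => blin b (f l) x) z.
Proof. exact: (fgext_comp (fgext (fun k => bcons k b x))). Qed.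

Lemma mdiff_split2_outer z x : mdiff mu (split2 false z x) =
  blin false (fgext (fun kk => mu kk.1 kk.2) z) x - split2 false z (mdiff mu x).
Proof.
rewrite blin_fgext /split2 bil_comp /bil -fgextB; apply: eq_fgext => kk /=.
by rewrite mdiff_inner hmul_bcons mdiff_outer.
Qed.

Lemma mdiff_split2_inner z x : mdiff mu (split2 true z x) =
  blin true (fgext (fun kk => mu kk.1 kk.2) z) x
  - bil (fun kk : K * K => bcons kk.1 true \o hmul mu kk.2) z x + split2 true z (mdiff mu x).
Proof.
rewrite blin_fgext /split2 bil_comp /bil -fgextB -fgextD; apply: eq_fgext => kk /=.
by rewrite mdiff_inner hmul_bcons mdiff_inner raddfB /= opprB addrA addrAC.
Qed.

Lemma blinU b g x : blin b (fgU g : {freeg K / int}) x = bcons g b x.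
Proof. exact: bilU. Qed.

(** For an inner first gap this is [mu_sig] together with [hsplit_hmul].  For an
outer one, the product in [sig g] restores g up to [rho g], and the induction
hypothesis for the tail supplies the missing word with head [rho g]. *)
Lemma hsplit_homotopy w : (0 < din w)%N ->
  mdiff mu (hsplit (fgU w)) + hsplit (mdiff mu (fgU w)) = fgU w.
Proof.
elim: w => [//|g b w IHw]; rewrite -bconsU; case: b => /= [_|dw].
  rewrite hsplit_inner mdiff_split2_inner mu_sig mdiff_inner raddfB /=.
  rewrite hsplit_hmul hsplit_inner.
  set p := bil _ _ _; set q := split2 _ _ _; rewrite {1}/blin bilBl -!/(blin _ _ _) blinU.
  set r := blin _ _ _; set s := bcons _ _ _; rewrite !addrA.
  by rewrite -[s - r - p + q + p]addrA [q + p]addrC addrA subrK [s - r + q]addrAC subrK addrK.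
have /esym E := IHw dw.
have mdiff_blin y x : mdiff mu (blin false y x) = blin false y (mdiff mu x).
  by rewrite /blin bil_comp; apply: eq_bil => k /=; rewrite mdiff_outer.
rewrite hsplit_outer raddfD /= mdiff_split2_outer mu_sig !mdiff_outer hsplit_outer mdiff_blin.
set y := hsplit (mdiff _ _) in E *; set z := mdiff _ (hsplit _) in E *.
rewrite addrACA subrK; set u := fgU w in E *.
rewrite -raddfD /= -E /blin bilBl subrK; exact: blinU.
Qed.

Lemma hsplit_span w : hsplit (fgU w) \in fspan (fun w' : bword K =>
  din w' = (din w).+1 /\ dout w' = dout w).
Proof.
elim: w => [g|g b w IHw].
  rewrite hsplit_one; apply: fspan_fgext (fspan_all _) => kk _.
  exact: fspanU.
have sp b' z : split2 b' z (fgU w) \in fspan (fun w' : bword K =>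
    din w' = (din (BCons g b' w)).+1 /\ dout w' = dout (BCons g b' w)).
  by apply: fspan_fgext (fspan_all _) => kk _ /=; rewrite !bconsU; apply: fspanU.
rewrite -bconsU; case: b; first by rewrite hsplit_inner; apply: sp.
rewrite hsplit_outer; apply: rpredD; first exact: sp.
apply: fspan_fgext (fspan_all _) => k _.
by apply: span_bcons IHw => w' /= [-> ->].
Qed.

End HeadContraction.

Section FoxSplitting.
Variable a : nat.
Local Notation G := (FG a).
Notation ZG := {freeg G / int}.
Notation ZGG := {freeg (G * G) / int}.

(** The product for which [<g> |-> g - 1] is multiplicative; the letters form a
basis, so unlike in the augmentation ideal [<1>] is not zero here but satisfies
[<1><1> = -<1>]. *)
Definition gmu (H : groupType) (g h : H) : {freeg H / int} := fgU (g * h)%g - fgU g - fgU h.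

Definition rtrans (y : G) : {additive ZGG -> ZGG} :=
  fgext (fun kk : G * G => fgU (kk.1, kk.2 * y)%g).

(** The crossed homomorphism with x_i |-> (x_i - 1) (x) 1.  In the component of
x_i - 1 one reads off the Fox derivative by x_i. *)
Definition fox : G -> ZGG :=
  crossed rtrans (fun i => fgU (FG_gen i, 1%g) - fgU (1%g, 1%g)).

Lemma rtransU y k k' : rtrans y (fgU (k, k')) = fgU (k, k' * y)%g.
Proof. exact: fgextU. Qed.

Lemma rtrans1 z : rtrans 1%g z = z.
Proof.
apply: (freeg_additive_ext (f := rtrans 1%g) (g := idfun)) => -[k k'] /=.
by rewrite [LHS]rtransU mulg1.
Qed.

Lemma rtransM x y z : rtrans (x * y)%g z = rtrans y (rtrans x z).
Proof.
apply: (freeg_additive_ext (f := rtrans (x * y)%g) (g := rtrans y \o rtrans x)) => -[k k'] /=.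
by rewrite !fgextU mulgA.
Qed.

Lemma foxM x y : fox (x * y)%g = rtrans y (fox x) + fox y.
Proof. exact: (crossedM _ rtrans1 rtransM). Qed.

Lemma fox_gen i : fox (FG_gen i) = fgU (FG_gen i, 1%g) - fgU (1%g, 1%g).
Proof. exact: (crossed_gen _ rtrans1 rtransM). Qed.

Lemma fox1 : fox 1%g = 0.
Proof. exact: (crossed1 _ rtrans1 rtransM). Qed.

Lemma fox_geninv i : fox (FG_gen i)^-1%g =
  - (fgU (FG_gen i, (FG_gen i)^-1%g) - fgU (1%g, (FG_gen i)^-1%g)).
Proof.
have /eqP := foxM (FG_gen i) (FG_gen i)^-1%g.
rewrite mulgV fox1 eq_sym addrC addr_eq0 => /eqP ->.
by rewrite fox_gen raddfB /= !fgextU !mul1g.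
Qed.

Definition fox_eval : {additive ZGG -> ZG} :=
  fgext (fun kk : G * G => fgU (kk.1 * kk.2)%g - fgU kk.2).

(** The fundamental formula of the free differential calculus,
g - 1 = sum_i (x_i - 1) dg/dx_i. *)
Lemma fox_fundamental g : fox_eval (fox g) = fgU g - fgU 1%g.
Proof.
elim/FG_ind: g => [|l x IHx]; first by rewrite fox1 raddf0 subrr.
pose f := fox_eval; rewrite -/f in IHx *.
have fr z : f (rtrans x z) = fgext (fun y => fgU (y * x)%g) (f z).
  apply: (freeg_additive_ext (f := f \o rtrans x)
    (g := fgext (fun y => fgU (y * x)%g) \o f)) => -[k k'] /=.
  by rewrite [rtrans _ _]fgextU /f !fgextU raddfB /= !fgextU mulgA.
rewrite foxM raddfD /= IHx fr.
have -> : f (fox (letter_gen (@FG_gen a) l)) = fgU (letter_gen (@FG_gen a) l) - fgU 1%g.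
  case: l => [[] i]; rewrite /letter_gen /= ?fox_gen ?fox_geninv ?raddfN raddfB /f /= !fgextU /=.
    by rewrite mulgV mul1g subrr subr0 opprB.
  by rewrite !mulg1 subrr subr0.
by rewrite raddfB /= !fgextU mul1g addrA subrK.
Qed.

(** The unit [<1>] is not covered by Fox calculus; the correction term splits it
off as [<1> = - <1><1>]. *)
Definition fox_sig (g : G) : ZGG := fox g - fgU (1%g, 1%g).

(** A letter minus the product of its splitting.  It is additive in g, and
consequently kills products ([fox_rho_mu]). *)
Definition fox_rho (g : G) : ZG := fgext (fun kk : G * G => fgU kk.1) (fox g).

Lemma fox_rhoM x y : fox_rho (x * y)%g = fox_rho x + fox_rho y.
Proof.
rewrite /fox_rho foxM raddfD /=; congr (_ + _).
apply: (freeg_additive_ext (f := fgext (fun kk : G * G => fgU kk.1) \o rtrans y)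
  (g := fgext (fun kk : G * G => fgU kk.1))) => -[k k'] /=.
by rewrite !fgextU.
Qed.

Lemma fox_mu_sig g : fgext (fun kk : G * G => gmu kk.1 kk.2) (fox_sig g) = fgU g - fox_rho g.
Proof.
rewrite /fox_sig raddfB /= fgextU /= /gmu mulg1 subrr sub0r opprK.
transitivity (fox_eval (fox g) - fox_rho g + fgU 1%g).
  congr (_ + _); rewrite /fox_rho -fgextB; apply: eq_fgext => kk /=.
  by rewrite addrAC.
by rewrite fox_fundamental addrAC subrK.
Qed.

Lemma fox_rho_mu g h : fgext fox_rho (gmu g h) = 0.
Proof. by rewrite /gmu !raddfB /= !fgextU fox_rhoM addrAC addrK subrr. Qed.

Lemma fox_sig_mu g h : fgext fox_sig (gmu g h) =
  fgext (fun kk : G * G => fgext (fun j => fgU (kk.1, j)) (gmu kk.2 h)) (fox_sig g)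
  + fgext (fun k => fgU (k, h)) (fox_rho g).
Proof.
rewrite /gmu [in LHS]raddfB [in LHS]raddfB /= ![in LHS]fgextU /fox_sig foxM.
have -> : fgext (fun kk : G * G => fgext (fun j => fgU (kk.1, j))
      (fgU (kk.2 * h)%g - fgU kk.2 - fgU h)) (fox g - fgU (1%g, 1%g)) =
    rtrans h (fox g) - fox g - fgext (fun kk : G * G => fgU (kk.1, h)) (fox g) + fgU (1%g, 1%g).
  rewrite raddfB /= fgextU /= !raddfB /= !fgextU mul1g.
  rewrite !opprK [- _ + _ + _]addrAC addNr add0r.
  congr (_ + _); rewrite -[X in _ = _ - X - _]fgext_id /rtrans -!fgextB.
  by apply: eq_fgext => -[k k'] /=; rewrite !raddfB /= !fgextU.
have -> : fgext (fun k => fgU (k, h)) (fox_rho g) = fgext (fun kk : G * G => fgU (kk.1, h)) (fox g) :> ZGG.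
  rewrite /fox_rho fgext_comp; apply: eq_fgext => kk /=; exact: fgextU.
set u := fgU (_, _); set v := fgext _ _; set r := rtrans _ _.
rewrite -[RHS]addrA [u + v]addrC addrA subrK.
by rewrite -[r + _ - u]addrA addrAC addrK opprB [u - _]addrC addrA.
Qed.

End FoxSplitting.

(** * The functors of words *)

(** The words of the j-th term of the resolution.  The bound on outer gaps
truncates: a word with m outer gaps stands for an element of I^(m+1). *)
Definition res_word (K : Type) (m j : nat) : pred (bword K) :=
  fun w => (din w == j) && (dout w < m)%N.
Arguments res_word {K} m j.

Lemma adm_bmapZ (K L : choiceType) (f : K -> L) m j : adm (bmapZ f) (res_word m j) (res_word m j).
Proof.
move=> w wP; rewrite /= bmapZU restr_out //.
by rewrite /res_word din_bmap dout_bmap.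
Qed.

Lemma bdiff_span (K : choiceType) (mu : K -> K -> {freeg K / int}) (w : bword K) :
  bdiff mu (fgU w) \in fspan (fun w' : bword K => (din w').+1 = din w /\ (dout w <= dout w')%N).
Proof.
apply: rpredD.
  have := mdiff_span (mu := mu) (r := fun _ _ _ => True) w (fun _ _ => fspan_all _).
  by apply: fspan_sub => w' [-> -> _].
by have := conv_span w; apply: fspan_sub => w' [-> -> _].
Qed.

Lemma adm_bdiff (K : choiceType) (mu : K -> K -> {freeg K / int}) m j :
  adm (bdiff mu) (res_word m j.+1) (res_word m j).
Proof.
move=> w wP; apply: restr_span0 (bdiff_span mu w) => w' [e d].
by move: wP; rewrite /res_word -e eqSS; apply: contra => /andP[-> /=]; exact: leq_ltn_trans.
Qed.

Lemma gmuA (H : groupType) (g h k : H) :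
  fgext (fun x => gmu x k) (gmu g h) = fgext (gmu g) (gmu h k).
Proof.
have cancel_tail (x y z : {freeg H / int}) : x - z - (y - z) = x - y.
  by rewrite opprB addrA subrK.
rewrite {1 3}/gmu !raddfB /= !fgextU /gmu !mulgA.
rewrite [LHS]addrAC; congr (_ - _); rewrite cancel_tail.
rewrite [X in _ = X - _]addrAC [X in _ = _ - X]addrAC cancel_tail.
by rewrite !opprB !addrA [LHS]addrAC [RHS]addrAC; congr (_ + _); rewrite addrAC.
Qed.

Section WordFunctor.
Variables m j : nat.

Definition PW_obj a : zmodType := piece (res_word m j : pred (bword (FG a))).

Definition PW_map a b (f : grhom (FG a) (FG b)) : {additive PW_obj a -> PW_obj b} :=
  compress (bmapZ f) (res_word m j) (res_word m j).

Lemma PW_mapE a b (f : grhom (FG a) (FG b)) x :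
  PW_map f (restr (res_word m j) x) = restr (res_word m j) (bmapZ f x).
Proof. exact/adm_compress/adm_bmapZ. Qed.

Lemma bmapZ_id (K : choiceType) (f : K -> K) x : f =1 id -> bmapZ f x = x.
Proof.
move=> /funext ->; apply: (freeg_additive_ext (f := bmapZ id) (g := idfun)) => w /=.
by rewrite bmapZU bmap_id.
Qed.

Lemma bmapZ_comp (K L M : choiceType) (f : K -> L) (g : L -> M) x :
  bmapZ (g \o f) x = bmapZ g (bmapZ f x).
Proof.
apply: (freeg_additive_ext (f := bmapZ (g \o f)) (g := bmapZ g \o bmapZ f)) => w /=.
by rewrite !bmapZU bmap_comp.
Qed.

Lemma PW_map_id a x : PW_map (grid (FG a)) x = x.
Proof. by rewrite -[x]inclK PW_mapE bmapZ_id. Qed.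

Lemma PW_map_comp a b c (f : grhom (FG a) (FG b)) (g : grhom (FG b) (FG c)) x :
  PW_map (grcomp g f) x = PW_map g (PW_map f x).
Proof. by rewrite -[x]inclK !PW_mapE -bmapZ_comp. Qed.

(** The j-th term of the resolution of the m-th Passi functor. *)
Definition PW : functor := Functor PW_map_id PW_map_comp.

Definition cell a (w : bword (FG a)) : PW a := restr (res_word m j) (fgU w).

Lemma PW_cell a b (f : grhom (FG a) (FG b)) w : fmap PW f (cell w) = cell (bmap f w).
Proof. by rewrite [LHS]PW_mapE bmapZU. Qed.

Lemma cell_ext a (A : zmodType) (f g : {additive PW a -> A}) :
  (forall w, res_word m j w -> f (cell w) = g (cell w)) -> f =1 g.
Proof.
move=> fg; apply: freeg_additive_ext => u.
by rewrite -restrU; apply: fg; exact: (valP u).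
Qed.

End WordFunctor.
Arguments cell m j {a} w.

Section Gaps.
(** Words over the one-element type record just a sequence of gaps; these are
the types of cells of the functor [PW]. *)
Definition gaps (K : Type) (w : bword K) : bword unit := bmap (fun=> tt) w.

Lemma relab_gaps (K L : Type) (h : nat -> L) (w : bword K) : relab h (gaps w) = relab h w.
Proof. exact: relab_bmap. Qed.

Lemma gaps_relab (K : Type) (h : nat -> K) (s : bword unit) : gaps (relab h s) = s.
Proof. by rewrite /gaps; elim: s h => [[]|[] b s IHs] h //=; rewrite IHs. Qed.

Lemma wlen_gaps (K : Type) (w : bword K) : wlen (gaps w) = wlen w.
Proof. exact: wlen_bmap. Qed.

Lemma gaps_bmap (K L : Type) (f : K -> L) (w : bword K) : gaps (bmap f w) = gaps w.
Proof. by rewrite /gaps -bmap_comp. Qed.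

Lemma res_word_gaps (K : Type) m j (w : bword K) : res_word m j (gaps w) = res_word m j w.
Proof. by rewrite /res_word din_bmap dout_bmap. Qed.

Lemma res_word_relab (K L : Type) m j (h : nat -> L) (w : bword K) : res_word m j (relab h w) = res_word m j w.
Proof. by rewrite /res_word din_relab dout_relab. Qed.

Definition gen_nat a (i : nat) : FG a := if insub i is Some o then FG_gen o else 1%g.

(** The universal word: its letters are the distinct generators of a free
group. *)
Definition uword (s : bword unit) : bword (FG (wlen s)) := relab (gen_nat (wlen s)) s.

(** The homomorphism that takes the universal word to w, for w with gaps s. *)
Definition word_hom (s : bword unit) (G : groupType) (w : bword G) : grhom (FG (wlen s)) G :=
  FG_lift (fun i : 'I_(wlen s) => nth 1%g (letters w) i).

Lemma word_hom_gen s (G : groupType) (w : bword G) i :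
  (i < wlen s)%N -> word_hom s w (gen_nat _ i) = nth 1%g (letters w) i.
Proof. by move=> ilt; rewrite /gen_nat insubT FG_lift_gen. Qed.

Lemma bmap_uword s (G : groupType) (w : bword G) :
  gaps w = s -> bmap (word_hom s w) (uword s) = w.
Proof.
move=> ws; rewrite bmap_relab.
have -> : relab (word_hom s w \o gen_nat _) s = relab (nth 1%g (letters w)) s.
  by apply: eq_relab => i ilt; exact: word_hom_gen.
by rewrite -ws relab_gaps relab_nth.
Qed.

Lemma word_hom_uniq s (G : groupType) (f : grhom (FG (wlen s)) G) :
  word_hom s (bmap f (uword s)) = f.
Proof.
apply: FG_hom_ext => i; rewrite FG_lift_gen letters_bmap.
rewrite (nth_map 1%g); last by rewrite size_letters wlen_relab.
by rewrite letters_relab // /gen_nat insubT //= => ilt; congr (f (FG_gen _)); apply: val_inj.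
Qed.

Lemma word_hom_bmap s (G H : groupType) (f : grhom G H) (w : bword G) :
  wlen w = wlen s -> word_hom s (bmap f w) = grcomp f (word_hom s w).
Proof.
move=> ws; apply: FG_hom_ext => i; rewrite FG_lift_gen letters_bmap.
rewrite (nth_map 1%g) ?size_letters ?ws //.
by rewrite -[grcomp _ _ _]/(f (word_hom s w (FG_gen i))) FG_lift_gen.
Qed.

End Gaps.

Section Yoneda.
Variables (m j : nat) (F : functor) (t : forall s : bword unit, F (wlen s)).

Definition PW_ext_fun a : {additive PW m j a -> F a} :=
  fgext (fun u : {w : bword (FG a) | res_word m j w} =>
    fmap F (word_hom (gaps (val u)) (val u)) (t (gaps (val u)))).

Lemma PW_ext_cell a (w : bword (FG a)) : res_word m j w ->
  PW_ext_fun a (cell m j w) = fmap F (word_hom (gaps w) w) (t (gaps w)).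
Proof.
move=> wok; rewrite /cell -[w]/(val (Sub w wok : {w | res_word m j w})) restrU.
exact: fgextU.
Qed.

Lemma PW_ext_natural a b (f : grhom (FG a) (FG b)) x :
  PW_ext_fun b (fmap (PW m j) f x) = fmap F f (PW_ext_fun a x).
Proof.
apply: (cell_ext (f := PW_ext_fun b \o fmap (PW m j) f) (g := fmap F f \o PW_ext_fun a)) => w wok /=.
rewrite PW_cell !PW_ext_cell //; last by rewrite -res_word_gaps gaps_bmap res_word_gaps.
by rewrite gaps_bmap word_hom_bmap ?wlen_gaps // fmap_comp.
Qed.

(** The Yoneda lemma: [PW m j] is the direct sum of the functors Z[Hom(F_l, -)]
over the sequences of gaps, so t can be prescribed freely on universal words. *)
Definition PW_ext : nat_trans (PW m j) F := NatTrans PW_ext_natural.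

Lemma PW_ext_uword s : res_word m j s -> PW_ext _ (cell m j (uword s)) = t s.
Proof.
move=> sok; rewrite [LHS]PW_ext_cell ?res_word_relab //.
have e : gaps (uword s) = s by exact: gaps_relab.
have -> : uword s = bmap (grid (FG (wlen s))) (uword s) by rewrite bmap_id.
(* generalizing the sequence of gaps makes the dependent types convertible *)
suff E s' : s' = s -> fmap F (word_hom s' (bmap (grid (FG (wlen s))) (uword s))) (t s') = t s.
  by apply: (E (gaps (bmap (grid (FG (wlen s))) (uword s)))); rewrite gaps_bmap.
by move=> ->; rewrite word_hom_uniq fmap_id.
Qed.

End Yoneda.

Lemma PW_nt_eq m j (F : functor) (p q : nat_trans (PW m j) F) :
  (forall s, res_word m j s -> p _ (cell m j (uword s)) = q _ (cell m j (uword s))) -> p = q.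
Proof.
move=> pq; apply: nat_trans_ext => a; apply: cell_ext => w wok.
rewrite -(bmap_uword (erefl (gaps w))) -PW_cell !nt_natural pq //.
by rewrite res_word_gaps.
Qed.

(** A natural transformation out of [PW m j] is lifted by choosing preimages of
its values on universal words. *)
Lemma PW_projective m j : projective (PW m j).
Proof.
move=> F G p f p_epi.
pose t s := sval (cid (p_epi _ (f _ (cell m j (uword s))))).
have tE s : p _ (t s) = f _ (cell m j (uword s)) by exact: (svalP (cid (p_epi _ (f _ (cell m j (uword s)))))).
exists (PW_ext m j t); apply: PW_nt_eq => s sok /=.
by rewrite [PW_ext_fun _ _ _ _ _](PW_ext_uword t sok) tE.
Qed.

Section WordDiff.
Variables m j : nat.

Lemma gmu_morph (G H : groupType) (f : grhom G H) k h :
  fgext (fun x => fgU (f x)) (gmu k h) = gmu (f k) (f h).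
Proof. by rewrite /gmu !raddfB /= !fgextU gmulfM. Qed.

Definition PW_diff_fun a : {additive PW m j.+1 a -> PW m j a} :=
  compress (bdiff (@gmu (FG a))) (res_word m j.+1) (res_word m j).

Lemma PW_diffE a x : PW_diff_fun a (restr (res_word m j.+1) x) = restr (res_word m j) (bdiff (@gmu (FG a)) x).
Proof. exact/adm_compress/adm_bdiff. Qed.

Lemma PW_diff_natural a b (f : grhom (FG a) (FG b)) x :
  PW_diff_fun b (fmap (PW m j.+1) f x) = fmap (PW m j) f (PW_diff_fun a x).
Proof.
rewrite -[x]inclK [fmap (PW m j.+1) f _]PW_mapE !PW_diffE [RHS]PW_mapE.
by rewrite (bmapZ_bdiff (gmu_morph f)).
Qed.

Definition PW_diff : nat_trans (PW m j.+1) (PW m j) := NatTrans PW_diff_natural.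

End WordDiff.

Lemma PW_diff_diff m j a x : PW_diff m j a (PW_diff m j.+1 a x) = 0.
Proof.
rewrite -[x]inclK [PW_diff m j.+1 a _]PW_diffE [LHS]PW_diffE bdiff_bdiff ?raddf0 //.
exact: gmuA.
Qed.

(** [hsplit] contracts the part [mdiff] of the differential exactly.  The other part
raises the number of outer gaps, and with it the error term; since that number
is below m, the error is nilpotent.  The contraction is not natural in the free
group, only exactness is. *)
Lemma PW_contractible m j a : contractible (PW_diff m j.+1 a) (PW_diff m j a).
Proof.
pose S := hsplit (@fox_sig a) (@fox_rho a).
apply: (piece_contractible_mid (S := S) (t := fun w => (m - dout w)%N) (B := m.+1)).
- exact: adm_bdiff.
- move=> w wP; apply: restr_span0 (hsplit_span _ _ w) => w' [d e].
  by move: wP; rewrite /res_word d e eqSS.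
- by move=> w _; rewrite ltnS leq_subr.
move=> w /andP[/eqP dw ow].
have SE x : bdiff (@gmu (FG a)) x = mdiff (@gmu (FG a)) x + conv x by [].
rewrite /= !SE raddfD /= addrACA.
rewrite /S (hsplit_homotopy (@fox_mu_sig a) (@fox_sig_mu a) (@fox_rho_mu a)) ?dw //.
rewrite addrAC subrr add0r; apply: rpredD.
  have := hsplit_span (@fox_sig a) (@fox_rho a) w; rewrite -{2}(fgext_id (hsplit _ _ _)).
  move=> hs; rewrite fgext_comp; apply: fspan_fgext hs => w' [_ e] /=.
  by apply: fspan_sub (conv_span w') => w'' [_ -> _]; rewrite e; apply: ltn_sub2l.
have cs := conv_span w; rewrite -(fgext_id (conv _)) fgext_comp; apply: fspan_fgext cs => w' [_ e _] /=.
by apply: fspan_sub (hsplit_span _ _ w') => w'' [_ ->]; rewrite e; apply: ltn_sub2l.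
Qed.

(** * The augmentation onto the Passi functor *)

Section AugPowers.
Variable G : groupType.

Lemma ZG_mulE (x y : ZG G) : x * y = ZG_mul x y. Proof. by []. Qed.

Lemma ZG_UU (g h : G) : (fgU g : ZG G) * fgU h = fgU (g * h)%g.
Proof. exact: ZG_mulUU. Qed.

Lemma augmU (g : G) : augm G (fgU g) = 1.
Proof. exact: degU. Qed.

Lemma augmM (x y : ZG G) : augm G (x * y) = augm G x * augm G y.
Proof.
move: x; apply: (freeg_additive_ext (f := augm G \o ZG_mulr y)
   (g := GRing.mulr_fun (augm G y) (augm G))) => g.
move: y; apply: (freeg_additive_ext (f := augm G \o ZG_mul (fgU g))
   (g := GRing.mull_fun (augm G (fgU g)) (augm G))) => h.
by rewrite /= ZG_mulUU !augmU.
Qed.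

Lemma aug_idealP (x : ZG G) : (x \in aug_ideal G) = (augm G x == 0).
Proof. by []. Qed.

Lemma aug_ideal_mulr (x y : ZG G) : x \in aug_ideal G -> x * y \in aug_ideal G.
Proof. by rewrite !aug_idealP augmM => /eqP ->; rewrite mul0r. Qed.

Lemma aug_idealU (g : G) : (fgU g : ZG G) - 1 \in aug_ideal G.
Proof. by rewrite aug_idealP raddfB /= -[X in _ - augm _ X]/(fgU 1%g : ZG G) !augmU subrr. Qed.

(** The powers of the ideal are spanned by products of elements of the ideal, so
a factor is prepended to such a product. *)
Lemma aug_power_mul k (x y : ZG G) :
  x \in aug_ideal G -> y \in aug_power G k -> x * y \in aug_power G k.+1.
Proof.
move=> xI; apply: (zspan_image (f := ZG_mul x)) => _ [z [zI ->]].
apply: mem_zspan; exists (fun i => if unlift ord0 i is Some i' then z i' else x).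
split=> [i|]; first by case: unliftP.
rewrite big_ord_recl unlift_none; congr (_ * _).
by apply: eq_bigr => i _; rewrite liftK.
Qed.

Lemma aug_power1 (x : ZG G) : x \in aug_ideal G -> x \in aug_power G 1.
Proof.
by move=> xI; apply: mem_zspan; exists (fun=> x); split=> //; rewrite big_ord1.
Qed.

Lemma aug_power_ideal k (x : ZG G) : x \in aug_power G k.+1 -> x \in aug_ideal G.
Proof.
apply: (zspan_image (f := idfun)) => _ [z [zI ->]] /=.
by rewrite big_ord_recl aug_ideal_mulr.
Qed.

End AugPowers.

Section Augmentation.
Variable G : groupType.
Notation ZW := {freeg (bword G) / int}.

(** The word g_0, ..., g_k with outer gaps stands for the product of the
g_i - 1; the sign (-1)^k is what makes this vanish on boundaries, since an inner
gap is replaced by the product and by the outer gap with the same sign. *)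
Fixpoint alpha_word (w : bword G) : ZG G :=
  match w with
  | BOne g => (fgU g : ZG G) - 1
  | BCons g true _ => 0
  | BCons g false w' => - (((fgU g : ZG G) - 1) * alpha_word w')
  end.

Lemma alpha_word_power w : alpha_word w \in aug_power G (dout w).+1.
Proof.
elim: w => [g|g [] w IHw] /=; first exact/aug_power1/aug_idealU.
  exact: rpred0.
by rewrite rpredN; apply: aug_power_mul => //; exact: aug_idealU.
Qed.

Lemma alpha_word_ideal w : alpha_word w \in aug_ideal G.
Proof. exact: aug_power_ideal (alpha_word_power w). Qed.

Definition alpha : ZW -> subz (aug_ideal G) :=
  fgext (fun w => Subz (alpha_word_ideal w)).
HB.instance Definition _ := GRing.Additive.on alpha.
Arguments alpha : simpl never.

Lemma alphaU w : val (alpha (fgU w)) = alpha_word w.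
Proof. by rewrite /alpha fgextU. Qed.

Lemma alpha_inner g x : alpha (bcons g true x) = 0.
Proof.
apply: (freeg_additive_ext (f := alpha \o bcons g true) (g := \0)) => w /=.
by apply: val_inj; rewrite bconsU alphaU.
Qed.

Lemma alpha_outer g x : val (alpha (bcons g false x)) = - (((fgU g : ZG G) - 1) * val (alpha x)).
Proof.
apply: (freeg_additive_ext (f := val \o alpha \o bcons g false)
  (g := \- (ZG_mul ((fgU g : ZG G) - 1) \o val \o alpha))) => w /=.
by rewrite bconsU !alphaU.
Qed.

Lemma alpha_one y : val (alpha (heads (BOne 1%g) y)) = (y : ZG G) - fgext (fun=> 1) y.
Proof.
apply: (freeg_additive_ext (f := val \o alpha \o heads (BOne 1%g))
  (g := idfun \- fgext (fun=> 1 : ZG G))) => g /=.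
by rewrite fgextU [heads _ _]fgextU alphaU.
Qed.

(** [<g> |-> g - 1] is multiplicative. *)
Lemma alpha_hmul g x : val (alpha (hmul (@gmu G) g x)) = ((fgU g : ZG G) - 1) * val (alpha x).
Proof.
have fgM (h : G) : ((fgU (g * h)%g : ZG G) - 1) - ((fgU g : ZG G) - 1) - ((fgU h : ZG G) - 1)
    = ((fgU g : ZG G) - 1) * ((fgU h : ZG G) - 1).
  rewrite [RHS]mulrBl mul1r mulrBr ZG_UU mulr1; congr (_ - _).
  by rewrite opprB addrA subrK.
apply: (freeg_additive_ext (f := val \o alpha \o hmul (@gmu G) g)
  (g := ZG_mul ((fgU g : ZG G) - 1) \o val \o alpha)) => w /=.
rewrite hmulU alphaU /gmu ?raddfB /= /heads !fgextU !alphaU.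
case: w => [h|h [] w] /=; first exact: fgM.
  by rewrite !subr0 -ZG_mulE mulr0.
rewrite -ZG_mulE mulrN mulrA -fgM [in RHS]mulrBl [in RHS]mulrBl.
by set A := _ * _; set B := _ * _; set C := _ * _; rewrite !opprD !opprK.
Qed.

Lemma alpha_bdiff x : alpha (bdiff (@gmu G) x) = 0.
Proof.
move: x; apply: (ZW_ind_ext (f := alpha \o bdiff (@gmu G)) (g := \0)) => [g|g b x /= IHx] /=.
  by rewrite bdiff_one raddf0.
apply: val_inj; case: b.
  rewrite bdiff_inner raddfB raddfD /= alpha_inner /= subr0.
  by rewrite raddfD /= alpha_hmul alpha_outer subrr.
by rewrite bdiff_outer alpha_outer IHx /= mulr0 oppr0.
Qed.

End Augmentation.

(** * Exactness in degree zero *)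

Section DegreeZero.
Variable G : groupType.
Notation ZW := {freeg (bword G) / int}.
Notation mu := (@gmu G).
Implicit Types (x : ZW) (y z : ZG G).

Lemma fgext_const (A : zmodType) (c : A) y : fgext (fun=> c) y = c *~ augm G y.
Proof.
move: y (fspan_all y); apply: fspan_ind => [|u v uE vE|g _].
- by rewrite !raddf0.
- by rewrite !raddfB /= uE vE.
by rewrite fgextU augmU mulr1z.
Qed.

(** The letter 1 is a placeholder, which [heads] replaces. *)
Definition single : ZG G -> ZW := heads (BOne (1%g : G)).
HB.instance Definition _ := GRing.Additive.on single.
Arguments single : simpl never.

Lemma singleU (g : G) : single (fgU g) = fgU (BOne g). Proof. exact: fgextU. Qed.

Lemma bdiff_single y : bdiff mu (single y) = 0.
Proof.
apply: (freeg_additive_ext (f := bdiff mu \o single) (g := \0)) => g /=.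
by rewrite singleU bdiff_one.
Qed.

Lemma hmul_single g y : hmul mu g (single y) = single (fgext (mu g) y).
Proof. exact: hmul_heads. Qed.

Definition hmulL y x : ZW := bil (fun g => hmul mu g) y x.

(** On the augmentation ideal the product of [gmu] coincides with the product of
the group ring: the correction terms are multiples of augmentations. *)
Lemma hmulL_single y z : y \in aug_ideal G -> z \in aug_ideal G ->
  hmulL y (single z) = single (y * z).
Proof.
move=> /eqP yI /eqP zI.
have mE g : hmul mu g (single z) = single (((fgU g : ZG G) - 1) * z).
  rewrite hmul_single; congr single.
  rewrite mulrBl mul1r -[(fgU g : ZG G) * z]/(ZG_mul (fgU g) z) /ZG_mul fgextU.
  rewrite -[X in _ = _ - X]fgext_id -fgextB.
  rewrite -[RHS]subr0 -[X in _ = _ - X](mulr0z (fgU g)) -zI -fgext_const -fgextB.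
  by apply: eq_fgext => h; rewrite /gmu /= addrAC.
rewrite /hmulL /bil (eq_fgext mE).
rewrite -(fgext_comp single (fun g => ((fgU g : ZG G) - 1) * z)); congr single.
rewrite -[RHS]subr0 -[X in _ = _ - X](mulr0z z) -yI -fgext_const.
have -> : y * z = fgext (fun g => (fgU g : ZG G) * z) y.
  apply: (freeg_additive_ext (f := ZG_mulr z) (g := fgext (fun g => (fgU g : ZG G) * z))) => g.
  by rewrite /= fgextU.
by rewrite -fgextB; apply: eq_fgext => g /=; rewrite mulrBl mul1r.
Qed.

(** The differential of an inner gap before a cycle is the product plus the outer
gap, so up to a boundary a product is minus the word with an outer gap. *)
Lemma hmulL_bdiff y x : bdiff mu x = 0 ->
  hmulL y x = bdiff mu (blin true y x) - blin false y x.
Proof.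
move=> x0; rewrite /hmulL /blin bil_comp /bil -fgextB; apply: eq_fgext => g /=.
by rewrite bdiff_inner x0 raddf0 subr0 addrK.
Qed.

(** x is homologous to a combination of words with at least k outer gaps; in the
complex [PW k] such words vanish. *)
Definition reach (k : nat) x : Prop :=
  exists Y, x - bdiff mu Y \in fspan (fun w : bword G => (k <= dout w)%N).

Lemma reach0 k : reach k 0.
Proof. by exists 0; rewrite raddf0 subrr rpred0. Qed.

Lemma reachB k x x' : reach k x -> reach k x' -> reach k (x - x').
Proof.
move=> [Y xY] [Y' xY']; exists (Y - Y').
by rewrite raddfB /= opprD opprK addrACA [- x' + _]addrC -[X in _ + X]opprB rpredB.
Qed.

(** Each factor from the augmentation ideal can be traded for an outer gap. *)
Lemma reach_hmulL k y x : bdiff mu x = 0 -> reach k x -> reach k.+1 (hmulL y x).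
Proof.
move=> x0 [Y xY]; exists (blin true y x - blin false y Y).
rewrite hmulL_bdiff // raddfB /=.
have -> : bdiff mu (blin false y Y) = blin false y (bdiff mu Y).
  by rewrite /blin bil_comp; apply: eq_bil => g /=; rewrite bdiff_outer.
rewrite opprB addrC addrA subrK -raddfB /= -opprB raddfN rpredN.
by apply: fspan_fgext (fspan_all y) => g _; apply: span_bcons xY.
Qed.

Lemma reach_power k y : y \in aug_power G k.+1 -> reach k (single y).
Proof.
move: y; apply: zspan_ind => [|u v ur vr|_ [z [zI ->]]]; first by rewrite raddf0; exact: reach0.
  by rewrite raddfB; exact: reachB.
elim: k z zI => [|k IHk] z zI.
  by exists 0; rewrite raddf0 subr0; apply: fspan_sub (fspan_all _).
have pI (l : nat) (t : 'I_l.+1 -> ZG G) : (forall i, t i \in aug_ideal G) -> \prod_i t i \in aug_ideal G.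
  by move=> tI; rewrite big_ord_recl aug_ideal_mulr.
rewrite big_ord_recl -hmulL_single ?pI //.
by apply: reach_hmulL; [exact: bdiff_single|apply: IHk => i; exact: zI].
Qed.

(** The letter 1 satisfies [<1><1> = -<1>], so it can be traded for outer gaps
indefinitely.  This compensates for [<1>] being sent to 1 - 1 = 0. *)
Lemma reach_one k : reach k (single (fgU 1%g)).
Proof.
elim: k => [|k IHk]; first by exists 0; rewrite raddf0 subr0; apply: fspan_sub (fspan_all _).
have -> : single (fgU 1%g) = 0 - hmulL (fgU 1%g) (single (fgU 1%g)).
  rewrite /hmulL bilU singleU /= hmulU /= /gmu mulg1 subrr !sub0r raddfN /= opprK.
  by rewrite -singleU.
apply: reachB; first exact: reach0.
by apply: reach_hmulL => //; exact: bdiff_single.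
Qed.

(** Up to boundaries every outer gap can be replaced by a product, leaving
one-letter words. *)
Lemma collapse x : x \in fspan (fun w : bword G => din w = 0%N) ->
  exists y Y, x = single y + bdiff mu Y.
Proof.
move: x; apply: fspan_ind => [|u v [y [Y ->]] [y' [Y' ->]]|w]; first by exists 0, 0; rewrite !raddf0 addr0.
  by exists (y - y'), (Y - Y'); rewrite !raddfB /= opprD addrACA.
elim: w => [g _|g [] w IHw] //=; first by exists (fgU g), 0; rewrite singleU raddf0 addr0.
rewrite add0n => /IHw[y [Y wE]].
(* minus the product, homologous to the outer gap via the inner one *)
exists (- fgext (mu g) y), (bcons g true (single y) + bcons g false Y).
rewrite -bconsU wE raddfN [RHS]/= [bdiff mu (_ + _)]raddfD [bcons g false (_ + _)]raddfD /=.
rewrite bdiff_inner bdiff_single raddf0 subr0.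
by rewrite bdiff_outer addrA -hmul_single addKr.
Qed.

Lemma alpha_single y : val (alpha (single y)) = y - (fgU 1%g : ZG G) *~ augm G y.
Proof. by rewrite alpha_one fgext_const. Qed.

(** Collapse x to a one-letter word y.  Its image y - aug(y) 1 in the augmentation
ideal lies in the power I^(m+1), so it can be traded for m outer gaps, and so
can the multiple of [<1>]. *)
Lemma reach_alpha m x : x \in fspan (fun w : bword G => din w = 0%N) ->
  val (alpha x) \in aug_power G m.+1 -> reach m x.
Proof.
move=> /collapse[y [Y ->]]; rewrite raddfD /= alpha_bdiff /= addr0 alpha_single => yI.
(* an arbitrary multiple, as the augmentation of y is not controlled *)
have one_reach (c : int) : reach m (single ((fgU 1%g : ZG G) *~ c)).
  rewrite raddfMz /=; case: c => n.
    elim: n => [|n IHn]; first exact: reach0.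
    rewrite -pmulrn mulrSr pmulrn -[X in _ + X]opprK; apply: reachB => //.
    by rewrite -sub0r; apply: reachB; [exact: reach0|exact: reach_one].
  rewrite NegzE mulrNz -sub0r; apply: reachB; first exact: reach0.
  elim: {n}n.+1 => [|n IHn]; first exact: reach0.
  rewrite -pmulrn mulrSr pmulrn -[X in _ + X]opprK; apply: reachB => //.
  by rewrite -sub0r; apply: reachB; [exact: reach0|exact: reach_one].
have := reachB (reach_power yI) (one_reach (- augm G y)).
rewrite mulrNz raddfN opprK raddfB /= subrK => -[Z ZP].
by exists (Y + Z); rewrite [bdiff mu (Y + Z)]raddfD /= opprD [- _ - _]addrC addrACA subrr addr0.
Qed.

End DegreeZero.

(** * The resolution of the Passi functor *)

Lemma alpha_natural (G H : groupType) (f : grhom G H) x :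
  aug_ideal_hom f (alpha x) = alpha (bmapZ f x).
Proof.
apply: (freeg_additive_ext (f := aug_ideal_hom f \o @alpha G) (g := @alpha H \o bmapZ f)) => w.
apply: val_inj; rewrite /= bmapZU !alphaU.
have fU (g : G) : ZG_map f ((fgU g : ZG G) - 1) = (fgU (f g) : ZG H) - 1.
  by rewrite rmorphB rmorph1 /= ZG_mapU.
elim: w => [g|g [] w IHw] //=; first exact: raddf0.
by rewrite rmorphN rmorphM /= fU IHw.
Qed.

Lemma alpha_word_inner (G : groupType) (w : bword G) : (0 < din w)%N -> alpha_word w = 0.
Proof.
by elim: w => [//|g [] w IHw] //= dw; rewrite IHw // mulr0 oppr0.
Qed.

Section Resolution.
Variable m : nat.

Definition PW_aug_fun a : {additive PW m 0 a -> Pa m a} :=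
  \pi_(Quotient.quot (aug_power_in (FG a) m)) \o @alpha (FG a) \o incl (res_word m 0).

Lemma PW_aug_natural a b (f : grhom (FG a) (FG b)) x :
  PW_aug_fun b (fmap (PW m 0) f x) = fmap (Pa m) f (PW_aug_fun a x).
Proof.
apply: (cell_ext (f := PW_aug_fun b \o fmap (PW m 0) f) (g := fmap (Pa m) f \o PW_aug_fun a)).
move=> w wok.
rewrite /= PW_cell !incl_restr; first last.
- by apply: fspanU; rewrite -res_word_gaps gaps_bmap res_word_gaps.
- exact: fspanU.
by rewrite [RHS]Passi_mapU alpha_natural bmapZU.
Qed.

Definition PW_aug : nat_trans (PW m 0) (Pa m) := NatTrans PW_aug_natural.

(** A word with exactly m outer gaps is discarded by [restr] and maps into
I^(m+1). *)
Lemma PW_augE a x : x \in fspan (fun w : bword (FG a) => (dout w <= m)%N) ->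
  PW_aug a (restr (res_word m 0) x) = \pi_(Quotient.quot (aug_power_in (FG a) m)) (alpha x).
Proof.
apply: (fspan_eq (f := PW_aug a \o restr (res_word m 0))
  (g := \pi_(Quotient.quot (aug_power_in (FG a) m)) \o @alpha (FG a))) => w dw /=.
have [wok|wok] := boolP (res_word m 0 w); first by rewrite incl_restr //; exact: fspanU.
rewrite restr_out // !raddf0; apply/esym/eqP; rewrite quot_pi_eq0.
rewrite -[_ \in _]/(val (alpha (fgU w)) \in aug_power (FG a) m.+1) alphaU.
have [d0|d0] := posnP (din w); last by rewrite alpha_word_inner // rpred0.
have -> : m = dout w; last exact: alpha_word_power.
by apply: anti_leq; apply/andP; split=> //; move: wok; rewrite /res_word d0 /= -leqNgt.
Qed.

Lemma PW_aug_epi : nt_epi PW_aug.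
Proof.
move=> a; elim/quotW=> y; exists (restr (res_word m 0) (single (val y))).
rewrite PW_augE; last first.
  by apply: fspan_fgext (fspan_all _) => g _; exact: fspanU.
congr (\pi_ _ _); apply: val_inj; rewrite alpha_single.
by rewrite (eqP (valP y)) mulr0z subr0.
Qed.

Lemma bdiff_incl_span j a (x : PW m j.+1 a) :
  bdiff (@gmu (FG a)) (incl (res_word m j.+1) x) \in
    fspan (fun w : bword (FG a) => din w = j /\ (dout w <= m)%N).
Proof.
rewrite -(fgext_id (incl _ x)) fgext_comp.
have : incl (res_word m j.+1) x \in fspan (fun w : bword (FG a) => res_word m j.+1 w).
  apply: fspan_fgext (fspan_all x) => u _; apply: fspanU; exact: (valP u).
apply: fspan_fgext => w /andP[/eqP dw ow] /=.
apply: rpredD.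
  have := mdiff_span (mu := @gmu (FG a)) (r := fun _ _ _ => True) w (fun _ _ => fspan_all _).
  apply: fspan_sub => w' [e -> _]; split; last exact: ltnW.
  by move: e; rewrite dw => -[].
have := conv_span w; apply: fspan_sub => w' [e -> _]; split=> //.
by move: e; rewrite dw => -[].
Qed.

(** Exactness at degree zero: an element whose image is in I^(m+1) bounds up to
words with m outer gaps, by [reach_alpha]. *)
Lemma PW_exact0 : nt_exact (PW_diff m 0) PW_aug.
Proof.
move=> a y; split=> [/eqP|[x <-]]; last first.
  rewrite -{1}[x]inclK [PW_diff m 0 a _]PW_diffE PW_augE ?alpha_bdiff ?raddf0 //.
  by apply: fspan_sub (bdiff_incl_span x) => w [].
rewrite -{1}[y]inclK PW_augE; last first.
  apply: fspan_fgext (fspan_all y) => u _; apply: fspanU.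
  by have /andP[_ /ltnW] := valP u.
rewrite quot_pi_eq0 => yI.
have [|Y YP] := reach_alpha _ (yI : val (alpha (incl (res_word m 0) y)) \in aug_power (FG a) m.+1).
  apply: fspan_fgext (fspan_all y) => u _; apply: fspanU.
  by have /andP[/eqP] := valP u.
exists (restr (res_word m 1) Y); rewrite [LHS]PW_diffE.
apply/eqP; rewrite eq_sym -subr_eq0 -{1}[y]inclK -raddfB; apply/eqP.
apply: restr_span0 YP => w mw; rewrite /res_word negb_and -leqNgt mw orbT //.
Qed.

Lemma PW_exactS j : nt_exact (PW_diff m j.+1) (PW_diff m j).
Proof.
move=> a y; split=> [y0|[x <-]]; last exact: PW_diff_diff.
have [K KE] := contractible_section (@PW_diff_diff m j a) (PW_contractible m j a).
by exists (K y); exact: KE.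
Qed.

Definition Passi_resolution : proj_resolution (Pa m) :=
  ProjResolution (fun i => @PW_projective m i) PW_aug_epi PW_exact0 PW_exactS.

End Resolution.

(** * The algebra of blocks *)

Section SetAlgebra.
Variable n : nat.
Notation K := {set 'I_n}.
Implicit Types (R S T X : K) (s : seq K).

Definition asc R S : bool :=
  [&& R != set0, S != set0 & [forall x in R, forall y in S, (x < y)%N]].

Lemma ascP R S : reflect [/\ R != set0, S != set0 & forall x y, x \in R -> y \in S -> (x < y)%N] (asc R S).
Proof.
apply: (iffP and3P) => -[R0 S0 RS]; split=> //.
  by move=> x y xR yS; move/forall_inP/(_ _ xR)/forall_inP/(_ _ yS): RS.
by apply/forall_inP => x xR; apply/forall_inP => y yS; exact: RS.
Qed.

Lemma asc_disjoint R S : asc R S -> [disjoint R & S].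
Proof.
move=> /ascP[_ _ RS]; rewrite -setI_eq0; apply/eqP/setP => x; rewrite !inE.
by apply/negP => /andP[xR xS]; have := RS _ _ xR xS; rewrite ltnn.
Qed.

Lemma disjointsUl R S T : [disjoint R :|: S & T] = [disjoint R & T] && [disjoint S & T].
Proof. by rewrite -!setI_eq0 setIUl setU_eq0. Qed.

Lemma disjointsUr R S T : [disjoint R & S :|: T] = [disjoint R & S] && [disjoint R & T].
Proof. by rewrite -!setI_eq0 setIUr setU_eq0. Qed.

Lemma setU_neq0 R S : R != set0 -> R :|: S != set0.
Proof. by rewrite setU_eq0 negb_and => ->. Qed.

Lemma ascUr R S T : asc S T -> asc R (S :|: T) = asc R S.
Proof.
move=> /ascP[S0 T0 ST]; apply/ascP/ascP => -[R0 ST0 RST]; split=> //.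
- by move=> x y xR yS; apply: RST; rewrite // inE yS.
- exact: setU_neq0.
move=> x y xR; rewrite inE => /orP[yS|yT]; first exact: RST.
by have [z zS] := set0Pn _ S0; exact: ltn_trans (RST _ _ xR zS) (ST _ _ zS yT).
Qed.

(** The dual product of blocks.  It comes from [gmu] through the multilinear
coefficient: a product of generators over R times one over S contributes the
generators over the union from the term gh, while the terms g and h contribute
only if S, respectively R, is empty. *)
Definition smu R S : {freeg K / int} :=
  if R == set0 then (if S == set0 then - fgU set0 else 0)
  else if (S != set0) && [disjoint R & S] then fgU (R :|: S) else 0.

(** The leading part of the product, for the filtration by inversions. *)
Definition smu0 R S : {freeg K / int} :=
  if R == set0 then (if S == set0 then - fgU set0 else 0)
  else if asc R S then fgU (R :|: S) else 0.

(** Associativity: both sides are the union if the blocks are nonempty and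
pairwise disjoint. *)
Lemma smuA R S T : fgext (fun Q => smu Q T) (smu R S) = fgext (smu R) (smu S T).
Proof.
have m0 X Y : X != set0 -> smu X Y = if (Y != set0) && [disjoint X & Y] then fgU (X :|: Y) else 0.
  by rewrite /smu => /negPf ->.
have m00 : smu set0 set0 = - fgU set0 by rewrite /smu eqxx.
have m0r Y : Y != set0 -> smu set0 Y = 0 by rewrite /smu eqxx => /negPf ->.
have mr0 X : X != set0 -> smu X set0 = 0 by move=> /m0 ->; rewrite eqxx.
have [->|R0] := eqVneq R set0; have [->|S0] := eqVneq S set0.
- have [->|T0] := eqVneq T set0; first by rewrite m00 !raddfN /= !fgextU m00.
  by rewrite m00 m0r // raddf0 raddfN /= fgextU m0r // oppr0.
- rewrite m0r // raddf0; have [->|T0] := eqVneq T set0; first by rewrite mr0 // raddf0.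
  rewrite m0 // T0 /=; case: ifP => _; rewrite ?raddf0 // fgextU m0r //.
  exact: setU_neq0.
- rewrite mr0 // raddf0; have [->|T0] := eqVneq T set0; last by rewrite m0r ?raddf0.
  by rewrite m00 raddfN /= fgextU mr0 // oppr0.
have [->|T0] := eqVneq T set0.
  rewrite (mr0 S) // raddf0 m0 //; case: ifP => _; rewrite ?raddf0 // fgextU mr0 //.
  exact: setU_neq0.
rewrite (m0 R) // (m0 S) // S0 T0 /=.
have [RS|RS] := boolP [disjoint R & S]; have [ST|ST] := boolP [disjoint S & T]; rewrite ?raddf0 //= ?fgextU.
- by rewrite !m0 ?setU_neq0 // T0 /= disjointsUl disjointsUr ST RS andbT setUA.
- by rewrite m0 ?setU_neq0 // disjointsUl (negPf ST) !andbF.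
by rewrite m0 // disjointsUr (negPf RS) andbF.
Qed.

(** The blocks Q that occur in the products [smu], [smu0] and [smu1] of R and S. *)
Definition rall R S Q : Prop :=
  [/\ R != set0, S != set0, [disjoint R & S] & Q = R :|: S] \/ [/\ R = set0, S = set0 & Q = set0].
Definition rasc R S Q : Prop :=
  (asc R S /\ Q = R :|: S) \/ [/\ R = set0, S = set0 & Q = set0].
Definition rdesc R S Q : Prop :=
  [/\ R != set0, S != set0, [disjoint R & S], ~~ asc R S & Q = R :|: S].

Lemma rasc_all R S Q : rasc R S Q -> rall R S Q.
Proof.
by move=> [[RS ->]|]; [left; split=> //; [case/ascP: RS|case/ascP: RS|exact: asc_disjoint]|right].
Qed.

Lemma rdesc_all R S Q : rdesc R S Q -> rall R S Q.
Proof. by move=> [R0 S0 RS _ ->]; left. Qed.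

Lemma smu_span R S : smu R S \in fspan (rall R S).
Proof.
rewrite /smu; have [R0|R0] := eqVneq R set0; have [S0|S0] := eqVneq S set0; rewrite ?rpred0 //=.
  by rewrite rpredN; apply: fspanU; right.
by case: ifP => RS; rewrite ?rpred0 //; apply: fspanU; left.
Qed.

Lemma smu0_span R S : smu0 R S \in fspan (rasc R S).
Proof.
rewrite /smu0; have [R0|R0] := eqVneq R set0; have [S0|S0] := eqVneq S set0; rewrite ?rpred0 //=.
- by rewrite rpredN; apply: fspanU; right.
- by case: ifP => RS; rewrite ?rpred0 //; apply: fspanU; left.
by case: ifP => RS; rewrite ?rpred0 //; apply: fspanU; left.
Qed.

Definition smu1 R S : {freeg K / int} := smu R S - smu0 R S.

Lemma smu1_span R S : smu1 R S \in fspan (rdesc R S).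
Proof.
rewrite /smu1 /smu /smu0; have [R0|R0] := eqVneq R set0; rewrite ?subrr ?rpred0 //.
have [RS|RS] := boolP (asc R S).
  by rewrite asc_disjoint //; case/ascP: RS => _ -> _; rewrite subrr rpred0.
rewrite subr0; case: ifP => [/andP[S0 dRS]|_]; last exact: rpred0.
exact: fspanU.
Qed.

(** The lists of pairwise disjoint, possibly empty, blocks with union X. *)
Fixpoint part X s : bool :=
  if s is R :: s' then (R \subset X) && part (X :\: R) s' else X == set0.

Definition nonempties s := all (fun R => R != set0) s.
Definition singles s := all (fun R => #|R| == 1%N) s.

Definition crossings R S : nat := #|[set p in setX R S | (p.2 < p.1)%N]|.
Fixpoint cross R s : nat := if s is Q :: s' then (crossings R Q + cross R s')%N else 0%N.
(** Merging two blocks that are not in ascending order forgets at least one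
inversion, which makes this number a weight for the error terms. *)
Fixpoint inversions s : nat := if s is R :: s' then (cross R s' + inversions s')%N else 0%N.

Lemma crossings0l S : crossings set0 S = 0%N.
Proof. by apply/eqP; rewrite cards_eq0; apply/eqP/setP => p; rewrite !inE. Qed.
Lemma crossings0r R : crossings R set0 = 0%N.
Proof. by apply/eqP; rewrite cards_eq0; apply/eqP/setP => p; rewrite !inE andbF. Qed.

Lemma crossingsUl R S T : [disjoint R & S] -> crossings (R :|: S) T = (crossings R T + crossings S T)%N.
Proof.
move=> RS; rewrite /crossings -cardsUI [X in (_ + X)%N](_ : _ = 0%N) ?addn0.
  by apply: eq_card => p; rewrite !inE; case: (p.1 \in R); case: (p.1 \in S); case: (p.2 \in T); case: (_ < _)%N.
apply/eqP; rewrite cards_eq0; apply/eqP/setP => p; rewrite !inE.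
have := RS; rewrite -setI_eq0 => /eqP/setP/(_ p.1); rewrite !inE.
by case: (p.1 \in R); case: (p.1 \in S); rewrite ?andbF.
Qed.

Lemma crossingsUr R S T : [disjoint S & T] -> crossings R (S :|: T) = (crossings R S + crossings R T)%N.
Proof.
move=> ST; rewrite /crossings -cardsUI [X in (_ + X)%N](_ : _ = 0%N) ?addn0.
  by apply: eq_card => p; rewrite !inE; case: (p.1 \in R); case: (p.2 \in S); case: (p.2 \in T); case: (_ < _)%N.
apply/eqP; rewrite cards_eq0; apply/eqP/setP => p; rewrite !inE.
have := ST; rewrite -setI_eq0 => /eqP/setP/(_ p.2); rewrite !inE.
by case: (p.2 \in S); case: (p.2 \in T); rewrite ?andbF.
Qed.

Lemma crossings_asc R S : asc R S -> crossings R S = 0%N.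
Proof.
move=> /ascP[_ _ RS]; apply/eqP; rewrite cards_eq0; apply/eqP/setP => -[x y]; rewrite !inE /=.
by apply/negP => /andP[/andP[xR yS]]; apply/negP; rewrite -leqNgt ltnW ?RS.
Qed.

(** Failure of ascent exhibits a pair in the wrong order. *)
Lemma crossings_desc R S : R != set0 -> S != set0 -> [disjoint R & S] -> ~~ asc R S -> (0 < crossings R S)%N.
Proof.
move=> R0 S0 RS; rewrite /asc R0 S0 /= => /forall_inPn[x xR /forall_inPn[y yS]]; rewrite -leqNgt => yx.
rewrite card_gt0; apply/set0Pn; exists (x, y); rewrite !inE xR yS /= ltn_neqAle yx andbT.
by apply/eqP => /val_inj exy; move: RS; rewrite -setI_eq0 => /eqP/setP/(_ x); rewrite !inE xR -exy yS.
Qed.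

Lemma crossings_le R S : (crossings R S <= #|R| * #|S|)%N.
Proof. by rewrite -cardsX; apply: subset_leq_card; apply/subsetP => p; rewrite !inE => /andP[]. Qed.

Definition total_card s : nat := sumn (map (fun R : K => #|R|) s).

Lemma inversions_le s : (inversions s <= total_card s * total_card s)%N.
Proof.
elim: s => //= R s IHs.
have : (cross R s <= #|R| * total_card s)%N.
  by elim: s {IHs} => //= S s IHs; have := crossings_le R S; rewrite /total_card /= -/(total_card s) mulnDr; lia.
rewrite /total_card /= -/(total_card s); nia.
Qed.

Lemma part_total_card X s : part X s -> total_card s = #|X|.
Proof.
elim: s X => [|R s IHs] X /=; first by move/eqP => ->; rewrite cards0.
by move=> /andP[RX /IHs]; rewrite /total_card /= -/(total_card s) => ->; rewrite cardsDS // subnKC // subset_leq_card.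
Qed.

Lemma nonempties_size s : nonempties s -> (size s <= total_card s)%N.
Proof.
elim: s => //= R s IHs /andP[R0 /IHs]; rewrite /total_card /= -/(total_card s).
by move=> H; move: R0; rewrite -card_gt0 => R0; exact: (leq_add R0 H).
Qed.

Lemma singles_total_card s : singles s -> total_card s = size s.
Proof. by elim: s => //= R s IHs /andP[/eqP R1 /IHs]; rewrite /total_card /= -/(total_card s) R1 => ->. Qed.

Section Merged.
Variable r : K -> K -> K -> Prop.
Hypothesis r_all : forall R S Q, r R S Q -> rall R S Q.

Lemma part_merged X s s' : merged r s s' -> part X s = part X s'.
Proof.
move=> [s1 [R [S [Q [s2 [-> -> /r_all RSQ]]]]]].
elim: s1 X => [|P s1 IHs] X /=; last by rewrite IHs.
case: RSQ => [[_ _ dRS ->]|[-> -> ->]]; last by rewrite !sub0set /= !setD0.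
by rewrite subUset subsetD setDDl [[disjoint S & R]]disjoint_sym dRS andbT andbA.
Qed.

Lemma nonempties_merged s s' : merged r s s' -> nonempties s = nonempties s'.
Proof.
move=> [s1 [R [S [Q [s2 [-> -> /r_all RSQ]]]]]]; rewrite /nonempties !all_cat /=; congr (_ && _).
case: RSQ => [[R0 S0 _ ->]|[-> -> ->]]; last by rewrite eqxx.
by rewrite R0 S0 setU_neq0.
Qed.

(** Crossings with a third block are additive in disjoint unions, so only those
between R and S get lost. *)
Lemma inversions_merged s s' : merged r s s' ->
  exists R S Q, r R S Q /\ inversions s = (inversions s' + crossings R S)%N.
Proof.
move=> [s1 [R [S [Q [s2 [-> -> rRSQ]]]]]]; exists R, S, Q; split=> //.
have crP P : (crossings P R + crossings P S)%N = crossings P Q.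
  by case: (r_all rRSQ) => [[_ _ dRS ->]|[-> -> ->]]; [rewrite crossingsUr|rewrite !crossings0r].
have crQ P : (crossings R P + crossings S P)%N = crossings Q P.
  by case: (r_all rRSQ) => [[_ _ dRS ->]|[-> -> ->]]; [rewrite crossingsUl|rewrite !crossings0l].
elim: s1 => [|P s1 IHs] /=.
  have : (cross R s2 + cross S s2)%N = cross Q s2.
    by elim: s2 => //= P s2; have := crQ P; lia.
  by lia.
have : cross P (s1 ++ [:: R, S & s2]) = cross P (s1 ++ Q :: s2).
  elim: s1 {IHs} => [|P' s1 /= ->] //=.
  by have := crP P; lia.
by move=> ->; rewrite IHs addnA.
Qed.

End Merged.
End SetAlgebra.
Arguments smu {n} R S.
Arguments smu0 {n} R S.
Arguments smu1 {n} R S.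

(** * Splitting the minimum off a block *)

Section MinSplit.
Variable n : nat.
Notation K := {set 'I_n}.
Implicit Types (R S T : K).

Definition smin R : K := [set x in R | [forall y in R, (x <= y)%N]].
Definition srest R : K := R :\: smin R.

Lemma smin_exists R : R != set0 ->
  exists a, [/\ a \in R, smin R = [set a] & forall y, y \in R -> (a <= y)%N].
Proof.
move=> /set0Pn[x xR].
have [a aR amin] := @arg_minnP _ x (mem R) (fun i : 'I_n => nat_of_ord i) xR.
exists a; split=> //; apply/setP => y; rewrite !inE; apply/andP/eqP => [[yR /forall_inP ymin]|->].
  by apply: val_inj; apply/eqP; rewrite eqn_leq ymin //= amin.
by split=> //; apply/forall_inP => z; exact: amin.
Qed.

Lemma smin_card1 R : #|R| == 1%N -> smin R = R.
Proof.
move=> /cards1P[x ->]; have [|a [aR -> _]] := @smin_exists [set x].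
  by apply/set0Pn; exists x; rewrite inE.
by move: aR; rewrite inE => /eqP ->.
Qed.

Lemma big_card R : (1 < #|R|)%N -> R != set0.
Proof. by rewrite -card_gt0; apply: ltnW. Qed.

Lemma asc_smin_srest R : (1 < #|R|)%N -> asc (smin R) (srest R).
Proof.
move=> R1; have [a [aR sE amin]] := smin_exists (big_card R1).
have rest0 : srest R != set0.
  rewrite /srest sE -card_gt0 cardsDS ?sub1set // cards1; lia.
apply/ascP; split=> // [|x y].
  by rewrite sE; apply/set0Pn; exists a; rewrite inE.
rewrite /srest sE !inE => /eqP -> /andP[ya yR]; rewrite ltn_neqAle amin // andbT.
by apply: contra ya => /eqP/val_inj ->.
Qed.

Lemma smin_srest R : R != set0 -> smin R :|: srest R = R.
Proof.
move=> /smin_exists[a [aR sE _]]; rewrite /srest sE; apply/setP => x; rewrite !inE.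
by case: eqVneq => [->|].
Qed.

(** Makes the splitting of a block into its minimum and the rest compatible with
products from the right. *)
Lemma asc_srest R S : (1 < #|R|)%N -> asc (srest R) S = asc R S.
Proof.
move=> R1; have R0 := big_card R1; have [a [aR sE amin]] := smin_exists R0.
have /ascP[_ r0 ar] := asc_smin_srest R1.
apply/ascP/ascP => -[_ S0 RS]; split=> // x y.
  rewrite -{1}(smin_srest R0) inE => /orP[xm|]; last exact: RS.
  have [z zr] := set0Pn _ r0 => yS; exact: ltn_trans (ar _ _ xm zr) (RS _ _ zr yS).
by rewrite inE => /andP[_ xR]; exact: RS.
Qed.

Lemma asc_smin R S : S != set0 -> ~~ asc R S -> #|R| == 1%N -> ~~ asc R (smin S).
Proof.
move=> S0 RS1 /cards1P[b Rb]; move: RS1; rewrite Rb; apply: contra => /ascP[R0 _ RS]; apply/ascP; split=> // x y xb yS.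
have [a [aS sE amin]] := smin_exists S0.
by apply: leq_trans (amin _ yS); apply: RS; rewrite // sE inE.
Qed.

Lemma smin_setU R S : asc R S -> smin (R :|: S) = smin R.
Proof.
move=> /ascP[R0 S0 RS]; have [a [aR -> amin]] := smin_exists R0.
have [b [bRS -> bmin]] := smin_exists (setU_neq0 S R0).
congr [set _]; apply: val_inj; apply/eqP; rewrite eqn_leq bmin ?inE ?aR //=.
by move: bRS; rewrite inE => /orP[/amin|/(RS _ _ aR)/ltnW].
Qed.

Lemma srest_setU R S : asc R S -> srest (R :|: S) = srest R :|: S.
Proof.
move=> RS; rewrite /srest smin_setU // setDUl; congr (_ :|: _); apply/setDidPl.
rewrite disjoint_sym; apply: disjointWl (asc_disjoint RS).
by apply/subsetP => x; rewrite inE => /andP[].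
Qed.

Lemma smu0E R S : R != set0 -> smu0 R S = if asc R S then fgU (R :|: S) else 0.
Proof. by rewrite /smu0 => /negPf ->. Qed.

Lemma smu00 : smu0 set0 set0 = - fgU set0 :> {freeg K / int}.
Proof. by rewrite /smu0 eqxx. Qed.

End MinSplit.

Section LowContraction.
Variable n : nat.
Notation K := {set 'I_n}.
Notation W := (bword K).
Notation ZW := {freeg W / int}.
Implicit Types (R S T : K) (w : W) (x : ZW).

Definition dup0 w : ZW := - fgU (BCons set0 true w).
Definition split_min w : ZW := fgU (BCons (smin (whead w)) true (set_head w (srest (whead w)))).

(** The contraction for [smu0].  It passes over leading singletons and acts on the
first other block: an empty block is duplicated, a larger one is split into its
minimum and the rest.  It vanishes if a singleton is met that is in ascending
order with the next block, across an inner gap: then the word is itself the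
splitting of a word with a larger block. *)
Fixpoint low_word w : ZW :=
  if whead w == set0 then dup0 w
  else if (1 < #|whead w|)%N then split_min w
  else match w with
  | BOne _ => 0
  | BCons R true w' => if asc R (whead w') then 0 else - bcons R true (low_word w')
  | BCons R false w' => bcons R false (low_word w')
  end.

Definition low : ZW -> ZW := fgext low_word.
HB.instance Definition _ := GRing.Additive.on low.
Arguments low : simpl never.

Lemma lowU w : low (fgU w) = low_word w. Proof. exact: fgextU. Qed.

Lemma low_wordE w : low_word w =
  if whead w == set0 then dup0 w
  else if (1 < #|whead w|)%N then split_min w
  else match w with
  | BOne _ => 0
  | BCons R true w' => if asc R (whead w') then 0 else - bcons R true (low_word w')
  | BCons R false w' => bcons R false (low_word w')
  end.
Proof. by case: w. Qed.

Lemma mdiff_head0 (mu : K -> K -> {freeg K / int}) w :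
  (forall S, mu set0 S \in fspan (fun Q => Q = set0)) ->
  whead w = set0 -> mdiff mu (fgU w) \in fspan (fun w' => whead w' = set0).
Proof.
move=> mu0; case: w => [R|R b w] /= R0; first by rewrite mdiff_one rpred0.
rewrite -bconsU R0.
have bc y : bcons set0 b y \in fspan (fun w' => whead w' = set0).
  by apply: span_bcons (fspan_all y).
case: b bc => bc; rewrite ?mdiff_inner ?mdiff_outer //.
rewrite rpredB // hmulU; apply: fspan_sub (heads_span w (mu0 _)) => _ [Q -> ->].
by case: w.
Qed.

Lemma smu_span0 S : smu set0 S \in fspan (fun Q => Q = set0).
Proof.
by rewrite /smu eqxx; case: ifP => _; rewrite ?rpred0 // rpredN; apply: fspanU.
Qed.

Lemma smu0_span0 S : smu0 set0 S \in fspan (fun Q => Q = set0).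
Proof.
by rewrite /smu0 eqxx; case: ifP => _; rewrite ?rpred0 // rpredN; apply: fspanU.
Qed.

Lemma low_head0 x : x \in fspan (fun w => whead w = set0) -> low x = - bcons set0 true x.
Proof.
apply: (fspan_eq (f := low) (g := \- bcons set0 true)) => w w0 /=.
by rewrite lowU low_wordE w0 eqxx bconsU.
Qed.

Lemma set_head_id w : set_head w (whead w) = w. Proof. by case: w. Qed.

Lemma dup_homotopy (mu : K -> K -> {freeg K / int}) w : mu set0 set0 = - fgU set0 ->
  whead w = set0 ->
  mdiff mu (dup0 w) - bcons set0 true (mdiff mu (fgU w)) = fgU w.
Proof.
move=> mu00 w0; rewrite /dup0 -bconsU raddfN /= mdiff_inner hmulU w0 mu00 raddfN /=.
by rewrite [heads _ _]fgextU -w0 set_head_id opprB opprK addrC addKr.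
Qed.

Lemma low_big_bcons R b x : (1 < #|R|)%N ->
  low (bcons R b x) = bcons (smin R) true (bcons (srest R) b x).
Proof.
move=> R1; apply: (freeg_additive_ext (f := low \o bcons R b)
  (g := bcons (smin R) true \o bcons (srest R) b)) => w /=.
by rewrite bconsU lowU low_wordE /= (negPf (big_card R1)) R1 !bconsU.
Qed.

Lemma low_single_outer R x : #|R| == 1%N -> low (bcons R false x) = bcons R false (low x).
Proof.
move=> /eqP R1; apply: (freeg_additive_ext (f := low \o bcons R false)
  (g := bcons R false \o low)) => w /=.
by rewrite bconsU !lowU low_wordE /= -cards_eq0 R1.
Qed.

Lemma low_single_asc R x : #|R| == 1%N -> x \in fspan (fun w => asc R (whead w)) ->
  low (bcons R true x) = 0.
Proof.
move=> /eqP R1; apply: (fspan_eq (f := low \o bcons R true) (g := \0)) => w Rw /=.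
by rewrite bconsU !lowU low_wordE /= -cards_eq0 R1 /= Rw.
Qed.

Lemma low_single_desc R x : #|R| == 1%N -> x \in fspan (fun w => ~~ asc R (whead w)) ->
  low (bcons R true x) = - bcons R true (low x).
Proof.
move=> /eqP R1; apply: (fspan_eq (f := low \o bcons R true) (g := \- (bcons R true \o low))) => w Rw /=.
by rewrite bconsU !lowU low_wordE /= -cards_eq0 R1 /= (negPf Rw).
Qed.

Lemma mdiff_asc_heads w : mdiff smu0 (fgU w) \in
  fspan (fun w' => whead w' = whead w \/ exists2 T, asc (whead w) T & whead w' = whead w :|: T).
Proof.
case: w => [R|R b w] /=; first by rewrite mdiff_one rpred0.
have bc y : bcons R b y \in fspan (fun w' =>
    whead w' = R \/ exists2 T, asc R T & whead w' = R :|: T).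
  by apply: span_bcons (fspan_all y) => w' _; left.
rewrite -bconsU; case: b bc => bc; rewrite ?mdiff_inner ?mdiff_outer //.
rewrite rpredB // hmulU; apply: fspan_sub (heads_span w (smu0_span _ _)) => _ [Q RQ ->].
case: RQ => [[Rw ->]|[-> w0 ->]]; last by left; case: (w).
by right; exists (whead w); rewrite // /whead; case: (w).
Qed.

Lemma low_heads w : low_word w \in
  fspan (fun w' => whead w' = whead w \/ whead w' = smin (whead w)).
Proof.
rewrite low_wordE; case: eqP => [w0|_]; first by rewrite rpredN; apply: fspanU; left.
case: ifP => [_|_]; first by apply: fspanU; right.
case: w => [R|R [] w]; rewrite ?rpred0 //=.
  by case: ifP => _; rewrite ?rpred0 // rpredN; apply: span_bcons (fspan_all _) => w' _; left.
by apply: span_bcons (fspan_all _) => w' _; left.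
Qed.

(** The critical case is a word that begins with a singleton R in ascending
order with its successor.  There the contraction of w vanishes, and the
product of R and the successor is a larger block with minimum R, whose
splitting gives w back. *)
Lemma low_homotopy w : ~~ singles (letters w) ->
  mdiff smu0 (low (fgU w)) + low (mdiff smu0 (fgU w)) = fgU w.
Proof.
elim: w => [R|R b w IHw] ns.
  rewrite mdiff_one raddf0 addr0 lowU low_wordE /=.
  have [->|R0] := eqVneq R set0.
    (* duplicating undoes the product of two empty blocks *)
    by have := dup_homotopy (w := BOne set0) (smu00 n) erefl; rewrite mdiff_one raddf0 subr0.
  case: ifP => R1; last by move: R0 R1 ns; rewrite /= andbT -card_gt0; case: #|R| => [|[]].
  rewrite /split_min -bconsU mdiff_inner mdiff_one raddf0 subr0 hmulU /=.
  rewrite smu0E; last by case/ascP: (asc_smin_srest R1).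
  by rewrite asc_smin_srest // smin_srest ?big_card // [LHS]fgextU.
have [R0|R0] := eqVneq R set0.
  have w0 : whead (BCons R b w) = set0 by [].
  rewrite [low (mdiff _ _)]low_head0; last by apply: mdiff_head0 => //; exact: smu0_span0.
  by rewrite lowU low_wordE w0 eqxx; apply: dup_homotopy => //; exact: smu00.
have [R1|R1] := boolP (1 < #|R|)%N.
  have [sr0 rr0] : smin R != set0 /\ srest R != set0 by case/ascP: (asc_smin_srest R1).
  rewrite lowU low_wordE /= (negPf R0) R1 /split_min /= -[fgU (BCons (smin R) _ _)]bconsU mdiff_inner hmulU /=.
  rewrite smu0E // asc_smin_srest // smin_srest // [heads _ _]fgextU /=.
  suff -> : low (mdiff smu0 (fgU (BCons R b w))) =
      bcons (smin R) true (mdiff smu0 (fgU (BCons (srest R) b w))) by rewrite subrK.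
  rewrite -!bconsU; case: b {ns}; last by rewrite !mdiff_outer low_big_bcons.
  rewrite !mdiff_inner !raddfB /= low_big_bcons //; congr (_ - _).
  rewrite !hmulU !smu0E // asc_srest //; case: ifP => RS; last by rewrite !raddf0.
  rewrite /heads !fgextU lowU low_wordE bconsU.
  have -> : whead (set_head w (R :|: whead w)) = R :|: whead w by case: (w).
  rewrite (negPf (setU_neq0 _ R0)) (leq_trans R1) ?subset_leq_card ?subsetUl //.
  rewrite /split_min.
  have -> : whead (set_head w (R :|: whead w)) = R :|: whead w by case: (w).
  by rewrite smin_setU // srest_setU //; case: (w).
have {}R1 : #|R| == 1%N by rewrite eqn_leq leqNgt R1 card_gt0.
have nsw : ~~ singles (letters w) by move: ns; rewrite /= R1.
rewrite -bconsU; case: b {ns}; last first.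
  by rewrite mdiff_outer !low_single_outer // mdiff_outer -raddfD /= IHw.
have [Rw|Rw] := boolP (asc R (whead w)).
  rewrite low_single_asc //; last exact: fspanU.
  rewrite raddf0 add0r mdiff_inner raddfB /= hmulU smu0E // Rw.
  rewrite (low_single_asc (x := mdiff _ _)) //; last first.
    apply: fspan_sub (mdiff_asc_heads w) => w' [->|[T wT ->]] //.
    by rewrite ascUr.
  rewrite subr0 [heads _ _]fgextU lowU low_wordE.
  have -> : whead (set_head w (R :|: whead w)) = R :|: whead w by case: (w).
  rewrite (negPf (setU_neq0 _ R0)).
  have -> : (1 < #|R :|: whead w|)%N.
    have := asc_disjoint Rw; rewrite -leq_card_setU => /eqP ->.
    by rewrite (eqP R1); case/ascP: Rw => _; rewrite -card_gt0; lia.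
  rewrite /split_min bconsU.
  have -> : whead (set_head w (R :|: whead w)) = R :|: whead w by case: (w).
  rewrite smin_setU // srest_setU // smin_card1 // /srest smin_card1 // setDv set0U.
  by case: (w).
rewrite low_single_desc //; last exact: fspanU.
rewrite mdiff_inner hmulU smu0E // (negPf Rw) raddf0 sub0r !raddfN /=.
rewrite (low_single_desc (x := mdiff _ _)) //; last first.
  apply: fspan_sub (mdiff_asc_heads w) => w' [->|[T wT ->]] //.
  by rewrite ascUr.
rewrite opprK mdiff_inner -[in RHS]IHw // raddfD /=.
(* the contraction keeps the first block or its minimum, so R stays non-ascending *)
suff -> : hmul smu0 R (low (fgU w)) = 0 by rewrite oppr0 add0r opprK raddfD.
have : low (fgU w) \in fspan (fun w' => ~~ asc R (whead w')).
  rewrite lowU; have [w0|w0] := eqVneq (whead w) set0.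
    rewrite low_wordE w0 eqxx rpredN; apply: fspanU.
    by apply/negP => /ascP[_]; rewrite eqxx.
  by apply: fspan_sub (low_heads w) => w' [->|->] //; exact: asc_smin.
apply: (fspan_eq (f := hmul smu0 R) (g := \0)) => w' Rw'.
by rewrite /= hmulU smu0E // (negPf Rw') raddf0.
Qed.

(** Splitting is the reverse of merging in ascending order, so it changes neither
the number of inversions nor the union of the blocks. *)
Lemma low_span w : low (fgU w) \in fspan (fun w' =>
  [/\ din w' = (din w).+1, dout w' = dout w & merged (@rasc n) (letters w') (letters w)]).
Proof.
elim: w => [R|R b w IHw]; rewrite lowU low_wordE /=.
  have [->|R0] := eqVneq R set0.
    rewrite rpredN; apply: fspanU; split=> //=.
    by exists [::], set0, set0, set0, [::]; split=> //; right.
  case: ifP => R1; last exact: rpred0.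
  apply: fspanU; split=> //=; exists [::], (smin R), (srest R), R, [::]; split=> //; left.
  by rewrite asc_smin_srest // smin_srest.
have [->|R0] := eqVneq R set0.
  rewrite rpredN; apply: fspanU; split=> //=.
  by exists [::], set0, set0, set0, (letters w); split=> //; right.
case: ifP => R1.
  apply: fspanU; split=> //=; exists [::], (smin R), (srest R), R, (letters w); split=> //; left.
  by rewrite asc_smin_srest // smin_srest.
have IHb b' : bcons R b' (low_word w) \in fspan (fun w' =>
  [/\ din w' = (din (BCons R b' w)).+1, dout w' = dout (BCons R b' w)
    & merged (@rasc n) (letters w') (letters (BCons R b' w))]).
  rewrite -lowU; apply: span_bcons IHw => w' [dw ow [s1 [S [T [Q [s2 [e1 e2 rSTQ]]]]]]].
  rewrite /= dw ow addnS; split=> //; exists (R :: s1), S, T, Q, s2.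
  by rewrite e1 e2.
by case: b; [case: ifP => _; rewrite ?rpred0 // rpredN|]; exact: IHb.
Qed.

End LowContraction.

(** * Contractibility in low degrees *)

Lemma hmulB (K : choiceType) (mu nu : K -> K -> {freeg K / int}) k x :
  hmul (fun a b => mu a b - nu a b) k x = hmul mu k x - hmul nu k x.
Proof.
apply: (freeg_additive_ext (f := hmul (fun a b => mu a b - nu a b) k)
  (g := hmul mu k \- hmul nu k)) => w /=.
by rewrite !hmulU raddfB.
Qed.

Lemma mdiffB (K : choiceType) (mu nu : K -> K -> {freeg K / int}) x :
  mdiff (fun a b => mu a b - nu a b) x = mdiff mu x - mdiff nu x.
Proof.
move: x; apply: (ZW_ind_ext (f := mdiff (fun a b => mu a b - nu a b))
  (g := mdiff mu \- mdiff nu)) => [k|k b x IHx] /=.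
  by rewrite !mdiff_one subr0.
case: b; rewrite ?mdiff_inner ?mdiff_outer IHx /= raddfB //= hmulB.
by rewrite [X in _ + X = _]opprD opprK [X in _ = _ + X]opprD opprK addrACA.
Qed.

Section SetComplex.
Variable n : nat.
Notation K := {set 'I_n}.
Notation W := (bword K).
Notation ZW := {freeg W / int}.
Notation D := (bdiff (@smu n)).
Implicit Types (w : W) (x : ZW).

(** The words dual to natural transformations into T^n ab: each of the n tensor
factors lies in exactly one block. *)
Definition qcell m j : pred W := fun w => res_word m j w && part setT (letters w).

(** The two properties of a list of blocks that all operators preserve. *)
Definition same_blocks w w' : Prop :=
  (forall X, part X (letters w') = part X (letters w)) /\
  nonempties (letters w') = nonempties (letters w).

Lemma merged_same_blocks r w w' : (forall R S Q : K, r R S Q -> rall R S Q) ->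
  merged r (letters w) (letters w') -> same_blocks w w'.
Proof.
move=> ra ww'; split=> [X|]; first by rewrite (part_merged ra X ww').
by rewrite (nonempties_merged ra ww').
Qed.

Lemma mdiff_set_span w : mdiff smu (fgU w) \in fspan (fun w' =>
  [/\ (din w').+1 = din w, dout w' = dout w, same_blocks w w' & (wlen w = (wlen w').+1)]).
Proof.
apply: fspan_sub (mdiff_span w (@smu_span n)) => w' [dw ow ww']; split=> //.
  exact: merged_same_blocks ww'.
by rewrite -!size_letters (merged_size ww').
Qed.

Lemma conv_set_span w : conv (fgU w) \in fspan (fun w' =>
  [/\ (din w').+1 = din w, dout w' = (dout w).+1, same_blocks w w' & letters w' = letters w]).
Proof.
by apply: fspan_sub (conv_span w) => w' [dw ow ww']; split; rewrite // /same_blocks ww'.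
Qed.

Lemma D_set_span w : D (fgU w) \in fspan (fun w' =>
  [/\ (din w').+1 = din w, (dout w <= dout w')%N & same_blocks w w']).
Proof.
apply: rpredD.
  by apply: fspan_sub (mdiff_set_span w) => w' [dw ow ww' _]; split; rewrite ?ow.
by apply: fspan_sub (conv_set_span w) => w' [dw ow ww' _]; split; rewrite ?ow.
Qed.

Lemma adm_D m j : adm D (qcell m j.+1) (qcell m j).
Proof.
move=> w wP; apply: restr_span0 (D_set_span w) => w' [dw ow [pw _]].
apply: contra wP => /andP[/andP[/eqP d' o'] p']; rewrite /qcell /res_word -dw d' eqxx -pw p' andbT.
exact: leq_ltn_trans ow o'.
Qed.

(** The differential of the complex dual to the cochains; that discarding words
is harmless ([adm_D]) reflects that the number of outer gaps never decreases. *)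
Definition Qd m j : {additive piece (qcell m j.+1) -> piece (qcell m j)} :=
  compress D (qcell m j.+1) (qcell m j).

Lemma Qd_Qd m j (x : piece (qcell m j.+2)) : Qd m j (Qd m j.+1 x) = 0.
Proof.
rewrite -[x]inclK [Qd m j.+1 _](adm_compress _ (@adm_D m j.+1)) [LHS](adm_compress _ (@adm_D m j)).
by rewrite /= bdiff_bdiff ?raddf0 //; exact: smuA.
Qed.

Lemma fspan_additive (p q : W -> Prop) (f : {additive ZW -> ZW}) x :
  (forall w, p w -> f (fgU w) \in fspan q) -> x \in fspan p -> f x \in fspan q.
Proof. by move=> fpq xp; rewrite -(fgext_id x) fgext_comp; exact: fspan_fgext xp. Qed.

(** The non-leading part of the differential, for the weight that counts
inversions and the outer gaps still available. *)
Definition nilpart x : ZW := mdiff smu1 x + conv x.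
Lemma nilpart_is_additive : zmod_morphism nilpart.
Proof. by move=> x y; rewrite /nilpart !raddfB opprD addrACA. Qed.
HB.instance Definition _ := GRing.isZmodMorphism.Build ZW ZW nilpart nilpart_is_additive.

Lemma D_nilpart x : D x = mdiff smu0 x + nilpart x.
Proof. by rewrite /bdiff /nilpart mdiffB addrA [mdiff smu0 x + _]addrC subrK. Qed.

Definition low_weight m w : nat := (inversions (letters w) + (m - dout w))%N.

Lemma nilpart_span m w : (dout w < m)%N ->
  nilpart (fgU w) \in fspan (fun w' => (low_weight m w' < low_weight m w)%N).
Proof.
move=> om; apply: rpredD.
  apply: fspan_sub (mdiff_span w (@smu1_span n)) => w' [_ ow ww'].
  have [R [S [Q [[R0 S0 dRS RS _] e]]]] := inversions_merged (@rdesc_all n) ww'.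
  by rewrite /low_weight ow e addnAC -[X in (X < _)%N]addn0 ltn_add2l crossings_desc.
apply: fspan_sub (conv_span w) => w' [_ ow e].
by rewrite /low_weight e ow ltn_add2l; apply: ltn_sub2l.
Qed.

Lemma low_span_weight m w : low (fgU w) \in fspan (fun w' =>
  [/\ din w' = (din w).+1, dout w' = dout w, same_blocks w w' & low_weight m w' = low_weight m w]).
Proof.
apply: fspan_sub (low_span w) => w' [dw ow ww']; split=> //.
  by have [pw nw] := merged_same_blocks (@rasc_all n) ww'; split=> [X|]; rewrite ?pw ?nw.
have [R [S [Q [RSQ e]]]] := inversions_merged (@rasc_all n) ww'.
rewrite /low_weight ow e; case: RSQ => [[RS _]|[-> -> _]].
  by rewrite crossings_asc // addn0.
by rewrite crossings0l addn0.
Qed.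

Lemma adm_low m j : adm (@low n) (qcell m j) (qcell m j.+1).
Proof.
move=> w wP; apply: restr_span0 (low_span_weight m w) => w' [dw ow [pw _] _].
by apply: contra wP; rewrite /qcell /res_word dw ow eqSS pw.
Qed.

Lemma low_error m w : (dout w < m)%N -> ~~ singles (letters w) ->
  D (low (fgU w)) + low (D (fgU w)) - fgU w \in fspan (fun w' => (low_weight m w' < low_weight m w)%N).
Proof.
move=> om ns; rewrite !D_nilpart raddfD /= addrACA low_homotopy // addrAC subrr add0r.
apply: rpredD.
  apply: (fspan_additive (f := nilpart)) (low_span_weight m w) => w' [_ ow _ <-].
  by apply: nilpart_span; rewrite ow.
apply: (fspan_additive (f := @low n)) (nilpart_span om) => w' w'w.
by apply: fspan_sub (low_span_weight m w') => w'' [_ _ _ ->].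
Qed.

(** A word of singletons would have n letters, but there are only
j + dout + 1 <= j + m. *)
Lemma qcell_not_singles m j w : (j + m < n)%N -> qcell m j w -> ~~ singles (letters w).
Proof.
move=> jmn /andP[/andP[/eqP dw ow] pw]; apply/negP => sw.
have := singles_total_card sw; rewrite (part_total_card pw) cardsT card_ord size_letters wlenE dw; lia.
Qed.

Lemma low_weight_bound m j w : qcell m j w -> (low_weight m w < n * n + m.+1)%N.
Proof.
move=> /andP[_ pw]; have := inversions_le (letters w).
rewrite (part_total_card pw) cardsT card_ord /low_weight; lia.
Qed.

Lemma Qd_contractible_low m j : (j.+1 + m < n)%N -> contractible (Qd m j.+1) (Qd m j).
Proof.
move=> jmn; apply: (piece_contractible_mid (S := @low n) (t := low_weight m) (B := (n * n + m.+1)%N)).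
- exact: adm_D.
- exact: adm_low.
- exact: low_weight_bound.
move=> w wq; apply: low_error; last exact: qcell_not_singles wq.
by case/andP: wq => /andP[].
Qed.

Lemma D_din0 w : din w = 0%N -> D (fgU w) = 0.
Proof. by move=> dw; apply: fspan_false (D_set_span w) => w' []; rewrite dw. Qed.

(** At the end of the complex, where the differential out of degree 0 is
zero. *)
Lemma Qd_contractible_low0 m (C : zmodType) : (m < n)%N ->
  contractible (Qd m 0) (\0 : piece (qcell m 0) -> C).
Proof.
move=> mn; apply: (piece_contractible (S := @low n) (h0 := \0) (t := low_weight m) (B := (n * n + m.+1)%N)).
- exact: adm_D.
- by move=> u; apply: low_weight_bound; exact: (valP u).
move=> u; have uq := valP u; rewrite /= addr0 -restrU -raddfB.
apply: (restr_span (r := fun v => (low_weight m v < low_weight m (val u))%N)).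
have /andP[/andP[/eqP du ou] _] := uq.
have := @low_error m (val u) ou (qcell_not_singles (mn : (0 + m < n)%N) uq).
by rewrite D_din0 // raddf0 addr0.
Qed.

End SetComplex.

(** * Contractibility in high degrees *)

Section HighDegrees.
Variable n : nat.
Notation K := {set 'I_n}.
Notation W := (bword K).
Notation ZW := {freeg W / int}.
Notation D := (bdiff (@smu n)).
Notation ne w := (nonempties (letters w)).
Implicit Types (w : W) (x : ZW).

(** Duplicates the first empty block, with the sign of the gaps before it.  By
the rule for the product of two empty blocks this contracts the words that
contain an empty block. *)
Fixpoint dup_word w : ZW :=
  if whead w == set0 then dup0 w
  else match w with
  | BOne _ => 0
  | BCons R true w' => - bcons R true (dup_word w')
  | BCons R false w' => bcons R false (dup_word w')
  end.

Definition dup : ZW -> ZW := fgext dup_word.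
HB.instance Definition _ := GRing.Additive.on dup.
Arguments dup : simpl never.

Lemma dup_wordE w : dup_word w =
  if whead w == set0 then dup0 w
  else match w with
  | BOne _ => 0
  | BCons R true w' => - bcons R true (dup_word w')
  | BCons R false w' => bcons R false (dup_word w')
  end.
Proof. by case: w. Qed.

Lemma dupU w : dup (fgU w) = dup_word w. Proof. exact: fgextU. Qed.

Lemma dup_head0 x : x \in fspan (fun w => whead w = set0) -> dup x = - bcons set0 true x.
Proof.
apply: (fspan_eq (f := dup) (g := \- bcons set0 true)) => w w0 /=.
by rewrite dupU dup_wordE w0 eqxx bconsU.
Qed.

Lemma dup_outer R x : R != set0 -> dup (bcons R false x) = bcons R false (dup x).
Proof.
move=> R0; apply: (freeg_additive_ext (f := dup \o bcons R false) (g := bcons R false \o dup)) => w /=.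
by rewrite bconsU !dupU dup_wordE /= (negPf R0).
Qed.

Lemma dup_inner R x : R != set0 -> dup (bcons R true x) = - bcons R true (dup x).
Proof.
move=> R0; apply: (freeg_additive_ext (f := dup \o bcons R true) (g := \- (bcons R true \o dup))) => w /=.
by rewrite bconsU !dupU dup_wordE /= (negPf R0).
Qed.

(** Multiplication by a nonempty block kills words with empty head, and otherwise
does not affect which block is the first empty one. *)
Lemma dup_hmul R x : R != set0 -> dup (hmul smu R x) = hmul smu R (dup x).
Proof.
move=> R0; apply: (freeg_additive_ext (f := dup \o hmul smu R) (g := hmul smu R \o dup)) => w /=.
rewrite hmulU dupU dup_wordE {1}/smu (negPf R0).
have [w0|w0] := eqVneq (whead w) set0.
  rewrite !raddf0 /dup0 -bconsU raddfN /= hmul_bcons {1}/smu (negPf R0) eqxx.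
  by rewrite /blin bil0l oppr0.
case: ifP => /= [dRw|dRw].
  rewrite [heads _ _]fgextU dupU dup_wordE.
  have -> : whead (set_head w (R :|: whead w)) = R :|: whead w by case: (w).
  rewrite (negPf (setU_neq0 _ R0)).
  case: w w0 dRw => [S|S b w] /= S0 dRS; first by rewrite raddf0.
  by case: b; rewrite ?raddfN /= hmul_bcons {1}/smu (negPf R0) S0 dRS /= /blin bilU.
case: w w0 dRw => [S|S b w] /= S0 dRS; rewrite ?raddf0 //.
case: b; rewrite ?raddfN /= hmul_bcons {1}/smu (negPf R0) S0 dRS /= /blin bil0l ?oppr0 //.
Qed.

Lemma dup_ne w : ne w -> dup (fgU w) = 0.
Proof.
elim: w => [R|R b w IHw] /=; first by rewrite andbT dupU dup_wordE /= => /negPf ->.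
move=> /andP[R0 /IHw]; rewrite -bconsU; case: b; rewrite ?dup_inner ?dup_outer // => ->.
  by rewrite raddf0 oppr0.
by rewrite raddf0.
Qed.

Lemma dup_homotopy_word w : ~~ ne w ->
  mdiff smu (dup (fgU w)) + dup (mdiff smu (fgU w)) = fgU w.
Proof.
have smu00 : smu set0 set0 = - fgU set0 :> {freeg K / int} by rewrite /smu eqxx.
elim: w => [R|R b w IHw] ns.
  rewrite mdiff_one raddf0 addr0 dupU dup_wordE /=.
  have R0 : R = set0 by apply/eqP; move: ns; rewrite /= andbT negbK.
  rewrite R0 eqxx; have := dup_homotopy (w := BOne set0) smu00 erefl.
  by rewrite mdiff_one raddf0 subr0.
have [R0|R0] := eqVneq R set0.
  have w0 : whead (BCons R b w) = set0 by [].
  rewrite [dup (mdiff _ _)]dup_head0; last by apply: mdiff_head0 => //; exact: smu_span0.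
  by rewrite dupU dup_wordE w0 eqxx; apply: dup_homotopy.
have nsw : ~~ ne w by move: ns; rewrite /= R0.
rewrite -bconsU; case: b {ns}.
  rewrite mdiff_inner raddfB /= !dup_inner // raddfN /= mdiff_inner dup_hmul // opprB opprK.
  by rewrite addrA subrK -raddfD /= IHw.
by rewrite mdiff_outer !dup_outer // mdiff_outer -raddfD /= IHw.
Qed.

Lemma dup_span w : dup (fgU w) \in fspan (fun w' =>
  [/\ din w' = (din w).+1, dout w' = dout w & same_blocks w w']).
Proof.
have sim00 w1 : whead w1 = set0 -> same_blocks w1 (BCons set0 true w1).
  move=> w10; split=> [X|] /=.
    by rewrite sub0set setD0.
  by rewrite [letters w1]letters_head w10 /= eqxx.
elim: w => [R|R b w IHw]; rewrite dupU dup_wordE /=.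
  by case: eqP => [R0|_]; rewrite ?rpred0 // rpredN; apply: fspanU; split=> //; apply: sim00.
case: eqP => [R0|_].
  by rewrite rpredN; apply: fspanU; split=> //; apply: sim00.
have IHb b' : bcons R b' (dup_word w) \in fspan (fun w' =>
  [/\ din w' = (din (BCons R b' w)).+1, dout w' = dout (BCons R b' w)
    & same_blocks (BCons R b' w) w']).
  rewrite -dupU; apply: span_bcons IHw => w' [dw ow [pw nw]] /=.
  by rewrite dw ow addnS; split=> //; split=> [X|] /=; rewrite ?pw ?nw.
by case: b; rewrite ?rpredN; exact: IHb.
Qed.

(** The words with an empty block are left to [dup_word]. *)
Definition toggle_word w : ZW :=
  match w with
  | BCons R false w' => if ne w then fgU (BCons R true w') else 0
  | _ => 0
  end.
Definition toggle : ZW -> ZW := fgext toggle_word.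
HB.instance Definition _ := GRing.Additive.on toggle.
Arguments toggle : simpl never.

Lemma toggleU w : toggle (fgU w) = toggle_word w. Proof. exact: fgextU. Qed.

Lemma toggle_span w : toggle (fgU w) \in fspan (fun w' =>
  [/\ din w' = (din w).+1, ne w, letters w' = letters w & wlen w' = wlen w]).
Proof.
rewrite toggleU; case: w => [R|R [] w]; rewrite ?rpred0 //=.
by case: ifP => // [new|_]; rewrite ?rpred0 //; apply: fspanU.
Qed.

Lemma toggle_outer R x : R != set0 -> x \in fspan (fun w => ne w) ->
  toggle (bcons R false x) = bcons R true x.
Proof.
move=> R0; apply: (fspan_eq (f := toggle \o bcons R false) (g := bcons R true)) => w w0 /=.
by rewrite !bconsU toggleU /= R0 w0.
Qed.

Lemma toggle_inner R x : toggle (bcons R true x) = 0.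
Proof.
apply: (freeg_additive_ext (f := toggle \o bcons R true) (g := \0)) => w /=.
by rewrite bconsU toggleU.
Qed.

Lemma D_ne_span w : ne w -> D (fgU w) \in fspan (fun w' => ne w').
Proof. by move=> new; apply: fspan_sub (D_set_span w) => w' [_ _ [_ ->]]. Qed.

(** Converting the first gap back restores w.  The other terms involving the first
gap multiply the first two blocks and thus shorten the word, and the terms
not involving it cancel between the two summands. *)
Lemma toggle_error w : ne w -> (1 < wlen w)%N ->
  D (toggle (fgU w)) + toggle (D (fgU w)) - fgU w
    \in fspan (fun w' => ne w' /\ (wlen w' < wlen w)%N).
Proof.
case: w => [//|R b w] /= /andP[R0 nw] _.
have hs : hmul smu R (fgU w) \in fspan (fun w' => ne w' /\ wlen w' = wlen w).
  rewrite hmulU; apply: fspan_sub (heads_span w (smu_span _ _)) => _ [Q RQ ->].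
  rewrite wlen_set_head; split=> //; rewrite letters_set_head /=.
  move: nw; rewrite [letters w]letters_head /= => /andP[w0 ->]; rewrite andbT.
  by case: RQ => [[_ _ _ ->]|[R00]]; [exact: setU_neq0|rewrite R00 eqxx in R0].
rewrite -bconsU; case: b.
  rewrite toggle_inner raddf0 add0r bdiff_inner raddfB raddfD /= toggle_inner subr0.
  rewrite toggle_outer //; last exact: fspanU.
  rewrite addrK; apply: (fspan_additive (f := toggle)) hs => w' [nw' <-].
  by apply: fspan_sub (toggle_span w') => w'' [_ _ e1 e2]; rewrite e1 e2.
rewrite toggle_outer //; last exact: fspanU.
rewrite bdiff_outer (toggle_outer R0 (D_ne_span nw)) bdiff_inner subrK addrK.
by apply: fspan_sub hs => w' [nw' ->].
Qed.

Lemma toggle_not_ne w : ~~ ne w -> toggle (fgU w) = 0 /\ toggle (D (fgU w)) = 0.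
Proof.
move=> nw; have t0 w' : ~~ ne w' -> toggle (fgU w') = 0.
  by rewrite toggleU; case: w' => [R|R [] w'] //= /negPf ->.
split; first exact: t0.
apply: (fspan_eq (f := toggle) (g := \0) (p := fun w' => ~~ ne w')) => //.
by apply: fspan_sub (D_set_span w) => w' [_ _ [_ ->]].
Qed.

Definition high x : ZW := dup x + toggle x.
Lemma high_is_additive : zmod_morphism high.
Proof. by move=> x y; rewrite /high !raddfB opprD addrACA. Qed.
HB.instance Definition _ := GRing.isZmodMorphism.Build ZW ZW high high_is_additive.

(** On words with empty blocks the error raises the number of outer gaps, on the
others it shortens the word.  Since neither kind produces the other, the two
weights need not be compared. *)
Definition high_weight m w : nat := if ne w then wlen w else (m - dout w)%N.

Lemma high_error m w : (dout w < m)%N -> (ne w -> (1 < wlen w)%N) ->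
  D (high (fgU w)) + high (D (fgU w)) - fgU w
    \in fspan (fun w' => (high_weight m w' < high_weight m w)%N).
Proof.
move=> om w1; rewrite /high; have [nw|nw] := boolP (ne w).
  rewrite dup_ne // add0r.
  have -> : dup (D (fgU w)) = 0.
    by apply: (fspan_eq (f := dup) (g := \0)) (D_ne_span nw) => w' /dup_ne.
  rewrite add0r; apply: fspan_sub (toggle_error nw (w1 nw)) => w' [nw' lw].
  by rewrite /high_weight nw nw'.
have [-> ->] := toggle_not_ne nw; rewrite !addr0.
rewrite /bdiff raddfD /= addrACA dup_homotopy_word // addrAC subrr add0r.
apply: rpredD.
  apply: (fspan_additive (f := @conv _)) (dup_span w) => w' [_ ow [_ nww']].
  apply: fspan_sub (conv_set_span w') => w'' [_ ow' [_ nw''] _].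
  by rewrite /high_weight nw'' nww' (negPf nw) ow' ow; apply: ltn_sub2l.
apply: (fspan_additive (f := dup)) (conv_set_span w) => w' [_ ow [_ nww'] _].
apply: fspan_sub (dup_span w') => w'' [_ ow' [_ nw'']].
by rewrite /high_weight nw'' nww' (negPf nw) ow' ow; apply: ltn_sub2l.
Qed.

Lemma qcell_ne_wlen w : ne w -> part setT (letters w) -> (wlen w <= n)%N.
Proof.
move=> nw /part_total_card; rewrite cardsT card_ord => tn.
by have := nonempties_size nw; rewrite size_letters tn.
Qed.

(** [toggle] can lead from a word with too many outer gaps to an admissible
one.  Such a word has no empty block and at least j + m + 1 > n letters, which
is impossible. *)
Lemma adm_high m j : (n <= m + j)%N -> adm high (qcell m j) (qcell m j.+1).
Proof.
move=> nmj w wP; rewrite /= /high raddfD /=.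
have -> : restr (qcell m j.+1) (dup (fgU w)) = 0.
  apply: restr_span0 (dup_span w) => w' [dw ow [pw _]].
  by apply: contra wP; rewrite /qcell /res_word dw ow eqSS pw.
rewrite add0r; apply: restr_span0 (toggle_span w) => w' [dw nw ew lw].
apply: contra wP => /andP[/andP[/eqP dw' _]]; rewrite ew => pw.
have dj : din w = j by move: dw'; rewrite dw => -[].
rewrite /qcell /res_word dj eqxx pw andbT /=.
by have := qcell_ne_wlen nw pw; rewrite wlenE dj; lia.
Qed.

Lemma high_weight_bound m j w : qcell m j w -> (high_weight m w < n + m.+1)%N.
Proof.
move=> /andP[_ pw]; rewrite /high_weight; case: ifP => [nw|_]; last lia.
by have := qcell_ne_wlen nw pw; lia.
Qed.

Lemma Qd_contractible_high m j : (n <= m + j)%N -> contractible (Qd n m j.+1) (Qd n m j).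
Proof.
move=> nmj; apply: (piece_contractible_mid (S := high) (t := high_weight m) (B := (n + m.+1)%N)).
- exact: adm_D.
- exact: adm_high.
- exact: high_weight_bound.
move=> w /andP[/andP[/eqP dw ow] _]; apply: high_error => // _.
by rewrite wlenE dw.
Qed.

(** The augmentation of the dual complex if m >= n: it takes the value
(-1)^(l-1) on the words with l nonempty blocks and outer gaps only. *)
Fixpoint sgn_word w : int :=
  match w with
  | BOne R => (R != set0)%:Z
  | BCons R true _ => 0
  | BCons R false w' => - ((R != set0)%:Z * sgn_word w')
  end.

Definition sgn_cochain : ZW -> int := fgext sgn_word.
HB.instance Definition _ := GRing.Additive.on sgn_cochain.
Arguments sgn_cochain : simpl never.

Lemma sgnU w : sgn_cochain (fgU w) = sgn_word w. Proof. exact: fgextU. Qed.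

Lemma sgn_word_not_ne w : ~~ ne w -> sgn_word w = 0.
Proof.
elim: w => [R|R [] w IHw] //=; first by rewrite andbT negbK => /eqP ->; rewrite eqxx.
by rewrite negb_and negbK => /orP[/eqP ->|/IHw ->]; rewrite ?eqxx ?mulr0 ?mul0r ?oppr0.
Qed.

(** An inner gap between nonempty blocks contributes the union and the outer gap,
with opposite signs. *)
Lemma sgn_D X w : part X (letters w) -> sgn_cochain (D (fgU w)) = 0.
Proof.
elim: w X => [R|R b w IHw] X /=; first by rewrite bdiff_one raddf0.
move=> /andP[RX pw]; rewrite -bconsU; case: b; last first.
  have E x : sgn_cochain (bcons R false x) = - ((R != set0)%:Z * sgn_cochain x).
    apply: (freeg_additive_ext (f := sgn_cochain \o bcons R false)
      (g := \- (GRing.mull_fun (R != set0)%:Z sgn_cochain))) => v /=.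
    by rewrite bconsU !sgnU.
  by rewrite bdiff_outer E (IHw _ pw) mulr0 oppr0.
(* words with an inner gap do not contribute *)
have Et x : sgn_cochain (bcons R true x) = 0.
  apply: (freeg_additive_ext (f := sgn_cochain \o bcons R true) (g := \0)) => v /=.
  by rewrite bconsU !sgnU.
rewrite bdiff_inner raddfB raddfD /= Et subr0 bconsU [sgn_cochain (fgU (BCons _ _ _))]sgnU /=.
rewrite hmulU; apply/eqP; rewrite subr_eq0; apply/eqP.
have pw' : part (X :\: R) (letters w) by [].
have dRw : [disjoint R & whead w].
  move: pw'; rewrite [letters w]letters_head /= subsetD => /andP[/andP[_ dw] _].
  by rewrite disjoint_sym.
rewrite /smu; have [R0|R0] := eqVneq R set0.
  rewrite mul0r; case: eqP => [w0|_]; last by rewrite !raddf0.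
  rewrite raddfN raddfN /= [heads _ _]fgextU sgnU sgn_word_not_ne ?oppr0 //.
  by rewrite letters_set_head /= eqxx.
rewrite mul1r dRw andbT; have [w0|w0] := eqVneq (whead w) set0.
  rewrite !raddf0 sgn_word_not_ne //.
  by rewrite [letters w]letters_head w0 /= eqxx.
rewrite [heads _ _]fgextU sgnU; case: w {IHw pw pw' dRw} w0 => [S|S [] w] /= S0.
- by rewrite setU_neq0 // S0.
- by [].
by rewrite setU_neq0 // S0.
Qed.

Definition sgn0 m : {additive piece (@qcell n m 0) -> int} := sgn_cochain \o incl (qcell m 0).

Hypothesis n_gt0 : (0 < n)%N.

(** The words that [Qd] discards have m >= n outer gaps, so one of their blocks
is empty and [sgn_word] vanishes on them. *)
Lemma sgn0_Qd m (x : piece (@qcell n m 1)) : (n <= m)%N -> sgn0 m (Qd n m 0 x) = 0.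
Proof.
move=> nm; apply: (freeg_additive_ext (f := sgn0 m \o Qd n m 0) (g := \0)) => -[w wq] /=.
rewrite [Qd n m 0 _]compressE inclU /=.
have /andP[_ pw] := wq; rewrite -[RHS](sgn_D pw).
apply: (fspan_eq (f := sgn_cochain \o incl (qcell m 0) \o restr (qcell m 0))
   (g := sgn_cochain)) (D_set_span w) => w' [dw ow [pw' nw]] /=.
have [w'q|w'q] := boolP (qcell m 0 w'); first by rewrite incl_restr //; exact: fspanU.
rewrite restr_out // !raddf0 sgnU; apply/esym; have [d0|d0] := posnP (din w').
  apply: sgn_word_not_ne; apply: contra w'q => nw'.
  rewrite /qcell /res_word d0 eqxx pw' pw andbT /=.
  by have := qcell_ne_wlen nw' (etrans (pw' _) pw); rewrite wlenE; lia.
by elim: w' d0 {dw ow pw' nw w'q} => [//|R [] w' IHw] //= /IHw ->; rewrite mulr0 oppr0.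
Qed.

Definition top_block m : piece (@qcell n m 0) := restr (qcell m 0) (fgU (BOne setT)).

Lemma setT_neq0 : [set: 'I_n] != set0.
Proof. by rewrite -card_gt0 cardsT card_ord. Qed.

Lemma sgn0_top m : (n <= m)%N -> sgn0 m (top_block m) = 1.
Proof.
move=> nm; rewrite /sgn0 /top_block /= incl_restr; first by rewrite sgnU /= setT_neq0.
by apply: fspanU; rewrite /qcell /res_word /= subxx setDv eqxx (leq_trans n_gt0).
Qed.

(** As in positive degrees; the exceptional word is the one with a single
block, where no gap can be toggled and the summand from the augmentation
is used instead. *)
Lemma Qd_contractible_zero m : (n <= m)%N -> contractible (Qd n m 0) (sgn0 m).
Proof.
move=> nm.
pose h0 (z : int) : piece (@qcell n m 0) := top_block m *~ z.
have h0a : zmod_morphism h0 by move=> y z; rewrite /h0 mulrzBr.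
pose h0' : {additive int -> piece (@qcell n m 0)} :=
  HB.pack h0 (GRing.isZmodMorphism.Build int (piece (@qcell n m 0)) h0 h0a).
apply: (piece_contractible (S := high) (h0 := h0') (t := high_weight m) (B := (n + m.+1)%N)).
- exact: adm_D.
- by move=> u; apply: high_weight_bound; exact: (valP u).
move=> [w wq]; have /andP[/andP[/eqP dw ow] pw] := wq.
rewrite /= /h0 /sgn0 /= inclU sgnU /=.
have [/andP[nw w1]|] := boolP (ne w && (wlen w == 1%N)).
  (* the word with a single block, which is all of the n points *)
  have {w1} [R wR] : exists R, w = BOne R.
    by move: w1; case: (w) => [R _|R b w'] /=; [exists R|rewrite wlenE].
  subst w; move: nw pw; rewrite /= andbT => R0 /andP[_].
  rewrite setD_eq0 => TR; have RT : R = setT by apply/eqP; rewrite eqEsubset subsetT.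
  rewrite RT in R0 wq *; rewrite R0 mulr1z /high dup_ne /= ?R0 // add0r toggleU /=.
  rewrite !raddf0 add0r /top_block -[X in _ - X]restrU /= subrr; exact: rpred0.
move=> nw1; rewrite addrAC -[X in _ - X]restrU -raddfB /=.
apply: rpredD.
  apply: (restr_span (r := fun v => (high_weight m v < high_weight m w)%N)).
  have := @high_error m w ow; rewrite D_din0 // raddf0 addr0; apply.
  by move=> nw; move: nw1; rewrite nw /= wlenE eqSS ltnS lt0n.
have [nw|nw] := boolP (ne w); last by rewrite sgn_word_not_ne // mulr0z rpred0.
apply: rpredMz; rewrite /top_block.
apply: (restr_span (r := fun v => (high_weight m v < high_weight m w)%N)).
apply: fspanU; rewrite /high_weight /= setT_neq0 nw /=.
by move: nw1; rewrite nw /= wlenE eqSS ltnS lt0n.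
Qed.

End HighDegrees.

(** * Tensor powers of the abelianization *)

Section TensorTheory.
Variables (n : nat) (A : zmodType).

Definition pure (u : {ffun 'I_n -> A}) : tensor n A :=
  \pi_(Quotient.quot (zspan (@multilin_rel n A))) (fgU u).

Definition upd (u : {ffun 'I_n -> A}) i a : {ffun 'I_n -> A} :=
  [ffun j => if j == i then a else u j].

Lemma pure_updB (u : {ffun 'I_n -> A}) i a b :
  pure (upd u i (a - b)) = pure (upd u i a) - pure (upd u i b).
Proof.
have : pure (upd u i a) - pure (upd u i (a - b)) - pure (upd u i b) = 0.
  rewrite /pure -!raddfB; apply/eqP; rewrite quot_pi_eq0; apply: mem_zspan.
  exists i, (upd u i (a - b)), (upd u i b), (upd u i a); split=> // [|j ji].
    by rewrite !ffunE eqxx subrK.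
  by rewrite !ffunE (negPf ji).
by move/eqP; rewrite -addrA -opprD subr_eq0 => /eqP ->; rewrite addrK.
Qed.

Lemma pure_ext (B : zmodType) (f g : {additive tensor n A -> B}) :
  (forall u, f (pure u) = g (pure u)) -> f =1 g.
Proof.
move=> fg; elim/quotW => x.
exact: (freeg_additive_ext
  (f := f \o \pi_(Quotient.quot (zspan (@multilin_rel n A))))
  (g := g \o \pi_(Quotient.quot (zspan (@multilin_rel n A))))).
Qed.

(** The tensor power is generated by pure tensors of elements of X, as soon as X
generates A.  The hypothesis expresses generation through additive maps, and
the entries are replaced one at a time. *)
Lemma pure_gen_ext (X : A -> Prop) (B : zmodType) (f g : {additive tensor n A -> B}) :
  (forall h : {additive A -> B}, (forall x, X x -> h x = 0) -> forall x, h x = 0) ->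
  (forall u : {ffun 'I_n -> A}, (forall i, X (u i)) -> f (pure u) = g (pure u)) -> f =1 g.
Proof.
move=> Xgen fg; apply: pure_ext => u; apply: subr0_eq.
suff E k : forall v : {ffun 'I_n -> A}, (forall i : 'I_n, (k <= i)%N -> X (v i)) ->
    f (pure v) - g (pure v) = 0.
  by apply: (E n) => i; rewrite leqNgt ltn_ord.
elim: k => [|k IHk] v vX; first by rewrite fg ?subrr // => i; exact: vX.
have [kn|kn] := ltnP k n; last first.
  by apply: IHk => i ki; have := ltn_ord i; rewrite ltnNge (leq_trans kn ki).
pose i0 := Ordinal kn.
pose h a := f (pure (upd v i0 a)) - g (pure (upd v i0 a)).
have hB : zmod_morphism h.
  by move=> a b; rewrite /h pure_updB [f _]raddfB [g _]raddfB /= opprD addrACA [in RHS]opprD.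
pose h' : {additive A -> B} := HB.pack h (GRing.isZmodMorphism.Build A B h hB).
have -> : v = upd v i0 (v i0) by apply/ffunP => j; rewrite ffunE; case: eqP => [->|].
apply: (Xgen h') => x Xx; apply: IHk => i ki; rewrite ffunE; case: eqP => // /eqP ii0.
by apply: vX; rewrite ltn_neqAle ki andbT eq_sym; apply: contra ii0 => /eqP e; apply/eqP/val_inj.
Qed.

Section Lift.
Variable e : 'I_n -> {additive A -> int}.

Definition tprod_fun : {additive {freeg {ffun 'I_n -> A} / int} -> int} :=
  fgext (fun u : {ffun 'I_n -> A} => \prod_i e i (u i)).

Lemma tprod_rel x : x \in zspan (@multilin_rel n A) -> tprod_fun x = 0.
Proof.
move: x; apply: zspan_ind => [|x y x0 y0|_ [i [u [v [w [wi uvw ->]]]]]]; first exact: raddf0.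
  by rewrite raddfB /= x0 y0 subr0.
have pE (z : {ffun 'I_n -> A}) :
    \prod_j e j (z j) = e i (z i) * \prod_(j < n | j != i) e j (z j) by rewrite (bigD1 i).
rewrite !raddfB /= /tprod_fun /= !fgextU !pE wi raddfD mulrDl /=.
have -> : \prod_(j < n | j != i) e j (u j) = \prod_(j < n | j != i) e j (w j).
  by apply: eq_bigr => j /uvw[-> _].
have -> : \prod_(j < n | j != i) e j (v j) = \prod_(j < n | j != i) e j (w j).
  by apply: eq_bigr => j /uvw[_ ->].
by rewrite [X in X - _ - _]addrC addrK subrr.
Qed.

Definition tprod : {additive tensor n A -> int} := quot_lift tprod_rel.

Lemma tprod_pure u : tprod (pure u) = \prod_i e i (u i).
Proof. by rewrite [LHS]quot_lift_pi /tprod_fun /= fgextU. Qed.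

End Lift.
End TensorTheory.

Lemma tensor_map_pure n (A B : zmodType) (f : {additive A -> B}) u :
  tensor_map n f (pure u) = pure [ffun i => f (u i)].
Proof. by rewrite [LHS]quot_map_pi /= tuples_mapU. Qed.

Section TabTheory.
Variable n : nat.

Lemma Tab_ext a (B : zmodType) (f g : {additive Tab n a -> B}) :
  (forall h : {ffun 'I_n -> 'I_a}, f (pure [ffun i => ab_gen (h i)]) = g (pure [ffun i => ab_gen (h i)])) ->
  f =1 g.
Proof.
move=> fg; apply: (pure_gen_ext (X := fun x => exists i : 'I_a, x = ab_gen i)) => [h hX|u uX].
  by apply: (ab_additive_ext (g := \0)) => i; apply: hX; exists i.
pose h : {ffun 'I_n -> 'I_a} := [ffun i => sval (cid (uX i))].
have -> : u = [ffun i => ab_gen (h i)].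
  by apply/ffunP => i; rewrite !ffunE; exact: (svalP (cid (uX i))).
exact: fg.
Qed.

Lemma Tab_fmap_pure a b (f : grhom (FG a) (FG b)) u :
  fmap (Tab n) f (pure u) = pure [ffun i => ab_map f (u i)].
Proof. exact: tensor_map_pure. Qed.

Lemma Tab_fmap_ab a b (f g : grhom (FG a) (FG b)) :
  (forall i, ab_map f (ab_gen i) = ab_map g (ab_gen i)) -> fmap (Tab n) f =1 fmap (Tab n) g.
Proof.
move=> fg; apply: pure_ext => u; rewrite !Tab_fmap_pure; congr pure.
apply/ffunP => i; rewrite !ffunE.
exact: (ab_additive_ext (f := ab_map f) (g := ab_map g) fg).
Qed.

(** The coordinates of T^n ab(F_a) in the basis of pure tensors of
generators. *)
Definition ab_coord a (h : {ffun 'I_n -> 'I_a}) : {additive Tab n a -> int} :=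
  tprod (fun i => expo (h i) : {additive ab (FG a) -> int}).

Lemma prod_delta a (h h' : {ffun 'I_n -> 'I_a}) :
  \prod_i ((h i == h' i)%:Z) = (h == h')%:Z.
Proof.
have [->|hh'] := eqVneq h h'; first by apply: big1 => i _; rewrite eqxx.
have [i hi] : exists i, h i != h' i.
  apply/existsP; rewrite -negb_forall; apply: contra hh' => /forallP hE.
  by apply/eqP/ffunP => i; apply/eqP.
by rewrite (bigD1 i) //= (negPf hi) mul0r.
Qed.

Lemma ab_coord_gen a (h h' : {ffun 'I_n -> 'I_a}) :
  ab_coord h (pure [ffun i => ab_gen (h' i)]) = (h == h')%:Z.
Proof.
rewrite /ab_coord tprod_pure -prod_delta; apply: eq_bigr => i _.
by rewrite ffunE /= expo_gen.
Qed.

Lemma Tab_expand a (y : Tab n a) :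
  y = \sum_(h : {ffun 'I_n -> 'I_a}) pure [ffun i => ab_gen (h i)] *~ ab_coord h y.
Proof.
pose E (z : Tab n a) : Tab n a :=
  \sum_(h : {ffun 'I_n -> 'I_a}) pure [ffun i => ab_gen (h i)] *~ ab_coord h z.
have EB : zmod_morphism E.
  by move=> u v; rewrite /E -sumrB; apply: eq_bigr => h _; rewrite raddfB mulrzBr.
pose E' : {additive Tab n a -> Tab n a} := HB.pack E (GRing.isZmodMorphism.Build _ _ E EB).
apply: (Tab_ext (f := idfun) (g := E')) => h; rewrite -[RHS]/(E _) /E (bigD1 h) // big1 ?addr0.
  by rewrite ab_coord_gen eqxx mulr1z; exact/esym/addr0.
by move=> h' h'h; rewrite ab_coord_gen (negPf h'h) mulr0z.
Qed.

End TabTheory.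

(** * From letters to blocks *)

Lemma part_sub n (X : {set 'I_n}) s Q : part X s -> Q \in s -> Q \subset X.
Proof.
elim: s X => //= R s IHs X /andP[RX ps]; rewrite inE => /orP[/eqP -> //|Qs].
by apply: subset_trans (IHs _ ps Qs) (subsetDl _ _).
Qed.

Lemma headsU (K : choiceType) (w : bword K) k : heads w (fgU k) = fgU (set_head w k).
Proof. exact: fgextU. Qed.

Section AbWords.
Variable n : nat.
Notation K := {set 'I_n}.
Notation G := (FG n).
Notation ZG := {freeg (bword G) / int}.

Definition ab_letters (w : bword G) : bword (ab G) := bmap (fun g => \pi_(ab G) g) w.

(** The product of the generators over a block, up to commutators: any
representative of its class in the abelianization will do. *)
Definition block_gen (R : K) : G := repr (\sum_(i in R) ab_gen i : ab G).

Lemma ab_block_gen R : \pi_(ab G) (block_gen R) = \sum_(i in R) ab_gen i.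
Proof. exact: reprK. Qed.

Lemma expo_block i (R : K) : expo i (\sum_(j in R) ab_gen j) = (i \in R)%:Z.
Proof.
rewrite raddf_sum /=; have [iR|iR] := boolP (i \in R).
  rewrite (bigD1 i) //= expo_gen eqxx big1 ?addr0 // => j /andP[_ ji].
  by rewrite expo_gen eq_sym (negPf ji).
by rewrite big1 // => j jR; rewrite expo_gen; case: eqP iR => // ->; rewrite jR.
Qed.

(** The endomorphism that sends the i-th generator to 1.  A functional that is
multilinear in the generators vanishes on words fixed by it. *)
Definition kill i : grhom G G := FG_lift (fun j => if j == i then 1%g else FG_gen j).

Lemma ab_kill_gen i j : ab_map (kill i) (ab_gen j) = if j == i then 0 else ab_gen j.
Proof. by rewrite /ab_gen ab_map_pi FG_lift_gen; case: eqP. Qed.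

(** The i-th generator does not occur in the letters of w, modulo
commutators. *)
Definition avoids i (w : bword G) : Prop :=
  forall g, g \in letters w -> ab_map (kill i) (\pi_(ab G) g) = \pi_(ab G) g.

Lemma kill_block i (R : K) : i \notin R -> ab_map (kill i) (\pi_(ab G) (block_gen R)) = \pi_(ab G) (block_gen R).
Proof.
move=> iR; rewrite ab_block_gen raddf_sum; apply: eq_bigr => j jR.
by rewrite /= ab_kill_gen; case: eqP iR => // <-; rewrite jR.
Qed.

Lemma avoids_set_head i w g :
  ab_map (kill i) (\pi_(ab G) g) = \pi_(ab G) g ->
  (forall h, h \in behead (letters w) -> ab_map (kill i) (\pi_(ab G) h) = \pi_(ab G) h) ->
  avoids i (set_head w g).
Proof. by move=> gE wE h; rewrite letters_set_head inE => /orP[/eqP ->|/wE]. Qed.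

(** The properties of functionals on words under which the products of group
elements and of blocks agree.  The set X records the generators that have not
been used yet in the induction. *)
Record blockwise (X : K) (psi : {additive ZG -> int}) : Prop := Blockwise {
  blockwise_ab : forall v v', ab_letters v = ab_letters v' -> psi (fgU v) = psi (fgU v');
  blockwise_avoid : forall i v, i \in X -> avoids i v -> psi (fgU v) = 0
}.

Lemma blockwise_bcons X psi R b : blockwise X psi ->
  blockwise (X :\: R) (psi \o bcons (block_gen R) b).
Proof.
move=> [psi_ab psi_av]; split=> [v v' vv'|i v] /=.
  by rewrite !bconsU; apply: psi_ab; rewrite /ab_letters /= -!/(ab_letters _) vv'.
rewrite inE => /andP[iR iX] iv; rewrite bconsU; apply: (psi_av i) => // g /=.
by rewrite inE => /orP[/eqP ->|/iv //]; exact: kill_block.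
Qed.

(** In the product gh - g - h of the letters belonging to blocks R and S, the
word with first letter g lacks the generators in S and the one with first
letter h lacks those in R.  They vanish unless S, respectively R, is empty,
and this gives the three cases of [smu]. *)
Lemma blockwise_bdiff (w : bword K) X psi : blockwise X psi -> part X (letters w) ->
  psi (bdiff (@gmu G) (fgU (bmap block_gen w))) = psi (bmapZ block_gen (bdiff smu (fgU w))).
Proof.
elim: w X psi => [R|R b w IHw] X psi psiX.
  by rewrite /= !bdiff_one !raddf0.
move=> /= /andP[RX pw]; rewrite -!bconsU.
have IH b' : psi (bcons (block_gen R) b' (bdiff (@gmu G) (fgU (bmap block_gen w)))) =
    psi (bcons (block_gen R) b' (bmapZ block_gen (bdiff smu (fgU w)))).
  exact: (IHw _ (psi \o bcons (block_gen R) b') (blockwise_bcons R b' psiX) pw).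
case: b; last by rewrite !bdiff_outer bmapZ_bcons IH.
have bmapE x y z : bmapZ block_gen (x + y - z) =
    bmapZ block_gen x + bmapZ block_gen y - bmapZ block_gen z by rewrite raddfB raddfD.
have psiE x y z : psi (x + y - z) = psi x + psi y - psi z by rewrite raddfB raddfD.
rewrite !bdiff_inner bmapE !bmapZ_bcons bmapZU !psiE IH; congr (_ + _ - _) => {IH IHw bmapE psiE}.
have [psi_ab psi_av] := psiX.
rewrite !hmulU; set v := bmap block_gen w.
have vS : whead v = block_gen (whead w) by rewrite /v; case: (w).
rewrite vS; set S := whead w in vS *.
have [SX rest_sub] : (S \subset X :\: R) /\
    forall Q, Q \in behead (letters w) -> Q \subset X :\: R :\: S.
  move: pw; rewrite [letters w]letters_head /= -/S => /andP[SX pw]; split=> // Q.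
  exact: part_sub.
(* the tail of the word uses neither the generators in R nor those in S *)
have rest_avoid i Q : (i \in R) || (i \in S) -> ab_map (kill i) (\pi_(ab G) (block_gen Q)) = \pi_(ab G) (block_gen Q) ->
    avoids i (set_head v (block_gen Q)).
  move=> iRS iQ; apply: avoids_set_head => // h.
  rewrite /v letters_bmap behead_map => /mapP[P Pw ->]; apply: kill_block.
  apply/negP => iP; have := subsetP (rest_sub _ Pw) _ iP; rewrite !inE.
  by move: iRS; case: (i \in R); rewrite ?andbF //=; case: (i \in S).
have head_ab g g' : \pi_(ab G) g = \pi_(ab G) g' -> psi (fgU (set_head v g)) = psi (fgU (set_head v g')).
  by move=> gg'; apply: psi_ab; rewrite /ab_letters; case: (v) => [k|k b v'] /=; rewrite gg'.
have block_mul : \pi_(ab G) (block_gen R * block_gen S)%g = \pi_(ab G) (block_gen R) + \pi_(ab G) (block_gen S) by exact: ab_piD.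
have block0 : \pi_(ab G) (block_gen set0) = 0 by rewrite ab_block_gen big_set0.
have iX i : i \in R -> i \in X by move/(subsetP RX).
have iX' i : i \in S -> i \in X by move/(subsetP SX); rewrite inE => /andP[].
have kill_S i : i \in R -> ab_map (kill i) (\pi_(ab G) (block_gen S)) = \pi_(ab G) (block_gen S).
  move=> iR; apply: kill_block; apply/negP => iS.
  by have := subsetP SX _ iS; rewrite inE iR.
have kill_R i : i \in S -> ab_map (kill i) (\pi_(ab G) (block_gen R)) = \pi_(ab G) (block_gen R).
  by move=> iS; apply: kill_block; have := subsetP SX _ iS; rewrite inE => /andP[].
rewrite /gmu !raddfB /= !headsU.
have bw T : bmapZ block_gen (fgU (set_head w T)) = fgU (set_head v (block_gen T)).
  by rewrite bmapZU /v; case: (w).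
rewrite /smu; have [R0|/set0Pn[i iR]] := eqVneq R set0.
  have -> : psi (fgU (set_head v (block_gen R * block_gen S)%g)) = psi (fgU (set_head v (block_gen S))).
    by apply: head_ab; rewrite block_mul R0 block0 add0r.
  rewrite addrAC subrr sub0r; have [S0|/set0Pn[i iS]] := eqVneq S set0.
    by rewrite !raddfN /= headsU bw R0.
  rewrite !raddf0 R0; apply/eqP; rewrite oppr_eq0; apply/eqP/(psi_av i); first exact: iX'.
  by apply: rest_avoid; rewrite ?iS ?orbT //; rewrite -R0; exact: kill_R.
have [S0|/set0Pn[i' iS']] := eqVneq S set0.
  have -> : psi (fgU (set_head v (block_gen R * block_gen S)%g)) = psi (fgU (set_head v (block_gen R))).
    by apply: head_ab; rewrite block_mul S0 block0 addr0.
  rewrite subrr sub0r !raddf0; apply/eqP; rewrite oppr_eq0; apply/eqP/(psi_av i); first exact: iX.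
  by apply: rest_avoid; rewrite ?iR //; exact: kill_S.
have -> : psi (fgU (set_head v (block_gen R))) = 0.
  by apply: (psi_av i'); [exact: iX'|apply: rest_avoid; rewrite ?iS' ?orbT //; exact: kill_R].
have -> : psi (fgU (set_head v (block_gen S))) = 0.
  by apply: (psi_av i); [exact: iX|apply: rest_avoid; rewrite ?iR //; exact: kill_S].
have dRS : [disjoint R & S] by move: SX; rewrite subsetD disjoint_sym => /andP[].
rewrite dRS !subr0 /= headsU bw; apply: head_ab.
rewrite block_mul !ab_block_gen -bigU //=; apply: eq_bigl => j.
by rewrite !inE.
Qed.

End AbWords.

(** * Cochains as functionals on words of blocks *)

Lemma eq_in_bmap (A : eqType) (L : Type) (f f' : A -> L) w :
  (forall k, k \in letters w -> f k = f' k) -> bmap f w = bmap f' w.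
Proof.
elim: w => [k|k b w IHw] /= ff'; first by rewrite ff' ?inE.
by rewrite ff' ?inE ?eqxx // IHw // => h hw; rewrite ff' // inE hw orbT.
Qed.

Section Fibers.
Variable n : nat.
Notation K := {set 'I_n}.

(** The words of blocks with a given sequence of gaps correspond to functions
from {1,...,n} to the letters, i.e. to the basis of T^n ab at the free group
on the letters: this is the reason for [chi_inj] and [chi_surj]. *)
Definition fiber a (h : {ffun 'I_n -> 'I_a}) (k : nat) : K := [set i | h i == k :> nat].

Definition fiber_word (s : bword unit) (h : {ffun 'I_n -> 'I_(wlen s)}) : bword K :=
  relab (fiber h) s.

Lemma part_relab (s : bword unit) (f : 'I_n -> nat) c :
  (forall i, f i < c + wlen s)%N ->
  part [set i | (c <= f i)%N] (letters (relab (fun k => [set i | f i == (c + k)%N]) s)).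
Proof.
elim: s c => [u|u b s IHs] c /= fc.
  rewrite addn0 (_ : [set i | f i == c] = [set i | (c <= f i)%N]) ?subxx ?setDv ?eqxx //.
  by apply/setP => i; rewrite !inE eqn_leq; have := fc i; rewrite addn1 ltnS => ->.
apply/andP; split.
  by apply/subsetP => i; rewrite !inE addn0 => /eqP ->.
rewrite (_ : _ :\: _ = [set i | (c.+1 <= f i)%N]); last first.
  by apply/setP => i; rewrite !inE addn0 ltn_neqAle eq_sym.
rewrite (_ : relab _ s = relab (fun k => [set i | f i == (c.+1 + k)%N]) s).
  by apply: IHs => i; rewrite addSnnS.
by apply: eq_relab => k _; rewrite addSnnS.
Qed.

Lemma part_fiber_word (s : bword unit) (h : {ffun 'I_n -> 'I_(wlen s)}) :
  part setT (letters (fiber_word h)).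
Proof.
have := @part_relab s (fun i => h i) 0 (fun i => ltn_ord (h i)).
by congr part; apply/setP => i; rewrite !inE.
Qed.

Lemma part_index X (s : seq K) : part X s ->
  exists f : 'I_n -> nat, (forall i, i \in X -> (f i < size s)%N) /\
    forall k, (k < size s)%N -> nth set0 s k = [set i in X | f i == k].
Proof.
elim: s X => [|R s IHs] X /=.
  move/eqP => ->; exists (fun=> 0%N); split=> // i; by rewrite inE.
move=> /andP[RX /IHs[f [fs fE]]]; exists (fun i => if i \in R then 0%N else (f i).+1); split.
  by move=> i iX; case: ifP => // iR; rewrite ltnS fs // inE iR.
case=> [_|k ks] /=; apply/setP => i.
  rewrite inE; have [iR|iR] := boolP (i \in R); first by rewrite (subsetP RX).
  by rewrite andbF.
rewrite fE // !inE; have [iR|iR] := boolP (i \in R); rewrite ?andbF //=.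
Qed.

Lemma fiber_word_exists (w : bword K) : part setT (letters w) ->
  exists h : {ffun 'I_n -> 'I_(wlen (gaps w))}, fiber_word h = w.
Proof.
move=> /part_index[f [fs fE]].
have fl i : (f i < wlen (gaps w))%N by rewrite wlen_gaps -size_letters fs.
exists [ffun i => Ordinal (fl i)]; rewrite /fiber_word relab_gaps -[RHS](relab_nth set0).
apply: eq_relab => k kw; rewrite fE ?size_letters //.
by apply/setP => i; rewrite !inE ffunE.
Qed.

End Fibers.

Section CochainIso.
Variables n m : nat.
Notation K := {set 'I_n}.
Notation G := (FG n).

(** The coefficient of y_1 (x) ... (x) y_n. *)
Definition ucoord : {additive Tab n n -> int} :=
  tprod (fun i => expo i : {additive ab (FG n) -> int}).

Definition gword (w : bword K) : bword G := bmap (@block_gen n) w.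

Section Chi.
Variable j : nat.
Implicit Type phi : nat_trans (PW m j) (Tab n).

Definition chi_fun phi : {additive {freeg (bword G) / int} -> int} :=
  ucoord \o phi n \o restr (res_word m j).

(** The functional on words of blocks attached to phi: the coefficient of
y_1 (x) ... (x) y_n in the value of phi on the word of the products of
generators. *)
Definition chi phi : {additive piece (@qcell n m j) -> int} :=
  fgext (fun u : {w | qcell m j w} => ucoord (phi n (cell m j (gword (val u))))).

Lemma chi_cell phi w : qcell m j w ->
  chi phi (restr (qcell m j) (fgU w)) = ucoord (phi n (cell m j (gword w))).
Proof.
move=> wq; rewrite -[w]/(val (Sub w wq : {w | qcell m j w})) restrU.
exact: fgextU.
Qed.

(** T^n ab factors through the abelianization, so phi only depends on the classes
of the letters. *)
Lemma nt_ab_letters phi a (v v' : bword (FG a)) :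
  bmap (fun g => \pi_(ab (FG a)) g) v = bmap (fun g => \pi_(ab (FG a)) g) v' ->
  phi a (cell m j v) = phi a (cell m j v').
Proof.
move=> vv'; have sh : gaps v = gaps v'.
  by rewrite -(gaps_bmap (fun g => \pi_(ab (FG a)) g) v) vv' gaps_bmap.
rewrite -(bmap_uword (erefl (gaps v))) -(bmap_uword (esym sh)) -!PW_cell !nt_natural.
apply: Tab_fmap_ab => i; rewrite /ab_gen !ab_map_pi !FG_lift_gen.
have iv : (i < size (letters v))%N by have := ltn_ord i; rewrite size_letters {2}wlen_gaps.
have iv' : (i < size (letters v'))%N.
  have wv : wlen v = wlen v' by rewrite -(wlen_gaps v) sh wlen_gaps.
  by rewrite size_letters -wv; move: iv; rewrite size_letters.
rewrite -(nth_map 1%g 0 (fun g => \pi_(ab (FG a)) g)) // -letters_bmap vv' letters_bmap.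
by rewrite (nth_map 1%g).
Qed.

Lemma ucoord_kill i (y : Tab n n) : (fmap (Tab n) (kill i) y : Tab n n) = y -> ucoord y = 0.
Proof.
move=> <-; apply: (pure_ext (f := ucoord \o fmap (Tab n) (kill i)) (g := \0)) => u.
rewrite -[LHS]/(ucoord (fmap (Tab n) (kill i) (pure u))) Tab_fmap_pure /ucoord tprod_pure (bigD1 i) //= ffunE.
have -> : expo i (ab_map (kill i) (u i)) = 0; last by rewrite mul0r.
apply: (ab_additive_ext (f := (expo i : {additive _ -> _}) \o ab_map (kill i)) (g := \0)) => k /=.
rewrite ab_kill_gen; case: eqP => [_|/eqP ki]; first by rewrite raddf0.
by rewrite expo_gen eq_sym (negPf ki).
Qed.

Lemma chi_blockwise phi X : blockwise X (chi_fun phi).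
Proof.
split=> [v v' vv'|i v _ iv]; rewrite /chi_fun /=.
  by congr (ucoord _); exact: nt_ab_letters vv'.
apply: (ucoord_kill (i := i)).
rewrite -[LHS](nt_natural phi (kill i) (cell m j v)) PW_cell; apply: nt_ab_letters.
rewrite -bmap_comp; apply: eq_in_bmap => g gv.
by rewrite -[RHS](iv _ gv) ab_map_pi.
Qed.

Lemma chi_restr phi x : x \in fspan (fun w : bword K => part setT (letters w)) ->
  chi phi (restr (qcell m j) x) = chi_fun phi (bmapZ (@block_gen n) x).
Proof.
apply: (fspan_eq (f := chi phi \o restr (qcell m j)) (g := chi_fun phi \o bmapZ (@block_gen n))) => w pw.
rewrite -[LHS]/(chi phi (restr (qcell m j) (fgU w))).
rewrite -[RHS]/(ucoord (phi n (restr (res_word m j) (bmapZ (@block_gen n) (fgU w))))) bmapZU.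
have [wq|wq] := boolP (qcell m j w); first by rewrite chi_cell.
have wo : ~~ res_word m j (bmap (@block_gen n) w).
  by move: wq; rewrite /qcell pw andbT -[res_word m j (bmap _ _)]res_word_gaps gaps_bmap res_word_gaps.
by rewrite !restr_out // !raddf0.
Qed.

Lemma word_hom_block (s : bword unit) (w : bword K) : gaps w = s ->
  forall i : 'I_(wlen s), ab_map (word_hom s (gword w)) (ab_gen i)
    = \sum_(k in nth set0 (letters w) i) ab_gen k.
Proof.
move=> ws i; rewrite /ab_gen ab_map_pi FG_lift_gen letters_bmap.
rewrite (nth_map set0); first by rewrite -ab_block_gen.
have sw : size (letters w) = wlen s by rewrite size_letters -ws wlen_gaps.
by rewrite sw.
Qed.

Lemma ucoord_fiber (s : bword unit) (h h' : {ffun 'I_n -> 'I_(wlen s)}) :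
  ucoord (fmap (Tab n) (word_hom s (gword (fiber_word h))) (pure [ffun i => ab_gen (h' i)])) = (h == h')%:Z.
Proof.
rewrite Tab_fmap_pure /ucoord tprod_pure -prod_delta; apply: eq_bigr => i _.
rewrite !ffunE word_hom_block ?gaps_relab //= expo_block letters_relab ?ltn_ord //.
by rewrite inE.
Qed.

(** Substituting for each letter the product of the generators over its fibre turns
the coefficient of y_1 (x) ... (x) y_n into the coordinate h. *)
Lemma ucoord_word_hom (s : bword unit) (h : {ffun 'I_n -> 'I_(wlen s)}) y :
  ucoord (fmap (Tab n) (word_hom s (gword (fiber_word h))) y) = ab_coord h y.
Proof.
apply: (Tab_ext (f := ucoord \o fmap (Tab n) (word_hom s (gword (fiber_word h)))) (g := ab_coord h)) => h'.
by rewrite ab_coord_gen -ucoord_fiber.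
Qed.

Lemma qcell_fiber (s : bword unit) (h : {ffun 'I_n -> 'I_(wlen s)}) :
  res_word m j s -> qcell m j (fiber_word h).
Proof. by move=> sok; rewrite /qcell res_word_relab sok part_fiber_word. Qed.

(** phi is determined by its values on universal words, and the coordinates of
these are values of chi phi. *)
Lemma chi_inj phi : (forall x, chi phi x = 0) -> phi = 0.
Proof.
move=> phi0; apply: PW_nt_eq => s sok; rewrite (Tab_expand (phi _ _)) big1 // => h _.
rewrite -ucoord_word_hom -nt_natural PW_cell bmap_uword ?gaps_bmap ?gaps_relab //.
by rewrite -chi_cell ?qcell_fiber // phi0 mulr0z.
Qed.

(** By the Yoneda lemma the values on universal words are arbitrary, so their
coordinates can be prescribed to be those of b. *)
Lemma chi_surj (b : {additive piece (@qcell n m j) -> int}) :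
  exists phi, forall x, chi phi x = b x.
Proof.
pose t (s : bword unit) : Tab n (wlen s) :=
  \sum_(h : {ffun 'I_n -> 'I_(wlen s)})
    pure [ffun i => ab_gen (h i)] *~ b (restr (qcell m j) (fgU (fiber_word h))).
exists (PW_ext m j t); apply: freeg_additive_ext => u.
rewrite -restrU; have uq := valP u; have /andP[uok /fiber_word_exists[h hu]] := uq.
rewrite chi_cell // [PW_ext m j t n _]PW_ext_cell; last first.
  by rewrite -res_word_gaps gaps_bmap res_word_gaps.
rewrite gaps_bmap (_ : gword (val u) = gword (fiber_word h)); last by rewrite hu.
have E (h' : {ffun 'I_n -> 'I_(wlen (gaps (val u)))}) c : ucoord (fmap (Tab n) (word_hom _ (gword (fiber_word h)))
    (pure [ffun i => ab_gen (h' i)] *~ c)) = (h == h')%:Z * c.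
  by rewrite [fmap _ _ _]raddfMz [ucoord _]raddfMz ucoord_fiber mulrzz.
rewrite [fmap _ _ _]raddf_sum [ucoord _]raddf_sum (bigD1 h) // big1 ?addr0.
  by rewrite -[LHS]/(_ + _) [X in X + _]E eqxx mul1r hu addr0.
by move=> h' h'h; rewrite -[LHS]/(ucoord _) E eq_sym (negPf h'h) mul0r.
Qed.

End Chi.

Lemma chi_diff j (phi : nat_trans (PW m j) (Tab n)) x :
  chi (nt_precomp (PW_diff m j) phi) x = chi phi (Qd n m j x).
Proof.
apply: (freeg_additive_ext (f := chi (nt_precomp (PW_diff m j) phi)) (g := chi phi \o Qd n m j)) => u.
have uq := valP u; have /andP[uok pu] := uq.
rewrite -restrU chi_cell // /= [PW_diff m j n _]PW_diffE.
rewrite [Qd n m j _]compressE restrU inclU chi_restr; last first.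
  by apply: fspan_sub (D_set_span (val u)) => w' [_ _ [-> _]].
exact: (blockwise_bdiff (chi_blockwise phi setT) pu).
Qed.

Lemma chiD j (phi psi : nat_trans (PW m j) (Tab n)) x : chi (phi - psi) x = chi phi x - chi psi x.
Proof.
apply: (freeg_additive_ext (f := chi (phi - psi)) (g := chi phi \- chi psi)) => u.
rewrite -restrU -[RHS]/(chi phi _ - chi psi _) !chi_cell ?(valP u) //.
by rewrite -[LHS]/(ucoord (phi n _ - psi n _)) raddfB.
Qed.

End CochainIso.

(** * A shuffle cycle in the middle degree *)

Section Shuffle.
Variable n : nat.
Notation K := {set 'I_n}.
Notation W := (bword K).
Notation ZW := {freeg W / int}.
Notation D := (bdiff (@smu n)).
Implicit Types (w v : W) (x : ZW) (e R S : K) (s : seq K).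

Lemma smuC R S : smu R S = smu S R.
Proof.
rewrite /smu disjoint_sym setUC.
by case: (R == set0); case: (S == set0).
Qed.

(** The sum over the insertions of e behind the first letter of w, before the first
outer gap, with alternating signs; it is the tail of the result, so that it does
not depend on that letter. *)
Fixpoint insert_after e w : ZW :=
  match w with
  | BOne _ => fgU (BOne e)
  | BCons _ true w' => fgU (BCons e true w') - bcons (whead w') true (insert_after e w')
  | BCons _ false w' => fgU (BCons e false w')
  end.

Definition insert_behind e : ZW -> ZW :=
  fgext (fun w => bcons (whead w) true (insert_after e w)).
HB.instance Definition _ e := GRing.Additive.on (insert_behind e).
Arguments insert_behind e x : simpl never.

(** The signed sum over all insertions of the letter e into the part of the word
before the first outer gap, joined by inner gaps: the shuffle product with e. *)
Definition insert e x : ZW := bcons e true x - insert_behind e x.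

Lemma insert_is_additive e : zmod_morphism (insert e).
Proof.
move=> x y; rewrite /insert (raddfB (bcons e true)) (raddfB (insert_behind e)).
by rewrite /= 2!opprD addrACA.
Qed.
HB.instance Definition _ e :=
  GRing.isZmodMorphism.Build ZW ZW (insert e) (insert_is_additive e).

Lemma insert_behindU e w :
  insert_behind e (fgU w) = bcons (whead w) true (insert_after e w).
Proof. exact: fgextU. Qed.

Lemma insert_behind_inner e R x :
  insert_behind e (bcons R true x) = bcons R true (insert e x).
Proof.
apply: (freeg_additive_ext (f := insert_behind e \o bcons R true)
  (g := bcons R true \o insert e)) => w /=.
by rewrite bconsU insert_behindU /= /insert insert_behindU bconsU.
Qed.

Lemma insert_behind_outer e R x :
  insert_behind e (bcons R false x) = bcons R true (bcons e false x).
Proof.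
apply: (freeg_additive_ext (f := insert_behind e \o bcons R false)
  (g := bcons R true \o bcons e false)) => w /=.
by rewrite bconsU insert_behindU [bcons e false _]bconsU.
Qed.

Lemma insert_after_set_head e w k : insert_after e (set_head w k) = insert_after e w.
Proof. by case: w => [h|h [] w]. Qed.

Lemma insert_behind_hmul e R x :
  insert_behind e (hmul smu R x) = hmul smu R (insert_behind e x).
Proof.
apply: (freeg_additive_ext (f := insert_behind e \o hmul smu R)
  (g := hmul smu R \o insert_behind e)) => w /=.
rewrite hmulU insert_behindU hmul_bcons [LHS]fgext_comp.
apply: eq_fgext => k; rewrite /= insert_behindU insert_after_set_head.
by case: w => [h|h [] w].
Qed.

Lemma hmul_bconsC e R b x : hmul smu R (bcons e b x) = hmul smu e (bcons R b x).
Proof. by rewrite !hmul_bcons smuC. Qed.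

(** The terms that multiply e with its left neighbour cancel those that multiply it
with its right neighbour, as the product is commutative; the product of e with
the first letter remains. *)
Lemma mdiff_insert_behind e x :
  mdiff smu (insert_behind e x) = hmul smu e x - insert_behind e (mdiff smu x).
Proof.
move: x; apply: (ZW_ind_ext (f := mdiff smu \o insert_behind e)
  (g := hmul smu e \- (insert_behind e \o mdiff smu))) => [R|R b x] /=.
  rewrite insert_behindU mdiff_one raddf0 subr0 /= mdiff_inner mdiff_one raddf0 subr0.
  by rewrite !hmulU /= smuC.
case: b => IHx.
  have dI : mdiff smu (insert e x) = - insert e (mdiff smu x).
    by rewrite [in LHS]/insert [LHS]raddfB /= mdiff_inner IHx opprB addrC addrA subrK opprB.
  rewrite insert_behind_inner !mdiff_inner dI.
  rewrite [bcons R true (- _)]raddfN [insert_behind e (_ - _)]raddfB /=.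
  rewrite insert_behind_hmul insert_behind_inner -hmul_bconsC opprK opprB.
  by rewrite [in hmul _ _ (insert _ _)]/insert [hmul _ _ (_ - _)]raddfB addrA addrAC.
rewrite insert_behind_outer mdiff_inner !mdiff_outer insert_behind_outer.
by rewrite hmul_bconsC.
Qed.

(** The shuffle product with e anticommutes with the differential of a
commutative algebra. *)
Lemma mdiff_insert e x : mdiff smu (insert e x) = - insert e (mdiff smu x).
Proof.
rewrite [in LHS]/insert [LHS]raddfB /= mdiff_inner mdiff_insert_behind opprB.
by rewrite addrC addrA subrK opprB.
Qed.

Definition same_part s w : Prop := forall X, part X (letters w) = part X s.

Lemma part_swap X R S s : part X [:: R, S & s] = part X [:: S, R & s].
Proof.
rewrite /= !subsetD !setDDl [S :|: R]setUC [[disjoint S & R]]disjoint_sym.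
by case: (R \subset X); case: (S \subset X); case: [disjoint R & S].
Qed.

Lemma insert_span e w : dout w = 0%N ->
  insert e (fgU w) \in fspan (fun w' => [/\ din w' = (din w).+1, dout w' = 0%N,
    same_part (e :: letters w) w' & whead w' \in [:: e; whead w]]).
Proof.
elim: w => [R|R [] w IHw] //= w0; rewrite /insert.
  rewrite insert_behindU /= !bconsU; apply: rpredB; apply: fspanU; split=> //.
  - by rewrite inE eqxx.
  - by move=> X; exact: part_swap.
  by rewrite !inE eqxx orbT.
rewrite -bconsU insert_behind_inner !bconsU; apply: rpredB.
  by apply: fspanU; rewrite /= w0 inE eqxx.
apply: span_bcons (IHw w0) => w' /= [dw ow pw _]; split; rewrite ?dw ?ow //.
  by move=> X; rewrite part_swap /= pw.
by rewrite !inE eqxx orbT.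
Qed.

(** The antisymmetrization of the word with the letters e :: s and inner gaps, as an
iterated shuffle product. *)
Fixpoint shuffle e s : ZW := if s is f :: s' then insert e (shuffle f s') else fgU (BOne e).
Fixpoint inner_word e s : W := if s is f :: s' then BCons e true (inner_word f s') else BOne e.

Lemma shuffle_span e s : shuffle e s \in fspan (fun w =>
  [/\ din w = size s, dout w = 0%N, same_part (e :: s) w & whead w \in e :: s]).
Proof.
elim: s e => [|f s IHs] e /=.
  by apply: fspanU; rewrite inE eqxx.
apply: fspan_additive (IHs f) => w [dw ow pw hw].
apply: fspan_sub (insert_span e ow) => w' [dw' ow' pw' hw']; split=> //.
- by rewrite dw' dw.
- by move=> X; rewrite pw' /= pw.
move: hw'; rewrite !inE => /orP[->//|/eqP ->].
by move: hw; rewrite inE => ->; rewrite orbT.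
Qed.

Lemma mdiff_shuffle e s : mdiff smu (shuffle e s) = 0.
Proof.
elim: s e => [|f s IHs] e /=; first exact: mdiff_one.
by rewrite mdiff_insert IHs raddf0 oppr0.
Qed.

Definition delta v : ZW -> int := fgext (fun w => (w == v)%:Z).
HB.instance Definition _ v := GRing.Additive.on (delta v).
Arguments delta v x : simpl never.

Lemma deltaU v w : delta v (fgU w) = (w == v)%:Z. Proof. exact: fgextU. Qed.

Lemma delta_out v (p : W -> Prop) x : x \in fspan p -> ~ p v -> delta v x = 0.
Proof.
move=> xp pv; apply: (fspan_eq (f := delta v) (g := \0) _ xp) => w pw.
by rewrite /= deltaU; case: eqP => // e; rewrite e in pw.
Qed.

Lemma delta_bcons e b v x : delta (BCons e b v) (bcons e b x) = delta v x.
Proof.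
apply: (freeg_additive_ext (f := delta (BCons e b v) \o bcons e b) (g := delta v)) => w /=.
rewrite bconsU !deltaU; congr (nat_of_bool _)%:Z.
by apply/eqP/eqP => [[]|->].
Qed.

Lemma delta_insert_behind e b v x : x \in fspan (fun w => whead w != e) ->
  delta (BCons e b v) (insert_behind e x) = 0.
Proof.
apply: (fspan_eq (f := delta (BCons e b v) \o insert_behind e) (g := \0)) => w wP /=.
rewrite insert_behindU; apply: (delta_out (p := fun w' => whead w' = whead w)).
  by apply: span_bcons (fspan_all _) => w' _.
by move=> /= ew; rewrite ew eqxx in wP.
Qed.

Lemma delta_conv_insert_behind e b v x : x \in fspan (fun w => whead w != e) ->
  delta (BCons e b v) (conv (insert_behind e x)) = 0.
Proof.
move=> xP; apply: (delta_out (p := fun w => whead w != e)); last by rewrite /= eqxx.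
apply: (fspan_additive (p := fun w => whead w != e)).
  move=> w wP; apply: fspan_sub (conv_span w) => w' [_ _ e'].
  by have := letters_head w'; rewrite e' letters_head => -[<-].
apply: (fspan_additive (f := insert_behind e)) xP => w wP; rewrite /= insert_behindU.
by apply: span_bcons (fspan_all _) => w' _.
Qed.

Lemma shuffle_head e f s : e \notin f :: s -> shuffle f s \in fspan (fun w => whead w != e).
Proof.
move=> efs; apply: fspan_sub (shuffle_span f s) => w [_ _ _ ws].
by apply: contra efs => /eqP <-.
Qed.

(** The letter e can come first in a word of the shuffle only by having been
inserted there. *)
Lemma delta_shuffle e s : uniq (e :: s) -> delta (inner_word e s) (shuffle e s) = 1.
Proof.
elim: s e => [|f s IHs] e /=; first by rewrite deltaU eqxx.
move=> /andP[efs fs]; rewrite /insert [LHS]raddfB /= delta_bcons IHs //.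
by rewrite delta_insert_behind ?subr0 //; exact: shuffle_head.
Qed.

Lemma delta_conv_shuffle e f s : uniq [:: e, f & s] ->
  delta (BCons e false (inner_word f s)) (conv (shuffle e (f :: s))) = 1.
Proof.
move=> /=/andP[efs fs]; rewrite /insert [conv _]raddfB /= conv_inner !raddfB /=.
rewrite delta_bcons delta_shuffle // delta_conv_insert_behind; last exact: shuffle_head.
rewrite subr0 (delta_out (p := fun w => if w is BCons _ b _ then b = true else True)) ?subr0 //.
by apply: span_bcons (fspan_all _).
Qed.




Fixpoint prefixed s w : W := if s is e :: s' then BCons e false (prefixed s' w) else w.

Definition prefix s : ZW -> ZW := fgext (fun w => fgU (prefixed s w)).
HB.instance Definition _ s := GRing.Additive.on (prefix s).
Arguments prefix s x : simpl never.

Lemma prefixU s w : prefix s (fgU w) = fgU (prefixed s w). Proof. exact: fgextU. Qed.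

Lemma prefix_cons e s x : prefix (e :: s) x = bcons e false (prefix s x).
Proof.
apply: (freeg_additive_ext (f := prefix (e :: s)) (g := bcons e false \o prefix s)) => w.
by rewrite /= !prefixU bconsU.
Qed.

Lemma D_prefix s x : D (prefix s x) = prefix s (D x).
Proof.
elim: s => [|e s IHs]; first by rewrite /prefix !fgext_id.
by rewrite !prefix_cons bdiff_outer IHs.
Qed.

Lemma delta_prefix s v x : delta (prefixed s v) (prefix s x) = delta v x.
Proof.
elim: s => [|e s IHs]; first by rewrite /prefix fgext_id.
by rewrite prefix_cons /= delta_bcons.
Qed.

Lemma letters_prefixed s w : letters (prefixed s w) = s ++ letters w.
Proof. by elim: s => //= e s ->. Qed.
Lemma din_prefixed s w : din (prefixed s w) = din w.
Proof. by elim: s. Qed.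
Lemma dout_prefixed s w : dout (prefixed s w) = (size s + dout w)%N.
Proof. by elim: s => //= e s ->. Qed.
Lemma letters_inner_word e s : letters (inner_word e s) = e :: s.
Proof. by elim: s e => //= f s IHs e; rewrite IHs. Qed.

Lemma part_cat_eq X s s1 s2 :
  (forall Y, part Y s1 = part Y s2) -> part X (s ++ s1) = part X (s ++ s2).
Proof. by move=> e; elim: s X => [|R s IHs] X //=; rewrite IHs. Qed.

Definition points : seq K := [seq [set i] | i <- enum 'I_n].

Lemma points_uniq : uniq points.
Proof. by rewrite map_inj_uniq ?enum_uniq //; exact: set1_inj. Qed.

Lemma points_size : size points = n.
Proof. by rewrite size_map size_enum_ord. Qed.

Lemma points_nonempties : nonempties points.
Proof. by rewrite /nonempties all_map; apply/allP => i _ /=; rewrite -card_gt0 cards1. Qed.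

Lemma points_part : part setT points.
Proof.
have H (t : seq 'I_n) (X : K) : uniq t -> X =i t -> part X [seq [set i] | i <- t].
  elim: t X => [|i t IHt] X /=; first by move=> _ Xt; apply/eqP/setP => i; rewrite Xt inE.
  move=> /andP[it ut] Xt; rewrite sub1set Xt inE eqxx /=; apply: IHt => // k.
  rewrite !inE Xt inE; case: eqP => //= ->; exact/esym/negbTE.
by apply: H (enum_uniq _) _ => i; rewrite inE mem_enum.
Qed.

(** The cycle is the word of m - 1 points with outer gaps, followed by the
shuffle of the remaining points.  Its shuffle part is annihilated by [mdiff], so
its differential D only converts gaps and has m outer gaps, whence it is zero in
the complex.  The functional c reads off one coefficient of that
unrestricted differential.  It vanishes on boundaries: the words that [Qd]
discards there have at least m outer gaps and more than n letters, hence an empty block,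
and c does not see such words; without discarding, D D = 0. *)
Lemma shuffle_cycle m j : (0 < m)%N -> n = (m + j.+1)%N ->
  exists (c : {additive piece (@qcell n m j.+1) -> int}) (z : piece (@qcell n m j.+1)),
  [/\ forall x : piece (@qcell n m j.+2), c (Qd n m j.+1 x) = 0, Qd n m j z = 0 & c z = 1].
Proof.
move=> m0 nmj.
pose s1 := take m.-1 points.
(* the points: m - 1 of them for the prefix, at least two for the shuffle *)
have [e [f [s Ls]]] : exists e f s, points = s1 ++ [:: e, f & s].
  have : size (drop m.-1 points) = j.+2 by rewrite size_drop points_size; lia.
  rewrite -{2}(cat_take_drop m.-1 points) -/s1.
  by case: (drop _ _) => [|e [|f s]] // _; exists e, f, s.
have s1s : size s1 = m.-1 by rewrite size_take points_size; case: ifP; lia.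
have ss : size s = j.
  by have := congr1 size Ls; rewrite points_size size_cat /= s1s; lia.
have us : uniq [:: e, f & s] by have := points_uniq; rewrite Ls cat_uniq => /and3P[].
pose v := prefixed s1 (BCons e false (inner_word f s)).
have vne : nonempties (letters v).
  by rewrite letters_prefixed /= letters_inner_word -Ls points_nonempties.
pose z := prefix s1 (shuffle e (f :: s)).
have Dz : D z = prefix s1 (conv (shuffle e (f :: s))).
  by rewrite /z D_prefix /bdiff mdiff_shuffle add0r.
have zP : z \in fspan (fun w => qcell m j.+1 w).
  apply: fspan_fgext (shuffle_span e (f :: s)) => w [dw ow pw _]; apply: fspanU.
  rewrite /qcell /res_word din_prefixed dout_prefixed letters_prefixed dw ow addn0 s1s /= ss eqxx.
  by rewrite (part_cat_eq _ _ pw) -Ls points_part andbT; lia.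
pose c : {additive piece (@qcell n m j.+1) -> int} := delta v \o D \o incl _.
exists c, (restr _ z); split.
- suff H w : qcell m j.+2 w -> c (restr _ (D (fgU w))) = 0.
    by apply: (freeg_additive_ext (f := c \o Qd n m j.+1) (g := \0)) => -[w wP]; rewrite -[LHS]/(c (compress _ _ _ _)) compressE inclU; apply: H.
  move=> /andP[/andP[/eqP dw ow] pw].
  have -> : c (restr _ (D (fgU w))) = delta v (D (D (fgU w))).
    apply: (fspan_eq (f := c \o restr _) (g := delta v \o D)) (D_set_span w) => w' [dw' ow' [pw' nw']].
    rewrite /c /=; have [w'P|w'P] := boolP (qcell m j.+1 w').
      by rewrite incl_restr //; exact: fspanU.
    rewrite restr_out // !raddf0; apply/esym/(delta_out (D_set_span w')) => -[_ _ [_ nv]].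
    have := qcell_ne_wlen (w := w').
    rewrite -nv vne pw' pw wlenE => /(_ isT isT).
    by move: w'P; rewrite /qcell /res_word pw' pw andbT; lia.
  by rewrite bdiff_bdiff ?raddf0 //; exact: smuA.
- rewrite [LHS]compressE incl_restr //= Dz.
  apply: (restr_span0 (r := fun w => (m <= dout w)%N)).
    by move=> w ow; rewrite /qcell /res_word ltnNge ow andbF.
  apply: (fspan_fgext (p := fun w => dout w = 1%N)).
    by move=> w ow; apply: fspanU; rewrite dout_prefixed s1s ow; lia.
  apply: (fspan_additive (f := @conv K)) (shuffle_span e (f :: s)) => w [_ ow _ _].
  by apply: fspan_sub (conv_set_span w) => w' [_ -> _ _]; rewrite ow.
by rewrite /c /= incl_restr // Dz delta_prefix delta_conv_shuffle.
Qed.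

End Shuffle.

(** * The Ext groups *)

Section Computation.
Variables n m : nat.
Notation P := (Passi_resolution m).
Notation H i := (cohomology (Tab n) P i).

(** Transports the search for a primitive to the dual complex. *)
Lemma precomp_of_chi j (phi : nat_trans (PW m j.+1) (Tab n)) (psi : nat_trans (PW m j) (Tab n)) :
  (forall x, chi phi x = chi psi (Qd n m j x)) -> phi = nt_precomp (PW_diff m j) psi.
Proof.
move=> e; apply/subr0_eq/chi_inj => x.
by rewrite chiD chi_diff e subrr.
Qed.

Lemma chi_cocycle i (phi : nat_trans (PW m i) (Tab n)) x :
  phi \in cocycles (Tab n) P i -> chi phi (Qd n m i x) = 0.
Proof.
move=> /eqP phi0; rewrite -chi_diff -[nt_precomp _ _]/(nt_precomp (res_diff P i) phi) phi0.
by have := chiD 0 0 x; rewrite !subrr.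
Qed.

Lemma cohomology_trivial i :
  (forall phi : nat_trans (P i) (Tab n), phi \in cocycles (Tab n) P i -> is_coboundary phi) ->
  zmod_trivial (H i).
Proof.
move=> B; elim/quotW=> phi; apply/eqP; rewrite quot_pi_eq0; apply/asboolP.
exact: B (valP phi).
Qed.

Lemma cohomology_trivialS j : contractible (Qd n m j.+1) (Qd n m j) -> zmod_trivial (H j.+1).
Proof.
move=> contr; apply: cohomology_trivial => phi phiC.
have [x|b bE] := contractible_cosection (@Qd_Qd n m j) contr (c := chi phi).
  exact: chi_cocycle.
have [psi psiE] := chi_surj b; exists psi.
by apply: precomp_of_chi => x; rewrite bE psiE.
Qed.

Lemma cohomology_trivial0 : (m < n)%N -> zmod_trivial (H 0).
Proof.
move=> mn; apply: cohomology_trivial => phi phiC; apply: chi_inj => x.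
have [y|y|b bE] := contractible_cosection (d1 := \0 : {additive piece (@qcell n m 0) -> int}) _ (Qd_contractible_low0 int mn) (c := chi phi).
- by [].
- exact: chi_cocycle.
by rewrite bE raddf0.
Qed.

(** Because of d K d = d, the coboundaries form a direct summand of the cochains
one degree higher.  The condition on j makes the complex contractible at j. *)
Lemma boundary_section j : (j + m < n)%N ->
  exists K : {additive piece (@qcell n m j) -> piece (@qcell n m j.+1)},
    forall x, Qd n m j (K (Qd n m j x)) = Qd n m j x.
Proof.
case: j => [|j] jmn.
  have [//|K KE] := contractible_section (d1 := \0 : {additive piece (@qcell n m 0) -> int}) _ (Qd_contractible_low0 int jmn).
  by exists K => x; apply: KE.
have [K KE] := contractible_section (@Qd_Qd n m j) (Qd_contractible_low jmn).
by exists K => x; apply: KE; exact: Qd_Qd.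
Qed.

Fixpoint all_words N : seq (bword {set 'I_n}) :=
  if N is N'.+1 then
    [seq BOne k | k <- enum {set 'I_n}] ++
    [seq BCons kb.1 kb.2 w | kb <- enum {: {set 'I_n} * bool}, w <- all_words N']
  else [::].

Lemma mem_all_words N w : (wlen w <= N)%N -> w \in all_words N.
Proof.
elim: N w => [|N IHN] [k|k b w] //= wN; rewrite mem_cat.
  by rewrite map_f ?mem_enum.
apply/orP; right; apply/allpairsP; exists ((k, b), w).
by split; [rewrite mem_enum|exact: IHN|].
Qed.

Lemma chi_at_is_additive j (x : piece (@qcell n m j)) :
  zmod_morphism (fun phi : nat_trans (PW m j) (Tab n) => chi phi x).
Proof. by move=> phi psi; exact: chiD. Qed.

Definition chi_at j (x : piece (@qcell n m j)) : {additive nat_trans (PW m j) (Tab n) -> int} :=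
  HB.pack (fun phi : nat_trans (PW m j) (Tab n) => chi phi x)
    (GRing.isZmodMorphism.Build (nat_trans (PW m j) (Tab n)) int _ (chi_at_is_additive x)).

(** The part of a cochain that lives on the elements x - K d x is unchanged by
coboundaries, and it determines the cochain up to coboundaries.  There are
finitely many words x, so this embeds the cohomology into a finite power
of Z. *)
Lemma cohomology_free j : (j + m < n)%N -> free_abelian (H j.+1).
Proof.
move=> /boundary_section[K KE].
pose defect (x : piece (@qcell n m j.+1)) := x - K (Qd n m j x).
(* the value on x - K d x is well defined on cohomology classes *)
pose theta x : {additive subz (cocycles (Tab n) P j.+1) -> int} := chi_at (defect x) \o val.
have thetaB x u : u \in @coboundaries _ (Tab n) P j.+1 -> theta x u = 0.
  move=> /asboolP[psi uE]; rewrite -[LHS]/(chi (val u) (defect x)) uE.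
  rewrite -[LHS]/(chi (nt_precomp (PW_diff m j) psi) (defect x)) chi_diff /defect.
  by rewrite [Qd n m j _]raddfB /= KE subrr raddf0.
pose s := all_words (j.+1 + m).
pose w0 := BOne (set0 : {set 'I_n}).
apply: (@free_abelian_embed (size s) _ (fun i => quot_lift (thetaB (restr (qcell m j.+1) (fgU (nth w0 s i)))))).
elim/quotW=> u u0; apply/eqP; rewrite quot_pi_eq0; apply/asboolP.
have [psi psiE] := chi_surj (chi (val u) \o K); exists psi; apply: precomp_of_chi => x.
rewrite psiE; apply: (freeg_additive_ext (f := chi (val u)) (g := chi (val u) \o K \o Qd n m j)) => -[w wq].
have ws : w \in s.
  by apply: mem_all_words; move: wq => /andP[/andP[/eqP dw ow] _]; rewrite wlenE dw; lia.
have := u0 (Ordinal (etrans (index_mem w s) ws)).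
rewrite quot_lift_pi /= nth_index // -[w in restr _ (fgU w)]/(val (Sub w wq : {w | qcell m j.+1 w})).
rewrite restrU -[LHS]/(chi (val u) (defect _)) /defect raddfB => /subr0_eq.
exact.
Qed.

Lemma cohomology_nontrivial j : (0 < m)%N -> n = (m + j.+1)%N -> ~ zmod_trivial (H j.+1).
Proof.
move=> m0 nmj H0; have [c [z [cd dz cz]]] := shuffle_cycle m0 nmj.
have [phi phiE] := chi_surj c.
have phiC : phi \in cocycles (Tab n) P j.+1.
  apply/eqP/chi_inj => x; rewrite -[LHS]/(chi (nt_precomp (PW_diff m j.+1) phi) x).
  by rewrite chi_diff phiE cd.
have := H0 (\pi_(Quotient.quot _) (Subz phiC)) => /eqP; rewrite quot_pi_eq0 => /asboolP[psi] /= e.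
have := phiE z; rewrite cz e -[LHS]/(chi (nt_precomp (PW_diff m j) psi) z) chi_diff dz raddf0.
by [].
Qed.

(** A cocycle factors through the augmentation [sgn0], so it is determined by
its value on the word with a single block. *)
Lemma cohomology0_int : (0 < n)%N -> (n <= m)%N -> zmod_iso (H 0) int.
Proof.
move=> n0 nm.
pose f : {additive subz (cocycles (Tab n) P 0) -> int} := chi_at (top_block n m) \o val.
have fB u : u \in @coboundaries _ (Tab n) P 0 -> f u = 0.
  by move=> /asboolP u0; rewrite -[LHS]/(chi_at _ (val u)) u0 raddf0.
apply: (zmod_iso_of (f := quot_lift fB)).
  elim/quotW=> u; rewrite quot_lift_pi => fu; apply/eqP; rewrite quot_pi_eq0; apply/asboolP.
  apply: chi_inj => x.
  have [y|b bE] := contractible_cosection (fun y => sgn0_Qd n0 y nm) (Qd_contractible_zero n0 nm) (c := chi (val u)).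
    by apply: chi_cocycle; exact: (valP u).
  have b1 : b 1 = 0 by rewrite -(sgn0_top n0 nm) -bE.
  by rewrite bE -[sgn0 n m x]intz raddfMz /= b1 mul0rz.
move=> z; have [phi phiE] := chi_surj (GRing.mull_fun z (sgn0 n m : {additive piece (@qcell n m 0) -> int})).
have phiC : phi \in cocycles (Tab n) P 0.
  apply/eqP/chi_inj => x; rewrite -[LHS]/(chi (nt_precomp (PW_diff m 0) phi) x).
  by rewrite chi_diff phiE -[LHS]/(z * sgn0 n m (Qd n m 0 x)) sgn0_Qd // mulr0.
exists (\pi_(Quotient.quot _) (Subz phiC)); rewrite quot_lift_pi.
by rewrite -[LHS]/(chi phi (top_block n m)) phiE -[LHS]/(z * sgn0 n m (top_block n m)) sgn0_top // mulr1.
Qed.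

End Computation.

Theorem corollary13p11 (n m : nat) :
  (1 <= n)%N ->
  ((m < n)%N ->
     [/\ forall i : nat, i <> (n - m)%N -> zmod_trivial (Ext (Pa m) (Tab n) i),
         free_abelian (Ext (Pa m) (Tab n) (n - m)%N)
       & (0 < m)%N -> ~ zmod_trivial (Ext (Pa m) (Tab n) (n - m)%N)]) /\
  ((n <= m)%N ->
     zmod_iso (Ext (Pa m) (Tab n) 0%N) int /\
     forall i : nat, (0 < i)%N -> zmod_trivial (Ext (Pa m) (Tab n) i)).
Proof.
move=> n0.
have iso i : zmod_iso (Ext (Pa m) (Tab n) i) (cohomology (Tab n) (Passi_resolution m) i).
  exact: cohomology_unique.
split=> [mn|nm].
  have [j nmj] : exists j, (n - m = j.+1)%N by exists (n - m).-1; lia.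
  split.
  - case=> [_|i iE]; apply: zmod_trivial_iso (iso _) _; first exact: cohomology_trivial0.
    (* degree i.+1 differs from n - m, so it is below or above *)
    apply: cohomology_trivialS; have [lt_i|le_i] := ltnP (i.+1 + m) n.
      exact: Qd_contractible_low.
    by apply: Qd_contractible_high; lia.
  - by apply: free_abelian_iso (iso _) _; rewrite nmj; apply: cohomology_free; lia.
  move=> m0 /(zmod_trivial_iso (zmod_iso_sym (iso _))); rewrite nmj.
  by apply: cohomology_nontrivial => //; lia.
split; first exact: zmod_iso_trans (iso _) (cohomology0_int n0 nm).
case=> // i _; apply: zmod_trivial_iso (iso _) _.
by apply: cohomology_trivialS; apply: Qd_contractible_high; lia.
Qed.
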